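(* Let $\Omega\subset\mathbb R^3$ be a bounded Lipschitz domain, $T>0$, and let $\varepsilon,\mu,\sigma\in L^\infty(\Omega;\mathbb R^{3\times3})$ be symmetric tensor fields such that, for some constants $\varepsilon_0,\mu_0>0$, $\xi^\top\varepsilon(x)\xi\ge\varepsilon_0|\xi|^2$ and $\xi^\top\mu(x)\xi\ge\mu_0|\xi|^2$ for all $\xi\in\mathbb R^3$ and a.e. $x\in\Omega$, and $\sigma(x)$ is positive semi-definite a.e. Let $f\in L^2(0,T;L^2(\Omega)^3)$ and $E_0,B_0\in L^2(\Omega)^3$ with $\operatorname{div}B_0=0$ in $L^2(\Omega)$. Let $(E_h,B_h)$, with $E_h\in H^1(0,T;\mathcal N_h^0)$ and $B_h\in H^1(0,T;\mathcal{RT}_h)$, be the solution of the semi-discrete Maxwell scheme with these data described in the context. Define $$\mathcal E_h(t):=\tfrac12\big(\|\sqrt\varepsilon E_h(t)\|_{L^2}^2+\|\sqrt{\mu^{-1}}B_h(t)\|_{L^2}^2\big).$$ Then for a.e. $t$, $$\frac{d}{dt}\mathcal E_h(t)+\|\sqrt\sigma E_h(t)\|_{L^2}^2=(f(t),E_h(t)).$$ Consequently, $$\sup_{0\le t\le T}\mathcal E_h(t)\le e^T\mathcal E_h(0)+\frac{e^T}{2\varepsilon_0}\int_0^T\|f(s)\|_{L^2}^2\,ds,$$ and hence $$\|E_h\|_{L^\infty(0,T;L^2(\Omega)^3)}+\|B_h\|_{L^\infty(0,T;L^2(\Omega)^3)}\le C_T\big(\|f\|_{L^2(0,T;L^2(\Omega)^3)}+\|E_0\|_{L^2(\Omega)^3}+\|B_0\|_{L^2(\Omega)^3}\big),$$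 with $C_T$ independent of $h$.
   Context: $(\cdot,\cdot)$ is the $L^2$ scalar product on $\Omega$. $H(\operatorname{curl};\Omega)$ and $H(\operatorname{div};\Omega)$ are the spaces of $L^2(\Omega)^3$ fields with curl, respectively divergence, in $L^2$; $H_0(\operatorname{curl};\Omega)$ is the subspace of $H(\operatorname{curl};\Omega)$ with vanishing tangential trace. $\{\mathcal T_h\}_h$ is a shape-regular family of tetrahedral meshes of $\Omega$ with mesh size $h\to0$, and $k\ge0$ is fixed. Spaces: $\mathcal N_h^0=\{v_h\in H_0(\operatorname{curl};\Omega):v_h|_K\in\mathcal N_k(K)\ \forall K\in\mathcal T_h\}$, $\mathcal{RT}_h=\{w_h\in H(\operatorname{div};\Omega):w_h|_K\in\mathcal{RT}_k(K)\ \forall K\in\mathcal T_h\}$, $\mathcal Q_h=\{q_h\in L^2(\Omega):q_h|_K\in\mathbb P_k(K)\ \forall K\in\mathcal T_h\}$, where $\mathcal N_k(K)=\mathbb P_k(K)^3+x\times\widetilde{\mathbb P}_k(K)^3$ (Nédélec, first kind), $\mathcal{RT}_k(K)=\mathbb P_k(K)^3+x\,\widetilde{\mathbb P}_k(K)$ (Raviart–Thomas), and $\mathbb P_k$ ($\widetilde{\mathbb P}_k$) denotes polynomials of degree $\le k$ (homogeneous of degree $k$). One has $\operatorname{curl}\mathcal N_h^0\subset\mathcal{RT}_h$. Semi-discrete scheme: for a.e. $t\in(0,T)$, $$(\varepsilon\partial_tE_h,\psi_h)+(\sigma E_h,\psi_h)-(\mu^{-1}B_h,\operatorname{curl}\psi_h)=(f,\psi_h)\quad\forall\psi_h\in\mathcal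 N_h^0,$$ $$(\partial_tB_h,\phi_h)+(\operatorname{curl}E_h,\phi_h)=0\quad\forall\phi_h\in\mathcal{RT}_h,$$ with initial data: $E_h(0)$ is the $L^2(\Omega)^3$-orthogonal projection of $E_0$ onto $\mathcal N_h^0$, and $B_h(0)\in\mathcal{RT}_h$ satisfies $(\operatorname{div}B_h(0),q_h)=0$ for all $q_h\in\mathcal Q_h$ and $\|B_h(0)-B_0\|_{L^2(\Omega)^3}\to0$ as $h\to0$ (an example being the $L^2$-orthogonal projection of $B_0$ onto $\{v_h\in\mathcal{RT}_h:\operatorname{div}v_h=0\}$).
   Formalization: The last estimate fails if f, E_0, B_0 vanish but B_h(0) does not; it is proved for nonzero data (C_T independent of h, may depend on the data; data-independent C_T for small h) and, with data-independent C_T, whenever ‖B_h(0)‖ ≤ ‖B_0‖. *)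

(* Defs.v *)
From HB Require Import structures.
From mathcomp Require Import all_boot all_order all_algebra.
From mathcomp Require Import all_classical all_reals all_analysis ess_sup_inf.
(* A full import would make the notations of mpoly clash with those of analysis. *)
From mathcomp Require mpoly.
Import (canonicals, coercions) mpoly.

Set Implicit Arguments.
Unset Strict Implicit.
Unset Printing Implicit Defensive.

Import Order.TTheory GRing.Theory Num.Theory.
Import numFieldNormedType.Exports.

Local Open Scope classical_set_scope.
Local Open Scope ring_scope.

(* A point of R^3 is a triple, so that Lebesgue measure on R^3 is the product
   measure and the product topology applies; vectors are columns, and [vec]
   identifies the two. *)
Notation pt R := (R * R * R)%type.
Notation vect R := 'cV[R]_3.
Notation vfield R := (R * R * R -> 'cV[R]_3)%type.
Notation tensor R := (R * R * R -> 'M[R]_3)%type.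

Section Maxwell.
Context {R : realType}.

Local Notation leb := (@lebesgue_measure R).
Definition leb3 := (leb \x leb \x leb)%E.

Definition vec (x : pt R) : vect R :=
  \col_i (if i == 0 then x.1.1 else if i == 1 then x.1.2 else x.2).

Definition basis (i : 'I_3) : pt R :=
  ((i == 0)%:R, (i == 1)%:R, (i == 2%:R)%:R).

Definition dot (n : nat) (u v : 'cV[R]_n) : R := (u^T *m v) 0 0.
Definition enorm (n : nat) (u : 'cV[R]_n) : R := Num.sqrt (dot u u).

(* Indices are cyclic: addition in 'I_3 is modulo 3. *)
Definition cross (u v : vect R) : vect R :=
  \col_i (u (i + 1) 0 * v (i + 2%:R) 0 - u (i + 2%:R) 0 * v (i + 1) 0).

Definition psd (n : nat) (A : 'M[R]_n) : Prop :=
  forall xi : 'cV[R]_n, 0 <= (xi^T *m A *m xi) 0 0.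

(* The symmetric positive semi-definite square root of a symmetric positive
   semi-definite matrix, which exists and is unique; 0 is a junk value. *)
Definition msqrt (n : nat) (A : 'M[R]_n) : 'M[R]_n :=
  xget 0 [set S | [/\ S^T = S, psd S & S *m S = A]].

Definition ip (Omega : set (pt R)) (u v : vfield R) : R :=
  \int[leb3]_(x in Omega) dot (u x) (v x).
Definition norm2 (Omega : set (pt R)) (u : vfield R) : R :=
  Num.sqrt (ip Omega u u).
Definition sip (Omega : set (pt R)) (p q : pt R -> R) : R :=
  \int[leb3]_(x in Omega) (p x * q x).

Definition L2s (Omega : set (pt R)) (q : pt R -> R) : Prop :=
  measurable_fun Omega q /\ leb3.-integrable Omega (fun x => (q x ^+ 2)%:E).
Definition L2 (Omega : set (pt R)) (u : vfield R) : Prop :=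
  forall i, L2s Omega (fun x => u x i 0).

Definition Linfty_tensor (Omega : set (pt R)) (A : tensor R) : Prop :=
  (forall i j, measurable_fun Omega (fun x => A x i j)) /\
  exists M : R, {ae leb3, forall x, Omega x -> forall i j, `|A x i j| <= M}.

Definition sym_tensor (Omega : set (pt R)) (A : tensor R) : Prop :=
  {ae leb3, forall x, Omega x -> (A x)^T = A x}.
Definition coercive (Omega : set (pt R)) (a : R) (A : tensor R) : Prop :=
  {ae leb3, forall x, Omega x ->
    forall xi : vect R, a * enorm xi ^+ 2 <= (xi^T *m A x *m xi) 0 0}.
Definition psd_tensor (Omega : set (pt R)) (A : tensor R) : Prop :=
  {ae leb3, forall x, Omega x -> psd (A x)}.

Definition act (A : tensor R) (u : vfield R) : vfield R := fun x => A x *m u x.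
Definition tinv (A : tensor R) : tensor R := fun x => invmx (A x).
Definition tsqrt (A : tensor R) : tensor R := fun x => msqrt (A x).

Definition partial (i : 'I_3) (p : pt R -> R) : pt R -> R :=
  fun x => 'D_(basis i) p x.

(* C^oo(R^3): every iterated partial derivative exists and is continuous. *)
Definition smooth (p : pt R -> R) : Prop :=
  forall s : seq 'I_3, let d := foldr partial p s in
    (forall (x : pt R) i, derivable d x (basis i)) /\
    continuous d.

Definition test (U : set (pt R)) (p : pt R -> R) : Prop :=
  smooth p /\
  exists K : set (pt R),
    [/\ compact K, K `<=` U & forall x, ~ K x -> p x = 0].
Definition vtest (U : set (pt R)) (phi : vfield R) : Prop :=
  forall i, test U (fun x => phi x i 0).

Definition grad (p : pt R -> R) : vfield R := fun x => \col_i partial i p x.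
(* Classical curl of a smooth field, with cyclic indices as in [cross]. *)
Definition rot (phi : vfield R) : vfield R := fun x =>
  \col_i (partial (i + 1) (fun y => phi y (i + 2%:R) 0) x
          - partial (i + 2%:R) (fun y => phi y (i + 1) 0) x).

Definition weak_curl (Omega : set (pt R)) (u w : vfield R) : Prop :=
  L2 Omega w /\
  forall phi, vtest Omega phi -> ip Omega w phi = ip Omega u (rot phi).
Definition weak_div (Omega : set (pt R)) (u : vfield R) (d : pt R -> R) : Prop :=
  L2s Omega d /\
  forall p, test Omega p -> sip Omega d p = - ip Omega u (grad p).

(* Representatives of the weak curl and weak divergence, which are unique up to
   null sets; 0 is a junk value outside H(curl) and H(div). *)
Definition curl (Omega : set (pt R)) (u : vfield R) : vfield R :=
  xget (fun=> 0) [set w | weak_curl Omega u w].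
Definition div (Omega : set (pt R)) (u : vfield R) : pt R -> R :=
  xget (fun=> 0) [set d | weak_div Omega u d].

Definition Hcurl (Omega : set (pt R)) (u : vfield R) : Prop :=
  L2 Omega u /\ exists w, weak_curl Omega u w.
Definition Hdiv (Omega : set (pt R)) (u : vfield R) : Prop :=
  L2 Omega u /\ exists d, weak_div Omega u d.

(* The tangential trace n x u is the functional on the boundary given by
   Green's formula, <n x u, phi> = (curl u, phi) - (u, curl phi); here phi runs
   over restrictions to Omega of smooth fields that need not vanish on the
   boundary. *)
Definition Hcurl0 (Omega : set (pt R)) (u : vfield R) : Prop :=
  Hcurl Omega u /\
  forall phi, vtest setT phi ->
    ip Omega (curl Omega u) phi = ip Omega u (rot phi).

(* Near each boundary point, after an orthogonal change of coordinates, Omega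
   is the region strictly above the graph of a Lipschitz function. *)
Definition lipschitz_boundary (Omega : set (pt R)) : Prop :=
  forall x, (closure Omega `\` Omega) x ->
    exists (Q : 'M[R]_3) (r L : R) (gamma : 'cV[R]_2 -> R),
      [/\ Q^T *m Q = 1%:M, 0 < r, L.-lipschitz gamma &
        forall y : pt R, enorm (vec y - vec x) < r ->
          (Omega y <->
           gamma (usubmx (Q *m vec y : 'cV[R]_(2 + 1)))
             < dsubmx (Q *m vec y : 'cV[R]_(2 + 1)) 0 0)].

Definition bounded_lipschitz_domain (Omega : set (pt R)) : Prop :=
  [/\ open Omega, connected Omega, Omega !=set0, bounded_set Omega
    & lipschitz_boundary Omega].

(* A tetrahedron is given by the 3 x 4 matrix of its vertices (as columns);
   [face K I] is the convex hull of the vertices with index in I, in particular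
   it is empty when I is. *)
Definition face (K : 'M[R]_(3, 4)) (I : {set 'I_4}) : set (pt R) :=
  [set x | exists l : 'cV[R]_4,
     [/\ forall i, 0 <= l i 0, forall i, i \notin I -> l i 0 = 0,
         \sum_i l i 0 = 1 & vec x = K *m l]].
Definition hull (K : 'M[R]_(3, 4)) : set (pt R) := face K [set: 'I_4]%SET.

Definition nondegenerate (K : 'M[R]_(3, 4)) : Prop :=
  (col_mx K (const_mx 1 : 'M[R]_(1, 4)) : 'M[R]_4) \in unitmx.

(* Conforming mesh: two distinct tetrahedra meet in a common proper face, which
   is possibly empty. *)
Definition mesh (Omega : set (pt R)) (Th : seq 'M[R]_(3, 4)) : Prop :=
  [/\ forall K, K \in Th -> nondegenerate K,
      [set x | exists2 K, K \in Th & hull K x] = closure Omega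
    & forall K K', K \in Th -> K' \in Th -> K != K' ->
        exists I I' : {set 'I_4},
          [/\ I != [set: 'I_4]%SET, I' != [set: 'I_4]%SET,
              hull K `&` hull K' = face K I
            & hull K `&` hull K' = face K' I']].

Definition diam (K : 'M[R]_(3, 4)) : R :=
  sup [set d | exists x y, [/\ hull K x, hull K y & d = enorm (vec x - vec y)]].
(* Diameter of the largest inscribed ball. *)
Definition inball (K : 'M[R]_(3, 4)) : R :=
  sup [set d | exists (c : pt R) (r : R),
    [/\ 0 <= r, forall y, enorm (vec y - vec c) <= r -> hull K y & d = 2 * r]].

Definition mesh_size (Th : seq 'M[R]_(3, 4)) : R :=
  \big[Num.max/0]_(K <- Th) diam K.

Definition shape_regular (Th : nat -> seq 'M[R]_(3, 4)) : Prop :=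
  exists kappa : R, forall n K, K \in Th n -> diam K <= kappa * inball K.

Local Notation poly3 := (mpoly.mpoly 3 R).

Definition peval (p : poly3) (x : pt R) : R :=
  mpoly.meval (fun i => vec x i 0) p.
Definition pveval (p : 'I_3 -> poly3) : vfield R := fun x => \col_i peval (p i) x.

(* [msize] is the degree plus one, and 0 for the zero polynomial. *)
Definition deg_le (k : nat) (p : poly3) : Prop := (mpoly.msize p <= k.+1)%N.
Definition homog (k : nat) (p : poly3) : Prop :=
  p \is mpoly.ishomog1 k mpoly.mdeg.

Definition nedelec (k : nat) (v : vfield R) : Prop :=
  exists p q : 'I_3 -> poly3,
    [/\ forall i, deg_le k (p i), forall i, homog k (q i)
      & forall x, v x = pveval p x + cross (vec x) (pveval q x)].
Definition raviart_thomas (k : nat) (v : vfield R) : Prop :=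
  exists (p : 'I_3 -> poly3) (q : poly3),
    [/\ forall i, deg_le k (p i), homog k q
      & forall x, v x = pveval p x + peval q x *: vec x].

Definition piecewise (V : Type) (Th : seq 'M[R]_(3, 4)) (P : (pt R -> V) -> Prop)
    (v : pt R -> V) : Prop :=
  forall K, K \in Th ->
    exists2 w, P w & {ae leb3, forall x, hull K x -> v x = w x}.

Definition Nh0 (Omega : set (pt R)) (k : nat) (Th : seq 'M[R]_(3, 4)) :
    set (vfield R) :=
  [set v | Hcurl0 Omega v /\ piecewise Th (nedelec k) v].
Definition RTh (Omega : set (pt R)) (k : nat) (Th : seq 'M[R]_(3, 4)) :
    set (vfield R) :=
  [set w | Hdiv Omega w /\ piecewise Th (raviart_thomas k) w].
Definition Qh (Omega : set (pt R)) (k : nat) (Th : seq 'M[R]_(3, 4)) :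
    set (pt R -> R) :=
  [set q | L2s Omega q /\
     piecewise Th (fun w => exists2 p, deg_le k p & w = peval p) q].

Definition simple_in_time (Omega : set (pt R)) (s : R -> vfield R) : Prop :=
  exists (n : nat) (A : 'I_n -> set R) (v : 'I_n -> vfield R),
    [/\ forall i, measurable (A i), forall i, L2 Omega (v i)
      & forall t x, s t x = \sum_i \1_(A i) t *: v i x].

(* L^2(0,T;L^2(Omega)^3): strongly measurable and square integrable. *)
Definition L2t (Omega : set (pt R)) (T : R) (u : R -> vfield R) : Prop :=
  [/\ {ae leb, forall t, t \in `]0, T[ -> L2 Omega (u t)},
      exists s : nat -> R -> vfield R,
        (forall n, simple_in_time Omega (s n)) /\
        {ae leb, forall t, t \in `]0, T[ ->
           (fun n => norm2 Omega (fun x => s n t x - u t x)) @ \oo --> (0 : R)}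
    & (\int[leb]_(t in `]0%R, T[) ((norm2 Omega (u t)) ^+ 2)%:E < +oo)%E].

Definition norm_L2t (Omega : set (pt R)) (T : R) (u : R -> vfield R) : R :=
  Num.sqrt (\int[leb]_(t in `]0, T[) (norm2 Omega (u t)) ^+ 2).

Definition norm_Linft (Omega : set (pt R)) (T : R) (u : R -> vfield R) : \bar R :=
  ess_sup leb ((fun t => (norm2 Omega (u t))%:E) \_ `]0, T[).

(* [u] is the continuous representative of an element of H^1(0,T;V), where V is
   a subspace of L^2(Omega)^3 normed by the L^2 norm, and [du] is its time
   derivative: u(t) = u(0) + \int_0^t du(s) ds, where the Bochner integral is
   characterised by its scalar products with the elements of L^2(Omega)^3.
   Below V is finite-dimensional, so that the choice of norm is immaterial. *)
Definition H1t (Omega : set (pt R)) (T : R) (V : set (vfield R))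
    (u du : R -> vfield R) : Prop :=
  [/\ forall t, t \in `[0, T] -> V (u t),
      {ae leb, forall t, t \in `]0, T[ -> V (du t)},
      L2t Omega T u, L2t Omega T du
    & forall v, L2 Omega v -> forall t, t \in `[0, T] ->
        ip Omega (u t) v
        = ip Omega (u 0) v + \int[leb]_(s in `]0, t[) ip Omega (du s) v].

Definition semidiscrete (Omega : set (pt R)) (T : R) (eps mu sigma : tensor R)
    (f : R -> vfield R) (k : nat) (Th : seq 'M[R]_(3, 4)) (E B : R -> vfield R) :
    Prop :=
  exists dE dB : R -> vfield R,
    [/\ H1t Omega T (Nh0 Omega k Th) E dE,
        H1t Omega T (RTh Omega k Th) B dB,
        {ae leb, forall t, t \in `]0, T[ -> forall psi, Nh0 Omega k Th psi ->
           ip Omega (act eps (dE t)) psi + ip Omega (act sigma (E t)) psi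
           - ip Omega (act (tinv mu) (B t)) (curl Omega psi)
           = ip Omega (f t) psi}
      & {ae leb, forall t, t \in `]0, T[ -> forall phi, RTh Omega k Th phi ->
           ip Omega (dB t) phi + ip Omega (curl Omega (E t)) phi = 0}].

Definition L2_projection (Omega : set (pt R)) (V : set (vfield R))
    (u v : vfield R) : Prop :=
  V v /\ forall psi, V psi -> ip Omega v psi = ip Omega u psi.

Definition discretely_div_free (Omega : set (pt R)) (k : nat)
    (Th : seq 'M[R]_(3, 4)) (v : vfield R) : Prop :=
  RTh Omega k Th v /\
  forall q, Qh Omega k Th q -> sip Omega (div Omega v) q = 0.

Definition energy (Omega : set (pt R)) (eps mu : tensor R) (E B : R -> vfield R)
    (t : R) : R :=
  2^-1 * (norm2 Omega (act (tsqrt eps) (E t)) ^+ 2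
          + norm2 Omega (act (tsqrt (tinv mu)) (B t)) ^+ 2).

Definition stability_bound (Omega : set (pt R)) (T C : R) (f : R -> vfield R)
    (E0 B0 : vfield R) (E B : R -> vfield R) : Prop :=
  (norm_Linft Omega T E + norm_Linft Omega T B
   <= (C * (norm_L2t Omega T f + norm2 Omega E0 + norm2 Omega B0))%:E)%E.

End Maxwell.

(* Main.v *)
Require Import Defs.
From HB Require Import structures.
From mathcomp Require Import all_boot all_order all_algebra.
From mathcomp Require Import all_classical all_reals all_analysis ess_sup_inf measurable_realfun.
From mathcomp Require Import ring lra.
From mathcomp Require mpoly.
Import (canonicals, coercions) mpoly.
From mathcomp Require complex.
Import (canonicals, coercions) complex.
Import Order.TTheory GRing.Theory Num.Theory.
Import numFieldNormedType.Exports.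
Set Implicit Arguments.
Unset Strict Implicit.
Unset Printing Implicit Defensive.
Local Open Scope classical_set_scope.
Local Open Scope ring_scope.

(** The energy identity comes from testing the first equation of the scheme with
    E_h(t) and reading the second one as Faraday's law: the curl of a field of
    N_h^0 lies in RT_h, so that d_t B_h = - curl E_h almost everywhere on Omega
    ([faraday_strong]), and by symmetry of mu^-1 the coupling term
    (mu^-1 B_h, curl E_h) is minus the derivative of the magnetic energy
    ([energy_AC]).  The energy may be differentiated because the discrete
    spaces are finite-dimensional: in an orthonormal basis it is a quadratic
    polynomial in finitely many coordinates, each of which is the primitive of an
    integrable function of time ([AC_quadratic]).  Primitives are stable under
    products ([AC_M], which is Fubini's theorem on a square cut along its
    diagonal) and are differentiable almost everywhere ([AC_derivable]).

    The derivative of the energy exceeds the energy by at most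
    |f|^2 / (2 eps0), since the energy is at least eps0 |E_h|^2 / 2; Gronwall's
    inequality ([gronwall]) then yields the bound on the supremum, and coercivity
    of eps and mu^-1 the bounds on the two fields ([stability]).  The constant
    involves the initial energy, hence |B_h(0)|, which the convergence of B_h(0)
    to B_0 compares with the data.

    The inclusion of curl N_h^0 in RT_h ([curl_in_RTh]) has to be derived from the
    weak definition of the curl.  On the interior of a cell the field is a
    polynomial; testing with products of one-variable bump functions and
    integrating by parts one coordinate at a time shows that its weak curl has the
    same integral as the curl of the polynomial over every small box, so that both
    agree almost everywhere ([zero_of_octants], [weak_curl_polynomial]).  The
    weak divergence of a weak curl vanishes because second derivatives of test
    functions commute ([mixed_partials]), and the cell boundaries, being contained
    in planes, are null sets ([plane_null]).

    Norms of time-dependent fields are only almost-everywhere limits of measurable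
    functions, and Lebesgue measure is not completed.  The estimates that involve
    them rest on the monotonicity of the integral as a supremum over simple
    functions, which does not ask for measurability
    ([ae_ge0_le_lower_integral]). *)

(** * Integrals of functions that need not be measurable *)

Section LowerIntegral.
Import HBNNSimple.
Context d (X : measurableType d) (R : realType).
Variable mu : {measure set X -> \bar R}.
Implicit Types D : set X.

(** The integral of a nonnegative function is the supremum of the integrals of
    the simple functions below it. Set to 0 on the exceptional null set, a
    simple function below f lies below g and keeps its integral; f and g
    themselves may fail to be measurable. *)
Lemma ae_ge0_le_lower_integral D (f g : X -> \bar R) :
  (forall x, 0 <= f x)%E -> (forall x, 0 <= g x)%E ->
  {ae mu, forall x, D x -> (f x <= g x)%E} ->
  (\int[mu]_(x in D) f x <= \int[mu]_(x in D) g x)%E.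
Proof.
move=> f0 g0 [N [mN N0 fgN]].
rewrite (integral_mkcond _ f) (integral_mkcond _ g).
have pf x : (0 <= (f \_ D) x)%E by rewrite patchE; case: ifP.
have pg x : (0 <= (g \_ D) x)%E by rewrite patchE; case: ifP.
rewrite ge0_integralTE//; apply: ge_ereal_sup => _ [h /= hf <-].
have mNc : measurable (~` N) by exact: measurableC.
pose h' := proj_nnsfun h mNc.
rewrite -integralT_nnsfun.
rewrite (_ : (\int[mu]_x (h x)%:E)%E = (\int[mu]_x (h' x)%:E)%E); last first.
  apply: ge0_ae_eq_integral => //.
  - by apply/measurable_EFinP; exact: measurable_funP.
  - by apply/measurable_EFinP; exact: measurable_funP.
  - by move=> x _; rewrite lee_fin fun_ge0.
  - by move=> x _; rewrite lee_fin fun_ge0.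
  exists N; split => // x /= hx; apply: contrapT => Nx; apply: hx => _.
  by rewrite mindicE mem_set// mulr1.
rewrite integralT_nnsfun ge0_integralTE//.
apply: ereal_sup_ubound; exists h' => //= x.
rewrite mindicE; case: (boolP (x \in ~` N)) => [|_]; last by rewrite mulr0.
rewrite inE => Nx; rewrite mulr1 (le_trans (hf x))// !patchE; case: ifPn => // Dx.
apply: contrapT => fgx; apply: Nx; apply: fgN => /= /(_ (set_mem Dx)).
by move=> ?; apply: fgx.
Qed.

Lemma ae_eq_lower_integral D (f g : X -> \bar R) :
  {ae mu, forall x, D x -> f x = g x} ->
  (\int[mu]_(x in D) f x = \int[mu]_(x in D) g x)%E.
Proof.
move=> fg; rewrite integralE [RHS]integralE.
by congr (_ - _)%E; apply/eqP; rewrite eq_le; apply/andP; split;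
  apply: ae_ge0_le_lower_integral => //; apply: filterS fg => x /= fg Dx;
  rewrite ?funeposE ?funenegE fg.
Qed.

Lemma ae_eq_Rintegral D (f g : X -> R) :
  {ae mu, forall x, D x -> f x = g x} ->
  \int[mu]_(x in D) f x = \int[mu]_(x in D) g x.
Proof.
move=> fg; rewrite /Rintegral; congr fine; apply: ae_eq_lower_integral.
by apply: filterS fg => x /= fg Dx; rewrite fg.
Qed.

Lemma integrable_EFinD D (f g : X -> R) : measurable D ->
  mu.-integrable D (EFin \o f) -> mu.-integrable D (EFin \o g) ->
  mu.-integrable D (EFin \o (fun x => f x + g x)).
Proof.
move=> mD fi gi; have := integrableD mD fi gi.
by apply: eq_integrable => // x _.
Qed.

Lemma integrable_EFinZl D (c : R) (f : X -> R) : measurable D ->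
  mu.-integrable D (EFin \o f) -> mu.-integrable D (EFin \o (fun x => c * f x)).
Proof.
move=> mD fi; have := integrableZl mD c fi.
by apply: eq_integrable => // x _.
Qed.

Lemma integrable_EFin_sum D (I : Type) (r : seq I) (F : I -> X -> R) :
  measurable D -> (forall i, mu.-integrable D (EFin \o F i)) ->
  mu.-integrable D (EFin \o (fun x => \sum_(i <- r) F i x)).
Proof.
move=> mD Fi; elim: r => [|i r IH].
  rewrite (_ : _ \o _ = cst 0%E); first exact: integrable0.
  by apply/funext => x /=; rewrite big_nil.
rewrite (_ : _ \o _ = EFin \o (fun x => F i x + \sum_(j <- r) F j x)).
  exact: integrable_EFinD.
by apply/funext => x /=; rewrite big_cons.
Qed.

Lemma integrable_EFin_patch D (f : X -> R) : measurable D ->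
  mu.-integrable D (EFin \o f) = mu.-integrable setT (EFin \o (f \_ D)).
Proof.
by move=> mD; rewrite -restrict_EFin; apply/idP/idP;
  by move=> /(integrable_mkcond (EFin \o f) mD).
Qed.

Lemma le_ae_Rintegral D (f g : X -> R) : measurable D ->
  mu.-integrable D (EFin \o f) -> mu.-integrable D (EFin \o g) ->
  {ae mu, forall x, D x -> f x <= g x} ->
  \int[mu]_(x in D) f x <= \int[mu]_(x in D) g x.
Proof.
move=> mD fi gi fg; rewrite -subr_ge0 -RintegralB//.
rewrite (@ae_eq_Rintegral _ _ (fun x => Num.max (g x - f x) 0)).
  by apply: Rintegral_ge0 => x _; rewrite le_max lexx orbT.
by apply: filterS fg => x /= fg Dx; rewrite max_l// subr_ge0 fg.
Qed.

End LowerIntegral.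

#[local] Instance leb_ae_filter (R : realType) :
  Filter (almost_everywhere (@lebesgue_measure R)).
Proof. exact: (ae_filter_ringOfSetsType lebesgue_measure). Qed.

(** * Square-integrable vector fields *)

Section Boxes.
Context {R : realType}.
Implicit Types (U : set (pt R)) (a b x : pt R).

Definition obox a b : set (pt R) :=
  `]a.1.1, b.1.1[ `*` `]a.1.2, b.1.2[ `*` `]a.2, b.2[.
Definition cbox a b : set (pt R) :=
  `[a.1.1, b.1.1] `*` `[a.1.2, b.1.2] `*` `[a.2, b.2].

Definition ratpt (q : rat * rat * rat) : pt R :=
  (ratr q.1.1, ratr q.1.2, ratr q.2).

Lemma rat_itv_in_ball (x e : R) : 0 < e ->
  exists p q : rat, x - e < ratr p < x /\ x < ratr q < x + e.
Proof.
move=> e0; have [|p pP] := @rat_in_itvoo R (x - e) x; first by rewrite ltrBlDr ltrDl.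
have [|q qP] := @rat_in_itvoo R x (x + e); first by rewrite ltrDl.
by exists p, q.
Qed.

Lemma measurable_obox a b : measurable (obox a b).
Proof. by apply: measurableX => //; apply: measurableX. Qed.

Lemma measurable_cbox a b : measurable (cbox a b).
Proof. by apply: measurableX => //; apply: measurableX. Qed.

Lemma open_rat_box U x : open U -> U x ->
  exists p q, obox (ratpt p) (ratpt q) x /\ cbox (ratpt p) (ratpt q) `<=` U.
Proof.
move=> oU Ux; have /nbhs_ballP[e /= e0 eU] := open_nbhs_nbhs (conj oU Ux).
have [p1 [q1 [/andP[h11 h12] /andP[h13 h14]]]] := rat_itv_in_ball x.1.1 e0.
have [p2 [q2 [/andP[h21 h22] /andP[h23 h24]]]] := rat_itv_in_ball x.1.2 e0.
have [p3 [q3 [/andP[h31 h32] /andP[h33 h34]]]] := rat_itv_in_ball x.2 e0.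
exists (p1, p2, p3), (q1, q2, q3); split.
  by split; [split|]; rewrite /= in_itv/=; apply/andP.
move=> y [[]] /=; rewrite !in_itv/= => /andP[y1 y1'] /andP[y2 y2'] /andP[y3 y3'].
apply: eU; split; [split|]; rewrite /ball /= ltr_norml; lra.
Qed.

(** Rational corners make the union countable, so that a property almost
    everywhere on U can be checked box by box; the closed boxes are kept
    inside U in order that functions supported in them be test functions of U. *)
Lemma open_bigcup_box U : open U ->
  U = \bigcup_(i in [set i : (rat * rat * rat) * (rat * rat * rat) |
        cbox (ratpt i.1) (ratpt i.2) `<=` U]) obox (ratpt i.1) (ratpt i.2).
Proof.
move=> oU; apply/seteqP; split => [x Ux|x [i /= iU ix]].
  by have [p [q [pq1 pq2]]] := open_rat_box oU Ux; exists (p, q).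
apply: iU; case: ix => -[] /=; rewrite !in_itv /= => /andP[? ?] /andP[? ?] /andP[? ?].
by split; [split|] => /=; rewrite in_itv/=; apply/andP; split; apply: ltW.
Qed.

Lemma open_measurable3 U : open U -> measurable U.
Proof.
move=> /open_bigcup_box ->; rewrite bigcup_mkcond.
apply: countable_bigcupT_measurable => [|i]; first exact: countableP.
by case: ifP => _; [exact: measurable_obox|exact: measurable0].
Qed.

End Boxes.

#[local] Instance leb3_ae_filter (R : realType) :
  Filter (almost_everywhere (@leb3 R)).
Proof. exact: ae_filter_ringOfSetsType. Qed.

Section L2space.
Context {R : realType} (Omega : set (pt R)).
Hypothesis mOmega : measurable Omega.
Local Notation mu := (@leb3 R).
Implicit Types (f g p q : pt R -> R) (u v w : vfield R) (A : tensor R).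

Lemma ae_le_integrable f g : measurable_fun Omega f ->
  {ae mu, forall x, Omega x -> `|f x| <= `|g x|} ->
  mu.-integrable Omega (EFin \o g) -> mu.-integrable Omega (EFin \o f).
Proof.
move=> mf fg /integrableP[mg ig]; apply/integrableP; split; first exact/measurable_EFinP.
apply: le_lt_trans ig; apply: ae_ge0_le_lower_integral => //.
Qed.

Lemma L2s_mul_integrable f g : L2s Omega f -> L2s Omega g ->
  mu.-integrable Omega (EFin \o (fun x => f x * g x)).
Proof.
move=> [mf if2] [mg ig2].
apply: (@ae_le_integrable _ (fun x => f x ^+ 2 + g x ^+ 2)).
- exact: measurable_funM.
- apply: aeW => x _; rewrite normrM [leRHS]ger0_norm ?addr_ge0 ?sqr_ge0//.
  rewrite -[f x ^+ 2]real_normK ?num_real// -[g x ^+ 2]real_normK ?num_real//.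
  have := normr_ge0 (f x); have := normr_ge0 (g x); nra.
- exact: integrable_EFinD.
Qed.

Lemma L2sD f g : L2s Omega f -> L2s Omega g -> L2s Omega (fun x => f x + g x).
Proof.
move=> Lf Lg; have fg := L2s_mul_integrable Lf Lg.
case: Lf Lg => mf f2 [mg g2]; split; first exact: measurable_funD.
have -> : (fun x => ((f x + g x) ^+ 2)%:E) =
   EFin \o (fun x => f x ^+ 2 + g x ^+ 2 + 2 * (f x * g x)).
  by apply/funext => x /=; congr EFin; ring.
by apply: integrable_EFinD => //; [exact: integrable_EFinD|exact: integrable_EFinZl].
Qed.

Lemma L2s_bounded_mul (a f : pt R -> R) (M : R) : measurable_fun Omega a ->
  {ae mu, forall x, Omega x -> `|a x| <= M} ->
  L2s Omega f -> L2s Omega (fun x => a x * f x).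
Proof.
move=> ma aM [mf f2]; split; first exact: measurable_funM.
apply: (@ae_le_integrable _ (fun x => M ^+ 2 * f x ^+ 2)).
- by apply: measurable_funX; exact: measurable_funM.
- apply: filterS aM => x /= aM Ox; rewrite exprMn !normrM ler_wpM2r//.
  have aM' : `|a x| <= `|M| by rewrite (le_trans (aM Ox))// ler_norm.
  exact: ler_pM.
- exact: integrable_EFinZl.
Qed.

Lemma L2sZ (c : R) f : L2s Omega f -> L2s Omega (fun x => c * f x).
Proof.
by apply: (@L2s_bounded_mul (fun=> c) f `|c|) => //; exact: aeW.
Qed.

Lemma L2s0 : L2s Omega (fun=> 0).
Proof.
split; first exact: measurable_cst.
by under eq_fun do rewrite expr0n/=; exact: integrable0.
Qed.

Lemma L2s_sum (I : Type) (r : seq I) (F : I -> pt R -> R) :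
  (forall i, L2s Omega (F i)) -> L2s Omega (fun x => \sum_(i <- r) F i x).
Proof.
move=> LF; elim: r => [|i r IH].
  by under eq_fun do rewrite big_nil; exact: L2s0.
by under eq_fun do rewrite big_cons; exact: L2sD.
Qed.

Lemma L2D u v : L2 Omega u -> L2 Omega v -> L2 Omega (fun x => u x + v x).
Proof. by move=> Lu Lv i; under eq_fun do rewrite mxE; exact: L2sD. Qed.

Lemma L2Z (c : R) u : L2 Omega u -> L2 Omega (fun x => c *: u x).
Proof. by move=> Lu i; under eq_fun do rewrite mxE; exact: L2sZ. Qed.

Lemma L2B u v : L2 Omega u -> L2 Omega v -> L2 Omega (fun x => u x - v x).
Proof.
move=> Lu Lv; under eq_fun do rewrite -scaleN1r.
by apply: L2D => //; exact: L2Z.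
Qed.

Lemma L2_0 : L2 Omega (fun=> 0).
Proof. by move=> i; under eq_fun do rewrite mxE; exact: L2s0. Qed.

Lemma L2_sum (I : Type) (r : seq I) (F : I -> vfield R) :
  (forall i, L2 Omega (F i)) -> L2 Omega (fun x => \sum_(i <- r) F i x).
Proof.
move=> LF i; under eq_fun do rewrite summxE.
by apply: L2s_sum => j; exact: LF.
Qed.

Lemma L2_act A u : Linfty_tensor Omega A -> L2 Omega u -> L2 Omega (act A u).
Proof.
move=> [mA [M AM]] Lu i; rewrite /act; under eq_fun do rewrite mxE.
apply: L2s_sum => j; apply: (@L2s_bounded_mul _ _ M) => //.
by apply: filterS AM => x /= AM Ox; exact: AM.
Qed.

Lemma dotE (n : nat) (a b : 'cV[R]_n) : dot a b = \sum_i a i 0 * b i 0.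
Proof. by rewrite /dot mxE; apply: eq_bigr => i _; rewrite mxE. Qed.

Lemma dotC (n : nat) (a b : 'cV[R]_n) : dot a b = dot b a.
Proof. by rewrite !dotE; apply: eq_bigr => i _; rewrite mulrC. Qed.

Lemma dotDl (n : nat) (a b c : 'cV[R]_n) : dot (a + b) c = dot a c + dot b c.
Proof. by rewrite !dotE -big_split; apply: eq_bigr => i _; rewrite mxE mulrDl. Qed.

Lemma dotZl (n : nat) (k : R) (a b : 'cV[R]_n) : dot (k *: a) b = k * dot a b.
Proof. by rewrite !dotE mulr_sumr; apply: eq_bigr => i _; rewrite mxE mulrA. Qed.

Lemma dot_ge0 (n : nat) (a : 'cV[R]_n) : 0 <= dot a a.
Proof. by rewrite dotE sumr_ge0// => i _; rewrite -expr2 sqr_ge0. Qed.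

Lemma dot_eq0 (n : nat) (a : 'cV[R]_n) : dot a a = 0 -> a = 0.
Proof.
rewrite dotE => /psumr_eq0P H; apply/colP => i; rewrite mxE.
by apply/eqP; rewrite -sqrf_eq0 expr2; apply/eqP/H => // j _; rewrite -expr2 sqr_ge0.
Qed.

Lemma dot_mulmx (n : nat) (B : 'M[R]_n) (a b : 'cV[R]_n) :
  dot (B *m a) b = dot a (B^T *m b).
Proof. by rewrite /dot trmx_mul mulmxA. Qed.

Lemma L2_dot_integrable u v : L2 Omega u -> L2 Omega v ->
  mu.-integrable Omega (EFin \o (fun x => dot (u x) (v x))).
Proof.
move=> Lu Lv.
have -> : EFin \o (fun x => dot (u x) (v x)) =
    EFin \o (fun x => \sum_i (u x i 0 * v x i 0)).
  by apply/funext => x /=; rewrite dotE.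
by apply: integrable_EFin_sum => // i; exact: L2s_mul_integrable.
Qed.

Lemma ipC u v : ip Omega u v = ip Omega v u.
Proof. by rewrite /ip; apply: eq_Rintegral => x _; rewrite dotC. Qed.

Lemma ipDl u v w : L2 Omega u -> L2 Omega v -> L2 Omega w ->
  ip Omega (fun x => u x + v x) w = ip Omega u w + ip Omega v w.
Proof.
move=> Lu Lv Lw; rewrite /ip -RintegralD//; last 2 first.
- exact: L2_dot_integrable.
- exact: L2_dot_integrable.
by apply: eq_Rintegral => x _; rewrite dotDl.
Qed.

Lemma ipZl (c : R) u w : L2 Omega u -> L2 Omega w ->
  ip Omega (fun x => c *: u x) w = c * ip Omega u w.
Proof.
move=> Lu Lw; rewrite /ip -RintegralZl//; last exact: L2_dot_integrable.
by apply: eq_Rintegral => x _; rewrite dotZl.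
Qed.

Lemma ip0l w : ip Omega (fun=> 0) w = 0.
Proof.
transitivity (\int[mu]_(x in Omega) (0 : R)).
  by apply: eq_Rintegral => x _; rewrite /dot trmx0 mul0mx mxE.
by rewrite /Rintegral integral0.
Qed.

Lemma ip_suml (I : Type) (r : seq I) (F : I -> vfield R) w :
  (forall i, L2 Omega (F i)) -> L2 Omega w ->
  ip Omega (fun x => \sum_(i <- r) F i x) w = \sum_(i <- r) ip Omega (F i) w.
Proof.
move=> LF Lw; elim: r => [|i r IH].
  by under eq_fun do rewrite big_nil; rewrite ip0l big_nil.
under eq_fun do rewrite big_cons; rewrite ipDl// ?IH ?big_cons//.
exact: L2_sum.
Qed.

Lemma ipDr u v w : L2 Omega u -> L2 Omega v -> L2 Omega w ->
  ip Omega w (fun x => u x + v x) = ip Omega w u + ip Omega w v.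
Proof. by move=> Lu Lv Lw; rewrite ipC ipDl// !(ipC w). Qed.

Lemma ipZr (c : R) u w : L2 Omega u -> L2 Omega w ->
  ip Omega w (fun x => c *: u x) = c * ip Omega w u.
Proof. by move=> Lu Lw; rewrite ipC ipZl// (ipC w). Qed.

Lemma ip_sumr (I : Type) (r : seq I) (F : I -> vfield R) w :
  (forall i, L2 Omega (F i)) -> L2 Omega w ->
  ip Omega w (fun x => \sum_(i <- r) F i x) = \sum_(i <- r) ip Omega w (F i).
Proof. by move=> LF Lw; rewrite ipC ip_suml//; apply: eq_bigr => i _; exact: ipC. Qed.

Lemma ipBl u v w : L2 Omega u -> L2 Omega v -> L2 Omega w ->
  ip Omega (fun x => u x - v x) w = ip Omega u w - ip Omega v w.
Proof.
move=> Lu Lv Lw; under eq_fun do rewrite -scaleN1r.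
by rewrite ipDl//; [rewrite ipZl// mulN1r|exact: L2Z].
Qed.

Lemma ipBr u v w : L2 Omega u -> L2 Omega v -> L2 Omega w ->
  ip Omega w (fun x => u x - v x) = ip Omega w u - ip Omega w v.
Proof. by move=> Lu Lv Lw; rewrite ipC ipBl// !(ipC w). Qed.

Definition ae_eq_on (u v : vfield R) : Prop :=
  {ae mu, forall x, Omega x -> u x = v x}.

Lemma ip_ae u u' v v' : ae_eq_on u u' -> ae_eq_on v v' ->
  ip Omega u v = ip Omega u' v'.
Proof.
move=> uu' vv'; rewrite /ip; apply: ae_eq_Rintegral.
by apply: filterS2 uu' vv' => x /= uu' vv' Ox; rewrite uu'// vv'.
Qed.

Lemma ae_eq_on_refl u : ae_eq_on u u.
Proof. exact: aeW. Qed.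

Lemma ip_ge0 u : 0 <= ip Omega u u.
Proof. by apply: Rintegral_ge0 => x _; exact: dot_ge0. Qed.

Lemma norm2_ge0 u : 0 <= norm2 Omega u.
Proof. exact: sqrtr_ge0. Qed.

Lemma sqr_norm2 u : norm2 Omega u ^+ 2 = ip Omega u u.
Proof. by rewrite /norm2 sqr_sqrtr// ip_ge0. Qed.

Lemma ip_def u : L2 Omega u -> ip Omega u u = 0 -> ae_eq_on u (fun=> 0).
Proof.
move=> Lu u0; have iu := L2_dot_integrable Lu Lu.
have := @ae_eq_integral_abs _ _ _ mu Omega mOmega (EFin \o (fun x => dot (u x) (u x)))
  (measurable_int _ iu).
move=> [H _]; have /H : (\int[mu]_(x in Omega) `|(EFin \o (fun x => dot (u x) (u x))) x| = 0)%E.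
  transitivity (\int[mu]_(x in Omega) (dot (u x) (u x))%:E)%E.
    by apply: eq_integral => x _ /=; rewrite ger0_norm// dot_ge0.
  have /fineK <- : (\int[mu]_(x in Omega) (dot (u x) (u x))%:E)%E \is a fin_num.
    exact: integrable_fin_num.
  by rewrite -[fine _]/(ip Omega u u) u0.
by apply: filterS => x /= Hx Ox; have [] := Hx Ox => /dot_eq0.
Qed.

(** A field of norm zero vanishes almost everywhere; otherwise the squared
    norm of u minus its projection on v is nonnegative. *)
Lemma CauchySchwarz u v : L2 Omega u -> L2 Omega v ->
  `|ip Omega u v| <= norm2 Omega u * norm2 Omega v.
Proof.
move=> Lu Lv.
have key : ip Omega u v ^+ 2 <= ip Omega u u * ip Omega v v.
  have [v0|v0] := eqVneq (ip Omega v v) 0.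
    have := ip_ae (ae_eq_on_refl u) (ip_def Lv v0).
    by rewrite (ipC u (fun=> 0)) ip0l => ->; rewrite expr0n mulr_ge0// ip_ge0.
  pose c := ip Omega u v / ip Omega v v.
  have Lc := L2Z c Lv.
  have := ip_ge0 (fun x => u x - c *: v x).
  rewrite ipBl// ?ipBr// ?ipZl// ?ipZr//; last exact: L2B.
  rewrite (ipC v u) /c => h.
  have vp : 0 < ip Omega v v by rewrite lt_neqAle eq_sym v0 ip_ge0.
  rewrite -(ler_pM2r vp) in h.
  move: h; rewrite mul0r.
  set a := ip _ u u; set b := ip _ u v; set d := ip _ v v.
  have -> : (a - b / d * b - (b / d * b - b / d * (b / d * d))) * d = a * d - b ^+ 2.
    by field; exact: v0.
  by rewrite subr_ge0.
rewrite -sqrtr_sqr /norm2 -sqrtrM ?ip_ge0//; apply: ler_wsqrtr.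
exact: key.
Qed.

Lemma norm2_triangle u v : L2 Omega u -> L2 Omega v ->
  norm2 Omega (fun x => u x + v x) <= norm2 Omega u + norm2 Omega v.
Proof.
move=> Lu Lv; rewrite -(ler_pXn2r (ltn0Sn 1)) ?nnegrE ?addr_ge0 ?norm2_ge0//.
rewrite sqr_norm2 ipDl// ?ipDr//; last exact: L2D.
rewrite sqrrD !sqr_norm2 (ipC v u).
have := CauchySchwarz Lu Lv; have := ler_norm (ip Omega u v).
lra.
Qed.

End L2space.

(** * Square roots of positive semi-definite matrices *)

Section MatrixSquareRoot.
Context {R : realType}.

Lemma interpolating_poly (s : seq R) (g : R -> R) :
  exists p : {poly R}, forall x, x \in s -> p.[x] = g x.
Proof.
elim: s => [|x s [p ps]]; first by exists 0.
have [xs|xs] := boolP (x \in s).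
  by exists p => y; rewrite inE => /predU1P[->|]; exact: ps.
pose w := \prod_(y <- s) ('X - y%:P).
have wx : w.[x] != 0.
  rewrite horner_prod prodf_seq_neq0; apply/allP => y ys /=.
  by rewrite hornerXsubC subr_eq0; apply: contraNneq xs => ->.
exists (p + ((g x - p.[x]) / w.[x]) *: w) => y.
rewrite inE hornerD hornerZ => /predU1P[->|ys]; first by rewrite divfK// addrC subrK.
have -> : w.[y] = 0 by apply/rootP; rewrite root_prod_XsubC.
by rewrite mulr0 addr0 ps.
Qed.

Lemma tr_horner_mx (n : nat) (A : 'M[R]_n.+1) (p : {poly R}) :
  (horner_mx A p)^T = horner_mx A^T p.
Proof.
elim/poly_ind: p => [|p c IH]; first by rewrite !rmorph0 trmx0.
rewrite !rmorphD !rmorphM /= !horner_mx_X !horner_mx_C linearD /= trmx_mul IH tr_scalar_mx.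
by congr (_ + _); apply: comm_mx_horner.
Qed.

(** Over the field of complex numbers built on R the matrix is unitarily
    diagonalizable with real eigenvalues; a polynomial with real coefficients
    that vanishes at these kills the diagonal matrix, hence A. *)
Lemma symmetric_annihilator (n : nat) (A : 'M[R]_n.+1) : A^T = A ->
  exists s : seq R, all (eigenvalue A) s /\
    forall p : {poly R}, (forall x, x \in s -> p.[x] = 0) -> horner_mx A p = 0.
Proof.
move=> symA.
pose f : {rmorphism R -> complex.complex R} := complex.real_complex R.
pose Ac := map_mx f A.
have Asym : Ac \is symmetricmx.
  apply/is_hermitianmxP; rewrite expr0 scale1r map_mx_id// /Ac.
  by rewrite map_trmx symA.
have Areal : Ac \is a mxOver Num.real.
  by apply/mxOverP => i j; rewrite mxE complex.complex_real.
have /spectral.orthomx_spectralP := spectral.symmetric_normalmx Asym Areal.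
have := spectral.hermitian_spectral_diag_real (spectral.realsym_hermsym Asym Areal).
set P := spectral.spectralmx Ac; set d := spectral.spectral_diag Ac.
move=> /mxOverP dreal AP; have Pu : P \in unitmx by exact: spectral.spectral_unit.
have fd i : f (complex.Re (d 0 i)) = d 0 i by rewrite [LHS]complex.RRe_real.
exists [seq complex.Re (d 0 i) | i <- enum 'I_n.+1]; split.
  apply/allP => _ /mapP[i _ ->].
  rewrite eigenvalue_root_char -(fmorph_root f) map_char_poly fd -eigenvalue_root_char.
  apply/eigenvalueP; exists (row i P); last first.
    apply/negP => /eqP r0; have := mulmxV Pu; move=> /(congr1 (row i)).
    rewrite row_mul r0 mul0mx => /rowP/(_ i); rewrite !mxE eqxx => /eqP.
    by rewrite eq_sym oner_eq0.
  rewrite -[map_mx f A]/Ac AP -row_mul !mulmxA mulmxV// mul1mx.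
  by rewrite row_mul row_diag_mx -scalemxAl -rowE.
move=> p p0; apply: (@map_mx_inj _ _ f); rewrite map_horner_mx map_mx0.
transitivity (horner_mx (invmx P *m diag_mx d *m P) (map_poly f p)).
  by congr (horner_mx _ _).
have Pu' : P \is a GRing.unit by [].
rewrite (horner_mx_uconjC _ _ Pu').
have -> : horner_mx (diag_mx d) (map_poly f p) = 0.
  rewrite horner_mx_diag; apply/matrixP => i j; rewrite !mxE -fd horner_map p0 ?rmorph0 ?mul0rn//.
  by apply/mapP; exists i => //; rewrite mem_enum.
by rewrite mulmx0 mul0mx.
Qed.

Lemma psd_eigenvalue_ge0 (n : nat) (A : 'M[R]_n) (a : R) :
  psd A -> eigenvalue A a -> 0 <= a.
Proof.
move=> psdA /eigenvalueP[v vA v0].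
have := psdA v^T; rewrite trmxK vA -scalemxAl mxE.
have -> : (v *m v^T) 0 0 = dot v^T v^T by rewrite /dot trmxK.
rewrite pmulr_lge0// lt_neqAle dot_ge0 andbT eq_sym.
by apply: contraNneq v0 => /dot_eq0/(congr1 trmx); rewrite trmxK trmx0 => ->.
Qed.

(** Let Q = q(A), where q(x) is the fourth root of x on the spectrum. Then Q
    is symmetric, so that its square is positive semi-definite, and the fourth
    power of Q is A. *)
Lemma psd_sqrt_exists (n : nat) (A : 'M[R]_n.+1) : A^T = A -> psd A ->
  exists S : 'M[R]_n.+1, [/\ S^T = S, psd S & S *m S = A].
Proof.
move=> symA psdA; have [s [/allP sA Ann]] := symmetric_annihilator symA.
have [q qs] := interpolating_poly s (fun x => Num.sqrt (Num.sqrt x)).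
pose Q := horner_mx A q.
have symQ : Q^T = Q by rewrite tr_horner_mx symA.
exists (Q *m Q); split.
- by rewrite trmx_mul symQ.
- move=> xi; rewrite -mulmxA -{1}symQ -!mulmxA mulmxA -trmx_mul.
  by rewrite -/(dot (Q *m xi) (Q *m xi)) dot_ge0.
have -> : Q *m Q *m (Q *m Q) = horner_mx A (q ^+ 4).
  by rewrite rmorphXn /= !exprS expr0 mulr1 -!mulmxE !mulmxA.
apply/eqP; rewrite -subr_eq0 -{2}(horner_mx_X A) -rmorphB /=; apply/eqP/Ann => x xs.
rewrite hornerD hornerN hornerX horner_exp qs// (exprM _ 2 2).
by rewrite !sqr_sqrtr ?sqrtr_ge0 ?subrr// (psd_eigenvalue_ge0 psdA)// sA.
Qed.

Lemma msqrtP (n : nat) (A : 'M[R]_n.+1) : A^T = A -> psd A ->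
  [/\ (msqrt A)^T = msqrt A, psd (msqrt A) & msqrt A *m msqrt A = A].
Proof.
move=> symA psdA; have [S SP] := psd_sqrt_exists symA psdA.
have H := @xgetPex _ 0 [set S : 'M[R]_n.+1 | [/\ S^T = S, psd S & S *m S = A]].
by apply: H; exists S.
Qed.

Lemma dot_msqrt (n : nat) (A : 'M[R]_n.+1) (u : 'cV[R]_n.+1) : A^T = A -> psd A ->
  dot (msqrt A *m u) (msqrt A *m u) = dot (A *m u) u.
Proof.
move=> symA psdA; have [symS _ SS] := msqrtP symA psdA.
by rewrite dot_mulmx symS mulmxA SS dotC.
Qed.

End MatrixSquareRoot.

(** * Tensor fields *)

Section MatrixEstimates.
Context {R : realType}.
Implicit Types (A B : 'M[R]_3) (u v : vect R).

Lemma sqr_enorm (n : nat) (a : 'cV[R]_n) : enorm a ^+ 2 = dot a a.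
Proof. by rewrite /enorm sqr_sqrtr// dot_ge0. Qed.

Lemma dot_mulmx_le A (M : R) u : (forall i j, `|A i j| <= M) ->
  dot (A *m u) (A *m u) <= 9 * M ^+ 2 * dot u u.
Proof.
move=> AM; have A2 i j : A i j ^+ 2 <= M ^+ 2.
  by rewrite -real_normK ?num_real// ler_pXn2r ?nnegrE// (le_trans _ (AM i j)).
have rowle i : (A *m u) i 0 * (A *m u) i 0 <= 3 * M ^+ 2 * dot u u.
  rewrite mxE dotE !big_ord_recl !big_ord0.
  set x := u _ _; set y := u _ _; set z := u _ _.
  set a := A _ _; set b := A _ _; set c := A _ _.
  have := A2 i ord0; have := A2 i (lift ord0 ord0); have := A2 i (lift ord0 (lift ord0 ord0)).
  rewrite -/a -/b -/c; set N := M ^+ 2 => cN bN aN.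
  have h1 : a ^+ 2 * x ^+ 2 <= N * x ^+ 2 by rewrite ler_wpM2r ?sqr_ge0.
  have h2 : b ^+ 2 * y ^+ 2 <= N * y ^+ 2 by rewrite ler_wpM2r ?sqr_ge0.
  have h3 : c ^+ 2 * z ^+ 2 <= N * z ^+ 2 by rewrite ler_wpM2r ?sqr_ge0.
  have := sqr_ge0 (a * x - b * y); have := sqr_ge0 (a * x - c * z).
  have := sqr_ge0 (b * y - c * z); nra.
rewrite [leLHS]dotE (_ : 9 * M ^+ 2 * dot u u = \sum_(i < 3) (3 * M ^+ 2 * dot u u)); last first.
  by rewrite sumr_const card_ord -mulr_natl; ring.
exact: ler_sum.
Qed.

(** From 0 <= |A u - u|^2, that is 2 (A u, u) <= |A u|^2 + |u|^2. *)
Lemma quadratic_form_le A (M : R) u : (forall i j, `|A i j| <= M) ->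
  dot (A *m u) u <= (9 * M ^+ 2 + 1) * dot u u.
Proof.
move=> /dot_mulmx_le-/(_ u); have := dot_ge0 (A *m u - u).
rewrite dotDl -scaleN1r dotZl !(dotC _ (_ + _)) !dotDl !dotZl (dotC u).
by have := dot_ge0 u; have := dot_ge0 (A *m u); nra.
Qed.

Section Coercive.
Variables (A : 'M[R]_3) (a : R).
Hypotheses (a0 : 0 < a) (symA : A^T = A).
Hypothesis coerA : forall xi : vect R, a * enorm xi ^+ 2 <= (xi^T *m A *m xi) 0 0.

Lemma coercive_dot u : a * dot u u <= dot (A *m u) u.
Proof. by rewrite -sqr_enorm (le_trans (coerA u))// /dot trmx_mul symA. Qed.

Lemma coercive_psd : psd A.
Proof. by move=> xi; apply: le_trans (coerA xi); rewrite mulr_ge0 ?sqr_ge0// ltW. Qed.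

Lemma coercive_unit : A \in unitmx.
Proof.
rewrite -row_free_unit -kermx_eq0; apply/eqP/row_matrixP => i; rewrite row0.
have : row i (kermx A) *m A = 0 by rewrite -row_mul mulmx_ker row0.
set v := row i _ => vA; have := coercive_dot v^T.
have -> : A *m v^T = 0 by rewrite -{1}symA -trmx_mul vA trmx0.
rewrite /dot trmx0 mul0mx [in X in _ <= X]mxE pmulr_rle0// => h.
apply: trmx_inj; rewrite trmx0; apply: dot_eq0; apply/eqP.
by rewrite eq_le h dot_ge0.
Qed.

Lemma dot_inv u : dot (invmx A *m u) u = dot (A *m (invmx A *m u)) (invmx A *m u).
Proof. by rewrite mulKVmx ?coercive_unit// dotC. Qed.

(** The entry is a coordinate of h = A^-1 e_j, and coercivity gives a |h|^2 <=
    (A h, h) = h_j <= |h|. *)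
Lemma coercive_inv_bound i j : `|invmx A i j| <= a^-1.
Proof.
pose e : vect R := delta_mx j 0; pose h := invmx A *m e.
have hE k : h k 0 = invmx A k j.
  by rewrite /h /e -colE mxE.
have sq k : h k 0 ^+ 2 <= dot h h.
  rewrite dotE (bigD1 k)//= -expr2 lerDl sumr_ge0// => l _.
  by rewrite -expr2 sqr_ge0.
have h1 : a * dot h h <= h j 0.
  have := coercive_dot h; rewrite -dot_inv => /le_trans; apply.
  rewrite -/h dotE (bigD1 j)//= [e j 0]mxE !eqxx mulr1 big1 ?addr0// => l lj.
  by rewrite [e l 0]mxE (negbTE lj) mulr0.
have := sq j; have := sq i; rewrite !hE in h1 *; set s := dot h h in h1 *.
have s0 : 0 <= s by exact: dot_ge0.
move=> hi hj; have as1 : a ^+ 2 * s <= 1.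
  have [->|sn] := eqVneq s 0; first by rewrite mulr0.
  have sp : 0 < s by rewrite lt_neqAle eq_sym sn.
  rewrite -(ler_pM2r sp) mul1r -mulrA -expr2 -exprMn (le_trans _ hj)//.
  by rewrite ler_pXn2r// nnegrE ?mulr_ge0 ?(ltW a0)// (le_trans _ h1)// mulr_ge0// ltW.
rewrite -(ler_pM2l a0) divff ?gt_eqF// -(ler_pXn2r (ltn0Sn 1)) ?nnegrE ?mulr_ge0 ?(ltW a0)//.
rewrite expr1n exprMn real_normK ?num_real// (le_trans _ as1)// ler_wpM2l//.
by rewrite exprn_ge0// ltW.
Qed.

(** With h = A^-1 u one has (A^-1 u, u) = (A h, h) >= a |h|^2, and |u|^2 = |A
    h|^2 <= 9 M^2 |h|^2; the summand 1 keeps the denominator positive when M =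
    0. *)
Lemma coercive_inv (M : R) : (forall i j, `|A i j| <= M) ->
  forall u, a / (9 * M ^+ 2 + 1) * dot u u <= dot (invmx A *m u) u.
Proof.
move=> AM u; rewrite dot_inv; set h := invmx A *m u.
have uE : u = A *m h by rewrite mulKVmx ?coercive_unit.
have c0 : 0 < 9 * M ^+ 2 + 1 by have := sqr_ge0 M; lra.
apply: le_trans (coercive_dot h); rewrite -mulrA ler_wpM2l ?(ltW a0)//.
rewrite mulrC ler_pdivrMr// uE (le_trans (dot_mulmx_le h AM))//.
by rewrite mulrC ler_wpM2l ?dot_ge0// lerDl.
Qed.

End Coercive.
End MatrixEstimates.

Section Tensors.
Context {R : realType} (Omega : set (pt R)).
Hypothesis mOmega : measurable Omega.
Local Notation mu := (@leb3 R).
Implicit Types (u v w : vfield R) (A : tensor R).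

(** This turns the energy into a quadratic form in the fields, free of square
    roots of tensors. *)
Lemma sqr_norm2_act_tsqrt A u : sym_tensor Omega A -> psd_tensor Omega A ->
  norm2 Omega (act (tsqrt A) u) ^+ 2 = ip Omega (act A u) u.
Proof.
move=> symA psdA; rewrite sqr_norm2; apply: ae_eq_Rintegral.
by apply: filterS2 symA psdA => x /= symA psdA Ox; exact: dot_msqrt (symA Ox) (psdA Ox).
Qed.

Lemma ip_act_sym A u v : sym_tensor Omega A ->
  ip Omega (act A u) v = ip Omega (act A v) u.
Proof.
move=> symA; apply: ae_eq_Rintegral.
by apply: filterS symA => x /= symA Ox; rewrite dot_mulmx symA// dotC.
Qed.

Lemma act_sum A (I : Type) (r : seq I) (c : I -> R) (F : I -> vfield R) :
  act A (fun x => \sum_(i <- r) c i *: F i x) =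
  (fun x => \sum_(i <- r) c i *: act A (F i) x).
Proof.
apply/funext => x; rewrite /act mulmx_sumr.
by apply: eq_bigr => i _; rewrite scalemxAr.
Qed.

Lemma act_ae A u v : ae_eq_on Omega u v -> ae_eq_on Omega (act A u) (act A v).
Proof. by apply: filterS => x /= h Ox; rewrite /act h. Qed.

Lemma coercive_psd_tensor A (a : R) : 0 < a -> coercive Omega a A ->
  psd_tensor Omega A.
Proof. by move=> a0; apply: filterS => x /= cA Ox; exact: coercive_psd a0 (cA Ox). Qed.

(** The integrand is nonnegative only almost everywhere, hence the detour
    through its positive part. *)
Lemma psd_ip_ge0 A u : psd_tensor Omega A -> 0 <= ip Omega (act A u) u.
Proof.
move=> psdA.
suff -> : ip Omega (act A u) u =
    \int[mu]_(x in Omega) Num.max (dot (act A u x) (u x)) 0.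
  by apply: Rintegral_ge0 => x _; rewrite le_max lexx orbT.
apply: ae_eq_Rintegral; apply: filterS psdA => x /= psdA Ox; rewrite max_l// dotC.
by have := psdA Ox (u x); rewrite /dot mulmxA.
Qed.

Lemma coercive_ip A (a : R) u : Linfty_tensor Omega A -> sym_tensor Omega A ->
  coercive Omega a A -> L2 Omega u -> a * ip Omega u u <= ip Omega (act A u) u.
Proof.
move=> LA symA cA Lu; rewrite -ipZl//; apply: le_ae_Rintegral => //.
- by apply: L2_dot_integrable => //; exact: L2Z.
- by apply: L2_dot_integrable => //; exact: L2_act.
- apply: filterS2 symA cA => x /= symA cA Ox; rewrite dotZl.
  exact: coercive_dot (symA Ox) (cA Ox) _.
Qed.

Lemma bounded_ip A : Linfty_tensor Omega A ->
  exists2 C, 0 <= C & forall u, L2 Omega u -> ip Omega (act A u) u <= C * ip Omega u u.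
Proof.
move=> LA; have [mA [M AM]] := LA.
exists (9 * M ^+ 2 + 1) => [|u Lu]; first by have := sqr_ge0 M; lra.
rewrite -ipZl//; apply: le_ae_Rintegral => //.
- by apply: L2_dot_integrable => //; exact: L2_act.
- by apply: L2_dot_integrable => //; exact: L2Z.
- apply: filterS AM => x /= AM Ox; rewrite dotZl.
  by apply: quadratic_form_le => i j; exact: AM.
Qed.

(** The inverse of y is y times the power -1 of y^2, also at 0, and real
    powers are measurable. *)
Lemma measurable_inv (f : pt R -> R) : measurable_fun Omega f ->
  measurable_fun Omega (fun x => (f x)^-1).
Proof.
move=> mf; have -> : (fun x => (f x)^-1) = (fun x => f x * (f x ^+ 2) `^ (-1)).
  apply/funext => x; rewrite powR_inv1 ?sqr_ge0//.
  have [->|f0] := eqVneq (f x) 0; first by rewrite invr0 mul0r.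
  by rewrite expr2 invfM mulrA divff// mul1r.
apply: measurable_funM => //.
exact: (measurableT_comp (@measurable_powR R (-1)) (measurable_funX 2 mf)).
Qed.

Lemma measurable_det (n : nat) (F : pt R -> 'M[R]_n) :
  (forall i j, measurable_fun Omega (fun x => F x i j)) ->
  measurable_fun Omega (fun x => \det (F x)).
Proof.
move=> mF; rewrite /determinant; apply: measurable_sum => s.
apply: measurable_funM => //; apply: measurable_prod => i _; exact: mF.
Qed.

(** The entries of the inverse are rational functions of those of A by
    Cramer's formula. *)
Lemma measurable_tinv A : (forall i j, measurable_fun Omega (fun x => A x i j)) ->
  forall i j, measurable_fun Omega (fun x => tinv A x i j).
Proof.
move=> mA i j; have mdet : measurable_fun Omega (fun x => \det (A x)).
  exact: measurable_det.
have -> : (fun x => tinv A x i j) =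
  (fun x => if \det (A x) == 0 then A x i j else (\det (A x))^-1 * (\adj (A x)) i j).
  apply/funext => x; rewrite /tinv /invmx unitmxE unitfE.
  by case: eqP => //= _; rewrite mxE.
apply: measurable_fun_if => //.
- by apply: measurable_fun_eqr.
- exact: measurable_funS (mA i j).
apply: (@measurable_funS _ _ _ _ Omega) => //.
apply: measurable_funM; first exact: measurable_inv.
under eq_fun do rewrite mxE /cofactor.
apply: measurable_funM => //; apply: measurable_det => k l.
by under eq_fun do rewrite !mxE; exact: mA.
Qed.

Section InverseTensor.
Variables (A : tensor R) (a : R).
Hypotheses (a0 : 0 < a) (LA : Linfty_tensor Omega A).
Hypotheses (symA : sym_tensor Omega A) (coerA : coercive Omega a A).

Lemma Linfty_tinv : Linfty_tensor Omega (tinv A).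
Proof.
split; first by apply: measurable_tinv; have [] := LA.
exists a^-1; apply: filterS2 symA coerA => x /= sA cA Ox i j.
exact: coercive_inv_bound a0 (sA Ox) (cA Ox) _ _.
Qed.

Lemma sym_tinv : sym_tensor Omega (tinv A).
Proof. by apply: filterS symA => x /= sA Ox; rewrite /tinv trmx_inv sA. Qed.

Lemma coercive_tinv : exists2 b, 0 < b & coercive Omega b (tinv A).
Proof.
have [_ [M AM]] := LA.
exists (a / (9 * M ^+ 2 + 1)).
  by rewrite divr_gt0//; have := sqr_ge0 M; lra.
apply: filterS3 symA coerA AM => x /= sA cA AM Ox xi.
rewrite sqr_enorm (le_trans (coercive_inv a0 (sA Ox) (cA Ox) (AM Ox) xi))//.
by rewrite dotC /dot mulmxA.
Qed.

End InverseTensor.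
End Tensors.

(** * Fubini for real-valued integrals *)

Section RealFubini.
Context d1 d2 (X : measurableType d1) (Y : measurableType d2) (R : realType).
Variables (m1 : {sigma_finite_measure set X -> \bar R}).
Variables (m2 : {sigma_finite_measure set Y -> \bar R}).
Variable f : X * Y -> R.
Hypothesis intf : (m1 \x m2)%E.-integrable setT (EFin \o f).

Lemma Rintegral_fubini1 :
  \int[(m1 \x m2)%E]_z f z = \int[m1]_x \int[m2]_y f (x, y).
Proof.
rewrite /Rintegral -(integral12_prod_meas1 intf); congr fine.
apply: ae_eq_lower_integral; apply: filterS (ae_integrable1 intf) => x ix _.
by rewrite fineK//; exact: integrable_fin_num.
Qed.

Lemma Rintegral_fubini2 :
  \int[(m1 \x m2)%E]_z f z = \int[m2]_y \int[m1]_x f (x, y).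
Proof.
rewrite /Rintegral -(integral21_prod_meas1 intf); congr fine.
apply: ae_eq_lower_integral; apply: filterS (ae_integrable2 intf) => x ix _.
by rewrite fineK//; exact: integrable_fin_num.
Qed.

Lemma integrable_fubini1 (k : X -> R) :
  (forall x, (\int[m2]_y (f (x, y))%:E)%E = (k x)%:E) ->
  m1.-integrable setT (EFin \o k).
Proof.
move=> fk; have -> : EFin \o k = (fun x => (\int[m2]_y (f (x, y))%:E)%E).
  by apply/funext => x; rewrite fk.
exact: (integrable_fubini_F intf).
Qed.

Lemma integrable_fubini2 (k : Y -> R) :
  (forall y, (\int[m1]_x (f (x, y))%:E)%E = (k y)%:E) ->
  m2.-integrable setT (EFin \o k).
Proof.
move=> fk; have mf := measurable_int _ intf.
have -> : EFin \o k = (fun y => (\int[m1]_x (f (x, y))%:E)%E).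
  by apply/funext => y; rewrite fk.
apply/integrableP; split; first exact: (measurable_fubini_G intf).
have [/(_ intf) iabs _] := integrable21ltyP m1 m2 mf; apply: le_lt_trans iabs.
apply: ae_ge0_le_lower_integral => [y|y|]; [exact: abse_ge0|exact: integral_ge0|].
apply: aeW => y _; apply: le_abse_integral => //.
exact: (measurable_fun_pair1 y mf).
Qed.

End RealFubini.

Section ProductIntegrable.
Context d1 d2 (X : measurableType d1) (Y : measurableType d2) (R : realType).
Variables (m1 : {sigma_finite_measure set X -> \bar R}).
Variables (m2 : {sigma_finite_measure set Y -> \bar R}).
Variables (g : X -> R) (h : Y -> R).
Hypotheses (ig : m1.-integrable setT (EFin \o g)).
Hypotheses (ih : m2.-integrable setT (EFin \o h)).

Lemma measurable_fun_tensor :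
  measurable_fun setT (fun z : X * Y => g z.1 * h z.2).
Proof.
have mg : measurable_fun setT g by apply/measurable_EFinP; exact: measurable_int ig.
have mh : measurable_fun setT h by apply/measurable_EFinP; exact: measurable_int ih.
by apply: measurable_funM; exact: measurableT_comp.
Qed.

Lemma integrable_tensor :
  (m1 \x m2)%E.-integrable setT (EFin \o (fun z : X * Y => g z.1 * h z.2)).
Proof.
apply/integrable12ltyP; first by apply/measurable_EFinP; exact: measurable_fun_tensor.
have ih' : (\int[m2]_y `|(EFin \o h) y| < +oo)%E by case/integrableP: ih.
have ig' : (\int[m1]_x `|(EFin \o g) x| < +oo)%E by case/integrableP: ig.
have mg : measurable_fun setT (EFin \o g) by exact: measurable_int ig.
have mh : measurable_fun setT (EFin \o h) by exact: measurable_int ih.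
have E x : (\int[m2]_y `|(EFin \o (fun z : X * Y => (g z.1 * h z.2)%R)) (x, y)| =
   `|(EFin \o g) x| * \int[m2]_y `|(EFin \o h) y|)%E.
  rewrite -ge0_integralZl//; last exact: measurableT_comp.
  by apply: eq_integral => y _ /=; rewrite normrM EFinM.
under eq_integral do rewrite E.
rewrite ge0_integralZr//; [|exact: measurableT_comp|exact: integral_ge0].
by apply: lte_mul_pinfty => //; [exact: integral_ge0|rewrite ge0_fin_numE// integral_ge0].
Qed.

Lemma Rintegral_tensor :
  \int[(m1 \x m2)%E]_z (g z.1 * h z.2) = \int[m1]_x g x * \int[m2]_y h y.
Proof.
rewrite (Rintegral_fubini1 integrable_tensor) -RintegralZr//.
by apply: eq_Rintegral => x _; rewrite -RintegralZl.
Qed.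

End ProductIntegrable.

(** * Absolutely continuous functions of time *)

Section IntegralProduct.
Context {R : realType}.
Local Notation leb := (@lebesgue_measure R).
Variables (t : R) (g h : R -> R).
Hypotheses (ig : leb.-integrable `]0, t] (EFin \o g)).
Hypotheses (ih : leb.-integrable `]0, t] (EFin \o h)).

Let I : set R := `]0, t].
Let gI := g \_ I.
Let hI := h \_ I.
Let Phi (z : R * R) := gI z.1 * hI z.2.
Let A := [set z : R * R | z.1 <= z.2].

Let igI : leb.-integrable setT (EFin \o gI).
Proof. by rewrite /gI -integrable_EFin_patch//; exact: measurable_itv. Qed.
Let ihI : leb.-integrable setT (EFin \o hI).
Proof. by rewrite /hI -integrable_EFin_patch//; exact: measurable_itv. Qed.

Let iPhi : (leb \x leb)%E.-integrable setT (EFin \o Phi).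
Proof. exact: integrable_tensor. Qed.

Let mA : measurable A.
Proof.
have := @measurable_fun_ler _ (R * R)%type R setT fst snd measurable_fst measurable_snd.
move=> mle; rewrite (_ : A = setT `&` (fun z : R * R => z.1 <= z.2) @^-1` [set true]).
  exact: mle.
by rewrite setTI; apply/seteqP; split => z.
Qed.

Let memI (x y : R) : (x \in (`]0, y]%classic : set R)) = (0 < x <= y).
Proof. by apply/idP/idP; rewrite inE/= in_itv. Qed.

Let memI' (x y : R) : (x \in (`]0, y[%classic : set R)) = (0 < x < y).
Proof. by apply/idP/idP; rewrite inE/= in_itv. Qed.

Let memA (r s : R) : ((r, s) \in A) = (r <= s).
Proof. by apply/idP/idP; rewrite inE. Qed.

Let memAC (r s : R) : ((r, s) \in ~` A) = (s < r).
Proof. by rewrite in_setC memA ltNge. Qed.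

Let belowE r s : (Phi \_ A) (r, s) = (hI s) * ((g \_ `]0, s]) r).
Proof.
rewrite /Phi /gI /hI !patch_indic /= !indicE memA !memI.
by case: (leP r s); case: (ltP 0 r); case: (leP r t); case: (ltP 0 s); case: (leP s t) => *;
  rewrite /= ?(mul0r, mulr0, mulr1)//; first [lra | exact: mulrC].
Qed.

Let aboveE r s : (Phi \_ (~` A)) (r, s) = gI r * ((h \_ `]0, r[) s).
Proof.
rewrite /Phi /gI /hI !patch_indic /= !indicE memAC !memI memI'.
by case: (ltP s r); case: (ltP 0 r); case: (leP r t); case: (ltP 0 s); case: (leP s t) => *;
  rewrite /= ?(mul0r, mulr0, mulr1)//; lra.
Qed.

Let G s := \int[leb]_(r in `]0, s]) g r.
Let H s := \int[leb]_(r in `]0, s]) h r.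

Let sub_patch (k : R -> R) (D : set R) : leb.-integrable I (EFin \o k) ->
  D `<=` I -> measurable D -> leb.-integrable setT (EFin \o (k \_ D)).
Proof.
by move=> ik DI mD; rewrite -integrable_EFin_patch//; apply: integrableS ik => //; exact: measurable_itv.
Qed.

Let subIc s : s \in I -> `]0, s] `<=` I.
Proof.
rewrite memI => /andP[s0 st] r; rewrite /I /= !in_itv/= => /andP[-> rs].
exact: le_trans st.
Qed.

Let subIo s : s \in I -> `]0, s[ `<=` I.
Proof.
rewrite memI => /andP[s0 st] r; rewrite /I /= !in_itv/= => /andP[-> rs].
by rewrite (le_trans (ltW rs)).
Qed.

Let integral_below s : (\int[leb]_r ((Phi \_ A) (r, s))%:E =
  (((fun s => h s * G s) \_ I) s)%:E)%E.
Proof.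
under eq_integral do rewrite belowE.
have [sI|sI] := boolP (s \in I); last first.
  rewrite (_ : hI s = 0); last by rewrite /hI patch_indic /= indicE (negbTE sI) mulr0.
  under eq_integral do rewrite mul0r.
  by rewrite integral0 patch_indic /= indicE (negbTE sI) mulr0.
have ig' := sub_patch ig (subIc sI) (measurable_itv _).
rewrite -[LHS]fineK; last by apply: integrable_fin_num => //; exact: integrable_EFinZl.
congr EFin; rewrite -[LHS]/(\int[leb]_x (hI s * (g \_ `]0, s]) x)).
rewrite RintegralZl// -Rintegral_mkcond.
by rewrite /hI !patch_indic /= indicE sI !mulr1.
Qed.

Let integral_above r : (\int[leb]_s ((Phi \_ (~` A)) (r, s))%:E =
  (((fun r => g r * H r) \_ I) r)%:E)%E.
Proof.
under eq_integral do rewrite aboveE.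
have [rI|rI] := boolP (r \in I); last first.
  rewrite (_ : gI r = 0); last by rewrite /gI patch_indic /= indicE (negbTE rI) mulr0.
  under eq_integral do rewrite mul0r.
  by rewrite integral0 patch_indic /= indicE (negbTE rI) mulr0.
have ih' := sub_patch ih (subIo rI) (measurable_itv _).
rewrite -[LHS]fineK; last by apply: integrable_fin_num => //; exact: integrable_EFinZl.
congr EFin; rewrite -[LHS]/(\int[leb]_x (gI r * (h \_ `]0, r[) x)).
rewrite RintegralZl// -Rintegral_mkcond Rintegral_itv_bndo_bndc.
  by rewrite /gI !patch_indic /= indicE rI !mulr1.
by rewrite integrable_EFin_patch//; exact: measurable_itv.
Qed.

Let iPhiA (B : set (R * R)) : measurable B ->
  (leb \x leb)%E.-integrable setT (EFin \o (Phi \_ B)).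
Proof. by move=> mB; rewrite -integrable_EFin_patch//; apply: integrableS iPhi. Qed.

Let integrable_hG : leb.-integrable I (EFin \o (fun s => h s * G s)).
Proof.
rewrite integrable_EFin_patch; last exact: measurable_itv.
exact: (integrable_fubini2 (iPhiA mA) integral_below).
Qed.

Let integrable_gH : leb.-integrable I (EFin \o (fun s => g s * H s)).
Proof.
rewrite integrable_EFin_patch; last exact: measurable_itv.
exact: (integrable_fubini1 (iPhiA (measurableC mA)) integral_above).
Qed.

Lemma integral_product_integrable :
  leb.-integrable I (EFin \o (fun s => g s * H s + h s * G s)).
Proof. by apply: integrable_EFinD => //; exact: measurable_itv. Qed.

(** The square ]0, t]^2 is cut along its diagonal; over each triangle the
    product g(r) h(s) is integrated first in the variable for which the inner
    integral is a primitive. *)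
Lemma integral_product : G t * H t = \int[leb]_(s in I) (g s * H s + h s * G s).
Proof.
rewrite RintegralD//; last exact: measurable_itv.
rewrite /G /H Rintegral_mkcond -/gI [X in _ * X]Rintegral_mkcond -/hI -Rintegral_tensor//.
rewrite -/(Phi) -(setUv A) Rintegral_setU//; last 3 first.
- exact: measurableC.
- by rewrite setUv.
- by apply/disj_setPS => z [].
rewrite addrC Rintegral_mkcond [X in _ + X]Rintegral_mkcond.
rewrite (Rintegral_fubini1 (iPhiA (measurableC mA))) (Rintegral_fubini2 (iPhiA mA)).
congr (_ + _); rewrite [RHS]Rintegral_mkcond; apply: eq_Rintegral => s _.
  by rewrite /Rintegral integral_above.
by rewrite /Rintegral integral_below.
Qed.

End IntegralProduct.

Section AbsolutelyContinuous.
Context {R : realType}.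
Local Notation leb := (@lebesgue_measure R).
Variable T : R.
Hypothesis T0 : 0 < T.
Implicit Types (F G f g : R -> R) (t : R).

(** F is absolutely continuous on [0, T], and f represents its derivative. *)
Definition AC F f : Prop :=
  leb.-integrable `]0, T] (EFin \o f) /\
  forall t, t \in `[0, T] -> F t = F 0 + \int[leb]_(s in `]0, t]) f s.

Lemma sub_itv0 t : t \in `[0, T] -> `]0, t] `<=` `]0, T].
Proof.
rewrite in_itv/= => /andP[t0 tT] s /=; rewrite !in_itv/= => /andP[-> /le_trans].
by apply.
Qed.

Lemma AC_integrable F f t : AC F f -> t \in `[0, T] ->
  leb.-integrable `]0, t] (EFin \o f).
Proof. by move=> [fi _] tT; apply: integrableS fi => //; exact: sub_itv0. Qed.

Lemma AC_cst (c : R) : AC (fun=> c) (fun=> 0).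
Proof.
split=> [|t _]; first exact: integrable0.
by rewrite /Rintegral integral0 addr0.
Qed.

Lemma AC_D F f G g : AC F f -> AC G g ->
  AC (fun t => F t + G t) (fun t => f t + g t).
Proof.
move=> aF aG; split=> [|t tT]; first by apply: integrable_EFinD => //; [case: aF|case: aG].
rewrite RintegralD//; [|exact: AC_integrable aF tT|exact: AC_integrable aG tT].
by rewrite (aF.2 _ tT) (aG.2 _ tT) addrACA.
Qed.

Lemma AC_Z (c : R) F f : AC F f -> AC (fun t => c * F t) (fun t => c * f t).
Proof.
move=> aF; split=> [|t tT]; first by apply: integrable_EFinZl => //; case: aF.
by rewrite RintegralZl// ?(aF.2 _ tT) ?mulrDr//; exact: AC_integrable aF tT.
Qed.

Lemma AC_sum (I : Type) (r : seq I) (F f : I -> R -> R) :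
  (forall i, AC (F i) (f i)) ->
  AC (fun t => \sum_(i <- r) F i t) (fun t => \sum_(i <- r) f i t).
Proof.
move=> aF; elim: r => [|i r IH].
  under eq_fun do rewrite big_nil.
  by under [X in AC _ X]eq_fun do rewrite big_nil; exact: AC_cst.
under eq_fun do rewrite big_cons.
by under [X in AC _ X]eq_fun do rewrite big_cons; exact: AC_D.
Qed.

Let in0T : 0 \in `[0, T].
Proof. by rewrite in_itv/= lexx ltW. Qed.

Let inTT : T \in `[0, T].
Proof. by rewrite in_itv/= lexx ltW. Qed.

Lemma AC_ext F F' f : (forall t, t \in `[0, T] -> F t = F' t) -> AC F f -> AC F' f.
Proof. by move=> FF' [fi Ff]; split => // t tT; rewrite -!FF'//; exact: Ff. Qed.

(** The products of the two integral terms are a primitive by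
    [integral_product]; the values at 0 contribute terms that are linear in f
    and g. *)
Lemma AC_M F f G g : AC F f -> AC G g ->
  AC (fun t => F t * G t) (fun t => f t * G t + g t * F t).
Proof.
move=> aF aG; have [fi Ff] := aF; have [gi Gg] := aG.
pose If s := \int[leb]_(r in `]0, s]) f r.
pose Ig s := \int[leb]_(r in `]0, s]) g r.
pose k s := (f s * Ig s + g s * If s) + (G 0 * f s + F 0 * g s).
have kE t : t \in `[0, T] -> {in (`]0, t]%classic : set R), (fun s => f s * G s + g s * F s) =1 k}.
  move=> tT s; rewrite inE/= => /sub_itv0 -/(_ tT) /=; rewrite in_itv/= => /andP[s0 sT].
  have sT' : s \in `[0, T] by rewrite in_itv/= (ltW s0).
  by rewrite /k (Ff s)// (Gg s)// /If /Ig; ring.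
have k_integrable t : t \in `[0, T] -> leb.-integrable `]0, t] (EFin \o k).
  move=> tT; have fit := AC_integrable aF tT; have git := AC_integrable aG tT.
  apply: integrable_EFinD => //; first exact: integral_product_integrable.
  by apply: integrable_EFinD => //; exact: integrable_EFinZl.
split=> [|t tT].
  have := k_integrable _ inTT; apply: eq_integrable => // s sT.
  by rewrite /= -(kE T).
have fit := AC_integrable aF tT; have git := AC_integrable aG tT.
have -> : \int[leb]_(s in `]0, t]) (f s * G s + g s * F s) =
    \int[leb]_(s in `]0, t]) k s by apply: eq_Rintegral; exact: kE.
rewrite RintegralD//; last 2 first.
- exact: integral_product_integrable.
- by apply: integrable_EFinD => //; exact: integrable_EFinZl.
rewrite -integral_product// RintegralD//; [|exact: integrable_EFinZl|exact: integrable_EFinZl].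
by rewrite !RintegralZl// (Ff t)// (Gg t)//; ring.
Qed.

Lemma AC_C1 F f : (forall t, is_derive t 1 F (f t)) -> continuous f -> AC F f.
Proof.
move=> dF cf.
have cF : continuous F.
  move=> x; apply: differentiable_continuous; apply/derivable1_diffP.
  by have [] := dF x.
have fi t : leb.-integrable `[0, t] (EFin \o f).
  apply: continuous_compact_integrable; first exact: segment_compact.
  by apply: continuous_subspaceT => x; exact: cf.
split=> [|t]; first by apply: integrableS (fi T) => //; exact: subset_itv_oc_cc.
rewrite in_itv/= => /andP[t0 tT]; have [<-|tn0] := eqVneq 0 t.
  by rewrite set_itvoc0 Rintegral_set0 addr0.
have tp : 0 < t by rewrite lt_neqAle tn0.
rewrite Rintegral_itv_obnd_cbnd; last by apply: integrableS (fi t) => //; exact: subset_itv_oc_cc.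
rewrite /Rintegral (continuous_FTC2 tp (F := F))//=; first by rewrite addrCA subrr addr0.
- by apply: continuous_subspaceT => x; exact: cf.
- split=> [x _||]; first by have [] := dF x.
  + by apply: cvg_at_right_filter; exact: cF.
  + by apply: cvg_at_left_filter; exact: cF.
- by move=> x _; rewrite derive1E; have /@derive_val := dF x.
Qed.

(** Lebesgue's differentiation theorem for the extension of f by 0;
    differentiability at a point of ]0, T[ only depends on the values of F
    near it. *)
Lemma AC_derivable F f : AC F f ->
  {ae leb, forall t, t \in `]0, T[ -> derivable F t 1 /\ F^`()%classic t = f t}.
Proof.
move=> [fi Ff]; pose fT := f \_ `]0, T].
have fTi : leb.-integrable setT (EFin \o fT).
  by rewrite -integrable_EFin_patch//; exact: measurable_itv.
have fTl : locally_integrable setT fT by apply: integrable_locally => //; exact: measurable_itv.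
have fTiy y : leb.-integrable [set` Interval (BRight 0) (BRight y)] (EFin \o fT).
  by apply: integrableS fTi => //; exact: measurable_itv.
have := FTC1 fTiy fTl; apply: filterS => t Ht.
rewrite in_itv/= => /andP[t0 tT].
pose K (y : R) : R := \int[leb]_(s in `]0, y]) fT s.
have dK : is_derive t (1 : R) K (f t).
  have [|dH HE] := Ht; first exact: t0.
  apply: DeriveDef; first exact: dH.
  by rewrite -derive1E [LHS]HE /fT patchE mem_set//= in_itv/= t0 ltW.
have [dH HE] : is_derive t (1 : R) (cst (F 0) + K) (0 + f t) by exact: is_deriveD.
have FH : {near t, (cst (F 0) + K) =1 F}.
  near=> y.
  have y0T : 0 < y < T.
    by near: y; apply: (@near_in_itvoo _ 0 T); rewrite in_itv/= t0.
  case/andP: y0T => y0 yT.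
  have yi : y \in `[0, T] by rewrite in_itv/= !ltW.
  rewrite (Ff y)//; congr (_ + _); apply: eq_Rintegral => s; rewrite inE/= => sy.
  by rewrite /fT patchE mem_set//; exact: sub_itv0 sy.
split; first exact: near_eq_derivable dH.
by rewrite derive1E -(near_eq_derive _ FH) HE add0r.
Unshelve. all: by end_near. Qed.

End AbsolutelyContinuous.

(** * Finite-dimensional spaces of fields *)

Section FiniteSpan.
Context {R : realType} (Omega : set (pt R)).
Hypothesis mOmega : measurable Omega.
Variables (J : finType) (w : J -> vfield R).

Definition spanned (v : vfield R) : Prop :=
  exists c : J -> R, ae_eq_on Omega v (fun x => \sum_j c j *: w j x).

Let sp (v : vfield R) : Prop := L2 Omega v /\ spanned v.

Let spD u v : sp u -> sp v -> sp (fun x => u x + v x).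
Proof.
move=> [Lu [c uc]] [Lv [c' vc]]; split; first exact: L2D.
exists (fun j => c j + c' j); apply: filterS2 uc vc => x uc vc Ox.
by rewrite uc// vc// -big_split; apply: eq_bigr => j _; rewrite scalerDl.
Qed.

Let spZ (a : R) v : sp v -> sp (fun x => a *: v x).
Proof.
move=> [Lv [c vc]]; split; first exact: L2Z.
exists (fun j => a * c j); apply: filterS vc => x vc Ox.
by rewrite vc// scaler_sumr; apply: eq_bigr => j _; rewrite scalerA.
Qed.

Let sp_sum (I : Type) (r : seq I) (F : I -> vfield R) : (forall i, sp (F i)) ->
  sp (fun x => \sum_(i <- r) F i x).
Proof.
move=> spF; elim: r => [|i r IH].
  under eq_fun do rewrite big_nil; split; first exact: L2_0.
  exists (fun=> 0); apply: aeW => x _; rewrite big1// => j _; exact: scale0r.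
by under eq_fun do rewrite big_cons; exact: spD.
Qed.

Definition orthonormal (n : nat) (e : 'I_n -> vfield R) : Prop :=
  forall i j, ip Omega (e i) (e j) = (i == j)%:R.

Let family (n : nat) (e : 'I_n -> vfield R) : Prop :=
  (forall i, sp (e i)) /\ orthonormal e.

Let ip_comb n (e : 'I_n -> vfield R) (c : 'I_n -> R) j : family e ->
  ip Omega (fun x => \sum_i c i *: e i x) (e j) = c j.
Proof.
move=> [spe one]; rewrite ip_suml//; [|by move=> i; apply: L2Z => //; case: (spe i)|by case: (spe j)].
rewrite (bigD1 j)//= ipZl//; [|by case: (spe j)|by case: (spe j)].
rewrite one eqxx mulr1 big1 ?addr0// => i ij.
by rewrite ipZl//; [rewrite one (negbTE ij) mulr0|case: (spe i)|case: (spe j)].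
Qed.

Let family_size n (e : 'I_n -> vfield R) : family e -> (n <= #|J|)%N.
Proof.
move=> fe; have [spe one] := fe.
have /choice[C eC] : forall i, exists c : J -> R,
    ae_eq_on Omega (e i) (fun x => \sum_j c j *: w j x).
  by move=> i; case: (spe i).
pose M : 'M[R]_(n, #|J|) := \matrix_(i, j) C i (enum_val j).
rewrite leqNgt; apply/negP => Jn.
have : kermx M != 0.
  by rewrite kermx_eq0 -row_leq_rank -ltnNge (leq_ltn_trans (rank_leq_col _)).
apply/negP; rewrite negbK; apply/eqP/row_matrixP => i; rewrite row0.
have : row i (kermx M) *m M = 0 by rewrite -row_mul mulmx_ker row0.
set l := row i _ => lM; apply/rowP => k; rewrite [RHS]mxE.
rewrite -(ip_comb (fun i => l 0 i) k fe) -(ip0l Omega (e k)).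
apply: ip_ae; last exact: ae_eq_on_refl.
have all_e : {ae @leb3 R, forall x, forall i, Omega x -> e i x = \sum_j C i j *: w j x}.
  exact: filter_forall.
apply: filterS all_e => x ex Ox.
under eq_bigr do rewrite ex//.
under eq_bigr do rewrite scaler_sumr.
rewrite exchange_big/= big1// => j _.
under eq_bigr do rewrite scalerA.
rewrite -scaler_suml; have /rowP/(_ (enum_rank j)) := lM.
rewrite !mxE => h; rewrite (_ : \sum_i0 _ = 0) ?scale0r//.
by rewrite -[RHS]h; apply: eq_bigr => m _; rewrite [M _ _]mxE enum_rankK.
Qed.

Let family0 : family (fun i : 'I_0 => (fun=> 0)).
Proof. by split => -[]. Qed.

(** An orthonormal family in the span has at most #|J| members. For one of
    maximal size, the residual of the projection of v on it vanishes almost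
    everywhere: otherwise it could be normalized and adjoined. *)
Lemma orthonormal_basis : exists (N : nat) (e : 'I_N -> vfield R),
  [/\ forall i, L2 Omega (e i), orthonormal e &
    forall v, L2 Omega v -> spanned v ->
      ae_eq_on Omega v (fun x => \sum_i ip Omega v (e i) *: e i x)].
Proof.
pose P n := `[< exists e : 'I_n -> vfield R, family e >].
have exP : exists n, P n by exists 0%N; apply/asboolP; exists (fun=> (fun=> 0)).
have ubP n : P n -> (n <= #|J|)%N by move=> /asboolP[e]; exact: family_size.
have [N /asboolP[e fe] maxN] := ex_maxnP exP ubP.
have [spe one] := fe; exists N, e; split => //; first by move=> i; case: (spe i).
move=> v Lv spv; pose q x := \sum_i ip Omega v (e i) *: e i x.
have spq : sp q by apply: sp_sum => i; exact: spZ.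
have Lq : L2 Omega q by case: spq.
pose r x := v x - q x.
have spr : sp r.
  rewrite (_ : r = fun x => v x + (-1) *: q x); last by apply/funext => x; rewrite scaleN1r.
  by apply: spD => //; exact: spZ.
have Lr : L2 Omega r by case: spr.
have re j : ip Omega r (e j) = 0.
  rewrite ipBl//; last by case: (spe j).
  by rewrite ip_comb// subrr.
suff rr0 : ip Omega r r = 0.
  apply: filterS (ip_def mOmega Lr rr0) => x rx Ox.
  by apply/eqP; rewrite -subr_eq0; apply/eqP/rx.
apply/eqP/negPn/negP => rr0.
have rn0 : norm2 Omega r != 0 by rewrite -sqrf_eq0 sqr_norm2.
pose r' x := (norm2 Omega r)^-1 *: r x.
have spr' : sp r' by exact: spZ.
suff PN : P N.+1 by have := maxN _ PN; rewrite ltnn.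
apply/asboolP.
exists (fun i => if unlift ord_max i is Some j then e j else r').
have r'e j : ip Omega r' (e j) = 0.
  by rewrite ipZl//; [rewrite re mulr0|case: (spe j)].
split=> [i|i j]; first by case: unliftP.
case: unliftP => [i' ->|->]; case: unliftP => [j' ->|->].
- by rewrite one (inj_eq lift_inj).
- by rewrite ipC r'e eq_sym (negbTE (neq_lift _ _)).
- by rewrite r'e (negbTE (neq_lift _ _)).
rewrite eqxx ipZl//; last by case: spr'.
rewrite ipZr// -sqr_norm2 expr2 /= mulr1n; field; exact: rn0.
Qed.

End FiniteSpan.

Section PiecewisePolynomials.
Context {R : realType}.
Implicit Types (v : vfield R) (x : pt R).
Local Notation poly3 := (mpoly.mpoly 3 R).
Local Notation coordinate i := (mpoly.mpolyX R (mpoly.mnm1 i) : poly3).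

Definition polynomial_field (d : nat) v : Prop :=
  exists2 p : 'I_3 -> poly3, forall i, deg_le d (p i) & forall x, v x = pveval p x.

Lemma pevalM (p q : poly3) x : peval (p * q) x = peval p x * peval q x.
Proof. exact: mpoly.mevalM. Qed.

Lemma pevalD (p q : poly3) x : peval (p + q) x = peval p x + peval q x.
Proof. exact: mpoly.mevalD. Qed.

Lemma pevalZ (c : R) (p : poly3) x : peval (c *: p) x = c * peval p x.
Proof. exact: mpoly.mevalZ. Qed.

Lemma pevalB (p q : poly3) x : peval (p - q) x = peval p x - peval q x.
Proof. exact: mpoly.mevalB. Qed.

Lemma peval_coordinate i x : peval (coordinate i) x = vec x i 0.
Proof. exact: mpoly.mevalXU. Qed.

Lemma deg_leD d (p q : poly3) : deg_le d p -> deg_le d q -> deg_le d (p + q).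
Proof.
by rewrite /deg_le => dp dq; rewrite (leq_trans (mpoly.msizeD_le _ _))// geq_max dp.
Qed.

Lemma deg_leB d (p q : poly3) : deg_le d p -> deg_le d q -> deg_le d (p - q).
Proof. by move=> dp dq; apply: deg_leD => //; rewrite /deg_le mpoly.msizeN. Qed.

Lemma deg_leW d d' (p : poly3) : (d <= d')%N -> deg_le d p -> deg_le d' p.
Proof. by move=> dd' dp; rewrite /deg_le (leq_trans dp). Qed.

Lemma deg_le_coordinateM d i (p : poly3) : deg_le d p -> deg_le d.+1 (coordinate i * p).
Proof.
rewrite /deg_le => dp; have [->|p0] := eqVneq p 0; first by rewrite mulr0 mpoly.msize0.
rewrite mpoly.msizeM//; first by rewrite mpoly.msizeX mpoly.mdeg1.
by rewrite -mpoly.msize_poly_eq0 mpoly.msizeX.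
Qed.

Lemma homog_deg_le d (p : poly3) : homog d p -> deg_le d p.
Proof.
move=> /mpoly.dhomogP hp; rewrite /deg_le mpoly.msizeE.
by apply/bigmax_leqP_seq => m mp _; rewrite hp.
Qed.

Lemma nedelec_polynomial k v : nedelec k v -> polynomial_field k.+1 v.
Proof.
move=> [p [q [dp hq vE]]].
exists (fun i => p i + (coordinate (i + 1) * q (i + 2%:R) - coordinate (i + 2%:R) * q (i + 1))).
  move=> i; apply: deg_leD; first exact: deg_leW (dp i).
  by apply: deg_leB; apply: deg_le_coordinateM; exact: homog_deg_le.
move=> x; rewrite vE; apply/colP => i.
by rewrite !mxE pevalD pevalB !pevalM !peval_coordinate !mxE.
Qed.

Lemma raviart_thomas_polynomial k v : raviart_thomas k v -> polynomial_field k.+1 v.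
Proof.
move=> [p [q [dp hq vE]]].
exists (fun i => p i + coordinate i * q).
  move=> i; apply: deg_leD; first exact: deg_leW (dp i).
  by apply: deg_le_coordinateM; exact: homog_deg_le.
move=> x; rewrite vE; apply/colP => i.
by rewrite !mxE pevalD !pevalM !peval_coordinate !mxE mulrC.
Qed.

Section Mesh.
Variables (Omega : set (pt R)) (Th : seq 'M[R]_(3, 4)) (d : nat).
Hypothesis cover : forall x, Omega x -> exists2 K, K \in Th & hull K x.

(** Cells overlap on their faces; attaching each point to the first cell that
    contains it makes the shape functions of different cells disjointly
    supported. *)
Definition first_cell x : nat := find (fun K => `[< hull K x >]) Th.

Definition shape_index : finType :=
  ('I_(size Th) * 'I_3 * mpoly.bmultinom 3 d.+1)%type.

Definition shape_function (j : shape_index) : vfield R := fun x =>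
  if first_cell x == j.1.1
  then peval (mpoly.mpolyX R (mpoly.bmnm j.2)) x *: delta_mx j.1.2 0 else 0.

Lemma first_cellP x : Omega x -> exists2 l : 'I_(size Th),
  first_cell x = l & hull (nth 0 Th l) x.
Proof.
move=> /cover[K KT Kx].
have hasK : has (fun K => `[< hull K x >]) Th by apply/hasP; exists K => //; exact/asboolP.
have lt : (first_cell x < size Th)%N by rewrite -has_find.
by exists (Ordinal lt) => //=; apply/asboolP; exact: (nth_find 0 hasK).
Qed.

(** Finite-dimensionality of the discrete spaces is used only in this form, as
    inclusion in the span of finitely many fields. *)
Lemma piecewise_spanned v : piecewise Th (polynomial_field d) v ->
  spanned Omega shape_function v.
Proof.
move=> pv.
have /choice[q qP] : forall l : 'I_(size Th), exists q : 'I_3 -> poly3,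
    (forall i, deg_le d (q i)) /\
    {ae @leb3 R, forall x, hull (nth 0 Th l) x -> v x = pveval q x}.
  move=> l; have [w [q dq wq] vw] := pv _ (mem_nth 0 (ltn_ord l)).
  by exists q; split => //; apply: filterS vw => x vw Kx; rewrite vw// wq.
exists (fun j => mpoly.mcoeff (mpoly.bmnm j.2) (q j.1.1 j.1.2)).
have all_q : {ae @leb3 R, forall x, forall l : 'I_(size Th),
    hull (nth 0 Th l) x -> v x = pveval (q l) x}.
  by apply: filter_forall => l; have [] := qP l.
apply: filterS all_q => x qx Ox.
have [l lx Kx] := first_cellP Ox.
rewrite (qx l)//; apply/colP => i; rewrite mxE summxE.
rewrite -(pair_big xpredT xpredT (fun li m => (mpoly.mcoeff (mpoly.bmnm m) (q li.1 li.2) *: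
   shape_function (li, m) x) i 0))/=.
rewrite -(pair_big xpredT xpredT (fun l' i' => \sum_m (mpoly.mcoeff (mpoly.bmnm m) (q l' i') *:
   shape_function (l', i', m) x) i 0))/=.
rewrite (bigD1 l)//= (bigD1 i)//= [X in _ + X]big1 ?addr0; last first.
  move=> l' l'l; rewrite big1// => i' _; rewrite big1// => m _.
  rewrite /shape_function /= lx (_ : (_ == _) = false) ?scaler0 ?mxE//.
  by apply/negbTE; rewrite eq_sym.
rewrite [X in _ + X]big1 ?addr0; last first.
  move=> i' i'i; rewrite big1// => m _.
  rewrite /shape_function /= lx eqxx !mxE eq_sym (negbTE i'i) mulr0 mulr0//.
have [/(_ i) dq _] := qP l; rewrite /peval {1}(mpoly.mpolywE dq) raddf_sum /=.
apply: eq_bigr => m _; rewrite mpoly.mevalZ /shape_function /= lx eqxx !mxE !eqxx.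
by rewrite mulr1.
Qed.

End Mesh.
End PiecewisePolynomials.

(** * Cells of a mesh up to null sets *)

Section Planes.
Context {R : realType}.
Local Notation leb := (@lebesgue_measure R).
Local Notation mu := (@leb3 R).

Definition affine (a0 a1 a2 b : R) (x : pt R) : R :=
  a0 * x.1.1 + a1 * x.1.2 + a2 * x.2 + b.

Lemma measurable_affine (a0 a1 a2 b : R) : measurable_fun setT (affine a0 a1 a2 b).
Proof.
apply: measurable_funD => //; apply: measurable_funD => //; first apply: measurable_funD => //.
- apply: measurable_funM => //.
  exact: (measurableT_comp measurable_fst measurable_fst).
- apply: measurable_funM => //.
  exact: (measurableT_comp measurable_snd measurable_fst).
- by apply: measurable_funM => //; exact: measurable_snd.
Qed.

Lemma continuous_affine (a0 a1 a2 b : R) : continuous (affine a0 a1 a2 b).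
Proof.
move=> x; apply: cvgD; last exact: cvg_cst.
apply: cvgD; first apply: cvgD.
- by apply: cvgM; [exact: cvg_cst|apply: cvg_comp cvg_fst cvg_fst].
- by apply: cvgM; [exact: cvg_cst|apply: cvg_comp cvg_fst cvg_snd].
- by apply: cvgM; [exact: cvg_cst|exact: cvg_snd].
Qed.

Lemma lebesgue_affine_zero (a b : R) : a != 0 -> leb [set z | a * z + b = 0] = 0%E.
Proof.
move=> a0; rewrite (_ : [set z | _] = [set - b / a]) ?lebesgue_measure_set1//.
apply/seteqP; split => z /=.
  by move=> /eqP; rewrite addr_eq0 => /eqP <-; rewrite mulrAC divff// mul1r.
by move=> ->; rewrite mulrCA divff// mulr1 addrC subrr.
Qed.

Lemma null_of_sections d1 d2 (X : measurableType d1) (Y : measurableType d2)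
    (m1 : {measure set X -> \bar R}) (m2 : {sigma_finite_measure set Y -> \bar R})
    (A : set (X * Y)) :
  (forall x, m2 (xsection A x) = 0%E) -> (m1 \x m2)%E A = 0%E.
Proof.
move=> A0; rewrite /product_measure1; transitivity (\int[m1]_x (cst 0%E x))%E.
  by apply: eq_integral => x _ /=; rewrite A0.
exact: integral0.
Qed.

Lemma null_cylinder d1 d2 (X : measurableType d1) (Y : measurableType d2)
    (m1 : {measure set X -> \bar R}) (m2 : {sigma_finite_measure set Y -> \bar R})
    (A : set X) :
  measurable A -> m1 A = 0%E -> (m1 \x m2)%E (A `*` setT) = 0%E.
Proof. by move=> mA A0; rewrite product_measure1E// A0 mul0e. Qed.

(** A coordinate axis that is not parallel to the plane has translates which
    meet it in one point each, so that its sections are null. *)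
Lemma plane_null (a0 a1 a2 b : R) : [|| a0 != 0, a1 != 0 | a2 != 0] ->
  mu.-negligible [set x | affine a0 a1 a2 b x = 0].
Proof.
move=> anz; set P := [set x | _].
have mP : measurable P.
  rewrite (_ : P = setT `&` affine a0 a1 a2 b @^-1` [set 0]); last by rewrite setTI.
  by apply: measurable_affine => //; exact: measurable_set1.
exists P; split => //.
have [a20|a20] := eqVneq a2 0; last first.
  apply: null_of_sections => p; rewrite -(lebesgue_affine_zero (a0 * p.1 + a1 * p.2 + b) a20).
  congr (leb _); apply/seteqP; split => z; rewrite /xsection/= inE /P /= /affine /= => <-; ring.
pose P2 := [set p : R * R | a1 * p.2 + (a0 * p.1 + b) = 0].
have mP2 : measurable P2.
  rewrite (_ : P2 = setT `&` (fun p : R * R => a1 * p.2 + (a0 * p.1 + b)) @^-1` [set 0]); last by rewrite setTI.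
  suff mf : measurable_fun setT (fun p : R * R => a1 * p.2 + (a0 * p.1 + b)).
    by apply: mf => //; exact: measurable_set1.
  apply: measurable_funD; first by apply: measurable_funM => //; exact: measurable_snd.
  by apply: measurable_funD => //; apply: measurable_funM => //; exact: measurable_fst.
have PE : P = P2 `*` setT.
  apply/seteqP; split => x; rewrite /P /P2 /= /affine a20.
    by move=> <-; split => //; ring.
  by move=> [h _]; rewrite -[RHS]h; ring.
suff P20 : (leb \x leb)%E P2 = 0%E.
  by rewrite PE; exact: null_cylinder.
have [a10|a10] := eqVneq a1 0; last first.
  apply: null_of_sections => p; rewrite -(lebesgue_affine_zero (a0 * p + b) a10).
  by congr (leb _); apply/seteqP; split => z; rewrite /xsection/= inE.
have a00 : a0 != 0 by move: anz; rewrite a10 a20 !eqxx !orbF.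
have P2E : P2 = [set z | a0 * z + b = 0] `*` setT.
  apply/seteqP; split => x; rewrite /P2 /= a10 mul0r add0r //.
  by move=> [].
have m1 : measurable [set z : R | a0 * z + b = 0].
  rewrite (_ : [set z | _] = [set - b / a0]); first exact: measurable_set1.
  apply/seteqP; split => z /=.
    by move=> /eqP; rewrite addr_eq0 => /eqP <-; rewrite mulrAC divff// mul1r.
  by move=> ->; rewrite mulrCA divff// mulr1 addrC subrr.
by rewrite P2E; apply: null_cylinder => //; exact: lebesgue_affine_zero.
Qed.

End Planes.

Section BarycentricCoordinates.
Context {R : realType} (K : 'M[R]_(3, 4)).
Local Notation mu := (@leb3 R).

Definition bary (x : pt R) : 'cV[R]_4 :=
  invmx (col_mx K (const_mx 1 : 'M[R]_(1, 4)) : 'M[R]_4) *m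
    (col_mx (vec x) (const_mx 1 : 'M[R]_(1, 1)) : 'cV[R]_4).

Hypothesis ndK : Defs.nondegenerate K.
Let M : 'M[R]_4 := col_mx K (const_mx 1 : 'M[R]_(1, 4)).

Lemma baryP x (l : 'cV[R]_4) : vec x = K *m l -> \sum_i l i 0 = 1 -> l = bary x.
Proof.
move=> xl l1; rewrite /bary -[LHS](mulKmx ndK); congr (_ *m _).
transitivity (col_mx (K *m l) ((const_mx 1 : 'M[R]_(1, 4)) *m l)); first exact (@mul_col_mx R 3 1 4 1 K (const_mx 1) l).
suff -> : (const_mx 1 : 'M[R]_(1, 4)) *m l = const_mx 1 by rewrite xl.
apply/matrixP => i j; rewrite !mxE -[RHS]l1.
by apply: eq_bigr => k _; rewrite !mxE mul1r ord1.
Qed.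

Lemma baryK x : vec x = K *m bary x /\ \sum_i bary x i 0 = 1.
Proof.
have : col_mx (K *m bary x) ((const_mx 1 : 'M[R]_(1, 4)) *m bary x) =
    col_mx (vec x) (const_mx 1 : 'M[R]_(1, 1)).
  exact: (etrans (esym (@mul_col_mx R 3 1 4 1 K (const_mx 1) (bary x))) (mulKVmx ndK _)).
move=> /eq_col_mx[-> /matrixP/(_ 0 0)]; rewrite !mxE => h; split => //.
by rewrite -[RHS]h; apply: eq_bigr => i _; rewrite !mxE mul1r.
Qed.

Lemma bary_affine i : exists a0 a1 a2 b,
  [|| a0 != 0, a1 != 0 | a2 != 0] /\ forall x, bary x i 0 = affine a0 a1 a2 b x.
Proof.
pose N : 'M[R]_(4, 3 + 1) := invmx M.
pose n (j : 'I_3) : R := N i (lshift 1 j); pose c : R := N i (rshift 3 ord0).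
have S4 (F : 'I_(3 + 1) -> R) : \sum_(k < 4) F k = F (lshift 1 ord0) +
    F (lshift 1 (lift ord0 ord0)) + F (lshift 1 (lift ord0 (lift ord0 ord0))) + F (rshift 3 ord0).
  transitivity (\sum_(k < 3 + 1) F k); first by [].
  rewrite big_split_ord /=.
  by rewrite !big_ord_recl !big_ord0 !addr0 !addrA.
exists (n ord0), (n (lift ord0 ord0)), (n (lift ord0 (lift ord0 ord0))), c; split; last first.
  move=> x; rewrite /bary -/M -/N mxE S4 /affine.
  have Eu (j : 'I_3) : (col_mx (vec x) (const_mx 1 : 'M[R]_(1, 1)) : 'cV[R]_4) (lshift 1 j) 0 =
      vec x j 0 by exact: (@col_mxEu R 3 1 1 (vec x) (const_mx 1) j 0).
  have Ed : (col_mx (vec x) (const_mx 1 : 'M[R]_(1, 1)) : 'cV[R]_4) (rshift 3 ord0) 0 = 1.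
    by rewrite [LHS](@col_mxEd R 3 1 1 (vec x) (const_mx 1) ord0 0) mxE.
  by rewrite !Eu Ed !mxE /n /c /= mulr1.
apply/negPn/negP; rewrite !negb_or !negbK => /and3P[/eqP n0 /eqP n1 /eqP n2].
have NM j : c = (i == j)%:R.
  have /matrixP/(_ i j) := mulVmx ndK; rewrite -/M -/N [RHS]mxE => <-.
  rewrite mxE S4 -!/(n _) n0 n1 n2 !mul0r !add0r -/c.
  have Ed : M (rshift 3 ord0) j = 1.
    by rewrite [LHS](@col_mxEd R 3 1 4 K (const_mx 1) ord0 j) mxE.
  by rewrite Ed mulr1.
have := NM i; rewrite eqxx (NM (i + 1)) => /eqP.
by rewrite eq_sym -subr_eq0 (_ : (i == i + 1) = false) ?subr0 ?oner_eq0//; apply/eqP; case: i {n c n0 n1 n2 NM} => -[|[|[|[|]]]].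
Qed.

Lemma bary_zero_null i : mu.-negligible [set x | bary x i 0 = 0].
Proof.
have [a0 [a1 [a2 [b [anz bE]]]]] := bary_affine i.
by rewrite (_ : [set x | _] = [set x | affine a0 a1 a2 b x = 0]); [exact: plane_null|apply/seteqP; split => x /=; rewrite bE].
Qed.

(** A barycentric coordinate vanishes on the face, which is thus contained in
    a plane. *)
Lemma proper_face_null (I : {set 'I_4}) : I != [set: 'I_4]%SET ->
  mu.-negligible (face K I).
Proof.
move=> IT; have /existsP[i iI] : [exists i, i \notin I].
  by rewrite -negb_forall; apply: contraNN IT => /forallP IT; apply/eqP/setP => i; rewrite inE IT.
apply: negligibleS (bary_zero_null i) => x [l [_ lI l1 xl]] /=.
by rewrite -(baryP xl l1) lI.
Qed.

Definition cell_interior : set (pt R) := [set x | forall i, 0 < bary x i 0].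

Lemma cell_interior_open : open cell_interior.
Proof.
suff H (x : pt R) : cell_interior x -> nbhs x cell_interior by rewrite openE.
move=> xK.
have Hi i : nbhs x [set y | 0 < bary y i 0].
  have [a0 [a1 [a2 [b [_ bE]]]]] := bary_affine i.
  have -> : [set y | 0 < bary y i 0] = affine a0 a1 a2 b @^-1` [set y | 0 < y].
    by apply/seteqP; split => y /=; rewrite bE.
  apply: (@continuous_affine R a0 a1 a2 b x).
  by apply: open_nbhs_nbhs; split; [exact: open_gt|rewrite /= -bE; exact: xK].
exact: (@filter_forall (pt R) 'I_4 (fun i y => 0 < bary y i 0) (nbhs x) _ Hi).
Qed.

Lemma cell_interior_sub : cell_interior `<=` hull K.
Proof.
move=> x xK; have [xE x1] := baryK x; exists (bary x); split => // i; first exact: ltW.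
by rewrite inE.
Qed.

Lemma ae_cell_interior : {ae mu, forall x, hull K x -> cell_interior x}.
Proof.
have : {ae mu, forall x, forall i : 'I_4, bary x i 0 <> 0}.
  apply: filter_forall => i; apply: negligibleS (bary_zero_null i) => x /=.
  by move=> /contrapT.
apply: filterS => x nz [l [l0 _ l1 xl]] i.
by rewrite lt_neqAle -(baryP xl l1) l0 andbT eq_sym (baryP xl l1); apply/eqP.
Qed.

End BarycentricCoordinates.

(** * Smooth bump functions on boxes *)

Section SmoothFunctions.
Context {R : realType}.
Implicit Types (f g : R -> R) (t : R).

(** Derivatives are provided as witnesses rather than computed, so that
    closure under products and affine changes of variable is a plain
    induction. *)
Fixpoint smooth_upto (n : nat) f : Prop :=
  if n is m.+1 then exists2 f', (forall t, is_derive t 1 f (f' t)) & smooth_upto m f'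
  else continuous f.

Definition smooth1 f : Prop := forall n, smooth_upto n f.

Lemma is_derive_continuous f f' : (forall t, is_derive t (1 : R) f (f' t)) -> continuous f.
Proof.
move=> df t; apply: differentiable_continuous; apply/derivable1_diffP.
by have [] := df t.
Qed.

Lemma smooth_uptoS n f : smooth_upto n.+1 f -> smooth_upto n f.
Proof.
elim: n f => [|n IH] f [f' df sf']; first exact: is_derive_continuous df.
by exists f' => //; exact: IH.
Qed.

Lemma smooth_uptoD n f g : smooth_upto n f -> smooth_upto n g ->
  smooth_upto n (fun t => f t + g t).
Proof.
elim: n f g => [|n IH] f g /=; first by move=> cf cg t; apply: cvgD; [exact: cf|exact: cg].
move=> [f' df sf] [g' dg sg]; exists (fun t => f' t + g' t); last exact: IH.
by move=> t; exact: is_deriveD.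
Qed.

Lemma smooth_upto_cst n (c : R) : smooth_upto n (fun=> c).
Proof.
elim: n c => [|n IH] c /=; first by move=> t; exact: cvg_cst.
by exists (fun=> 0) => [t|]; [exact: is_derive_cst|exact: IH].
Qed.

Lemma smooth_uptoM n f g : smooth_upto n f -> smooth_upto n g ->
  smooth_upto n (fun t => f t * g t).
Proof.
elim: n f g => [|n IH] f g; first by move=> cf cg t; apply: cvgM; [exact: cf|exact: cg].
move=> sf sg; have sf0 := smooth_uptoS sf; have sg0 := smooth_uptoS sg.
case: sf sg => f' df sf' [g' dg sg'].
exists (fun t => f t * g' t + g t * f' t); last by apply: smooth_uptoD; exact: IH.
by move=> t; exact: is_deriveM.
Qed.

Lemma smooth_upto_affine n f (c d : R) : smooth_upto n f ->
  smooth_upto n (fun t => f (c * t + d)).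
Proof.
elim: n f => [|n IH] f /=.
  move=> cf t; apply: continuous_comp; last exact: cf.
  by apply: cvgD; [apply: cvgM; [exact: cvg_cst|exact: cvg_id]|exact: cvg_cst].
move=> [f' df sf']; exists (fun t => c * f' (c * t + d)).
  move=> t; have dl : is_derive t (1 : R) (fun t => c * t + d) c.
    have := is_deriveD (is_deriveZ c (is_derive_id t (1 : R))) (is_derive_cst d t (1 : R)).
    by rewrite addr0 /GRing.scale/= mulr1.
  have := @is_derive1_comp R f (fun t => c * t + d) t _ _ (df _) dl.
  by rewrite mulrC.
by apply: smooth_uptoM; [exact: smooth_upto_cst|exact: IH].
Qed.

Lemma smooth1_derive f : smooth1 f -> exists2 f', (forall t, is_derive t 1 f (f' t)) & smooth1 f'.
Proof.
move=> sf; have [f' df _] := sf 1%N; exists f' => // n.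
have [g dg sg] := sf n.+1; suff -> : f' = g by [].
apply/funext => t; have [_ <-] := df t; by have [_ <-] := dg t.
Qed.

End SmoothFunctions.

Section FlatExponential.
Context {R : realType}.
Implicit Types (q : {poly R}) (t u : R).

(** The k-th power of u / k <= 1 + u / k <= exp (u / k). *)
Lemma pow_expRN_le (k : nat) u : 0 <= u -> u ^+ k * expR (- u) <= k%:R ^+ k.
Proof.
move=> u0; case: k => [|k]; first by rewrite !expr0 mul1r expR_le1 oppr_le0.
have k0 : 0 < k.+1%:R :> R by rewrite ltr0n.
have h : (u / k.+1%:R) ^+ k.+1 <= expR u.
  have -> : expR u = expR (u / k.+1%:R) ^+ k.+1 by rewrite -expRM_natl mulrC divfK ?gt_eqF.
  rewrite ler_pXn2r ?nnegrE ?expR_ge0 ?divr_ge0//.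
  by rewrite (le_trans _ (expR_ge1Dx _))// lerDr.
rewrite expRN -[leRHS]mulr1 ler_pdivrMr ?expR_gt0// mulr1.
by rewrite -ler_pdivrMl ?exprn_gt0// mulrC -expr_div_n.
Qed.

Lemma poly_expRN_bounded q : exists2 M, 0 <= M & forall u, 0 <= u -> `|q.[u]| * expR (- u) <= M.
Proof.
exists (\sum_(i < size q) `|q`_i| * i%:R ^+ i).
  by apply: sumr_ge0 => i _; rewrite mulr_ge0// exprn_ge0.
move=> u u0; rewrite horner_coef (le_trans (ler_wpM2r (expR_ge0 _) (ler_norm_sum _ _ _)))//.
rewrite mulr_suml ler_sum// => i _.
by rewrite normrM normrX (ger0_norm u0) -mulrA ler_wpM2l// pow_expRN_le.
Qed.

(** For q = 1 this is the classical function exp (-1/t), flat at 0; the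
    polynomial factor in 1/t makes the family closed under differentiation. *)
Definition flat q t : R := if 0 < t then q.[t^-1] * expR (- t^-1) else 0.

Lemma flat0 q t : t <= 0 -> flat q t = 0.
Proof. by move=> t0; rewrite /flat ltNge t0. Qed.

(** Exponential decay beats any polynomial. A quadratic bound is all that
    differentiability at 0 takes, for every q at once. *)
Lemma flat_quadratic q : exists2 M, 0 <= M & forall t, `|flat q t| <= M * t ^+ 2.
Proof.
have [M M0 qM] := poly_expRN_bounded ('X^2 * q); exists M => // t.
rewrite /flat; case: ltP => t0; last by rewrite normr0 mulr_ge0// sqr_ge0.
have := qM t^-1; rewrite invr_ge0 ltW// => /(_ isT).
rewrite hornerM hornerXn normrM [`|t^-1 ^+ 2|]ger0_norm ?sqr_ge0// -mulrA exprVn mulrC.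
rewrite ler_pdivrMr ?exprn_gt0//; apply: le_trans.
by rewrite normrM [X in _ * X]ger0_norm ?expR_ge0.
Qed.

Lemma is_derive_quadratic (f : R -> R) (M : R) : (forall t, `|f t| <= M * t ^+ 2) ->
  is_derive (0 : R) (1 : R) f 0.
Proof.
move=> fM; have f0 : f 0 = 0.
  by apply/eqP; rewrite -normr_le0 (le_trans (fM 0))// expr0n mulr0.
have M0 : 0 <= M by have := le_trans (normr_ge0 _) (fM 1); rewrite expr1n mulr1.
have cv : h^-1 *: (f (h *: 1 + 0) - f 0) @[h --> 0^'] --> (0 : R).
  apply/cvgr0Pnorm_le => e e0; near=> h.
  have h0 : h != 0 by near: h; exact: nbhs_dnbhs_neq.
  rewrite f0 subr0 addr0 /GRing.scale/= mulr1 normrM normfV.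
  rewrite ler_pdivrMl ?normr_gt0// (le_trans (fM h))//.
  rewrite -[h ^+ 2]real_normK ?num_real// expr2 mulrA mulrC ler_wpM2l//.
  have : `|h| <= e / (M + 1).
    by near: h; apply: dnbhs0_le; rewrite divr_gt0// ltr_wpDl.
  rewrite ler_pdivlMr ?ltr_wpDl// => /(le_trans _); apply.
  by rewrite mulrC ler_wpM2l// lerDl.
apply: DeriveDef; first by apply/cvg_ex; exists 0.
exact: cvg_lim cv.
Unshelve. all: by end_near. Qed.

Lemma is_derive_flat q t : is_derive t (1 : R) (flat q) (flat ('X^2 * (q - q^`())) t).
Proof.
have [t0|t0|->] := ltgtP t 0.
- rewrite (flat0 _ (ltW t0)); have d0 : is_derive t (1 : R) (cst (0 : R)) 0 by exact: is_derive_cst.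
  apply: near_eq_is_derive d0.
  by near=> s; rewrite /= flat0// ltW//; near: s; exact: lt_nbhsl.
- rewrite {2}/flat t0.
  have dq : is_derive t (1 : R) (fun s => q.[s^-1] * expR (- s^-1))
     (('X^2 * (q - q^`())).[t^-1] * expR (- t^-1)).
    have dV : is_derive t (1 : R) (fun s : R => s^-1) (- t ^- 2).
      have := is_deriveV (lt0r_neq0 t0) (is_derive_id t (1 : R)).
      by rewrite /GRing.scale/= mulr1.
    have dN : is_derive t (1 : R) (fun s : R => - s^-1) (t ^- 2).
      by have := is_deriveN dV; rewrite opprK.
    have dp := is_derive1_comp (is_derive_poly q t^-1) dV.
    have de := @is_derive1_comp R expR (fun s : R => - s^-1) t _ _ (is_derive_expR (- t^-1)) dN.
    have [dd dE] := is_deriveM dp de; apply: DeriveDef; first exact: dd.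
    rewrite [LHS]dE.
    rewrite /GRing.scale/= hornerM hornerXn hornerD hornerN -exprVn; ring.
  apply: near_eq_is_derive dq.
  by near=> s; rewrite /flat ifT//; near: s; exact: lt_nbhsr.
have [M M0 fM] := flat_quadratic q.
by rewrite (flat0 _ (lexx _)); exact: is_derive_quadratic fM.
Unshelve. all: by end_near. Qed.

End FlatExponential.

Section Bump.
Context {R : realType}.

Lemma smooth_flat (q : {poly R}) : smooth1 (flat q).
Proof.
move=> n; elim: n q => [|n IH] q /=.
  exact: is_derive_continuous (is_derive_flat q).
by exists (flat ('X^2 * (q - q^`()))); [exact: is_derive_flat|exact: IH].
Qed.

(** Increases with k to the indicator function of ]a, b[. *)
Definition bump (a b : R) (k : nat) (t : R) : R :=
  flat 1 (k.+1%:R * (t - a)) * flat 1 (k.+1%:R * (b - t)).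

Variables (a b : R).

Lemma smooth_bump k : smooth1 (bump a b k).
Proof.
have -> : bump a b k = fun t => flat 1 (k.+1%:R * t + - (k.+1%:R * a)) *
                            flat 1 (- k.+1%:R * t + k.+1%:R * b).
  apply/funext => t; rewrite /bump; congr (flat 1 _ * flat 1 _); ring.
by move=> n; apply: smooth_uptoM; apply: smooth_upto_affine; exact: smooth_flat.
Qed.

Lemma flat1_range (t : R) : 0 <= flat 1 t <= 1.
Proof.
rewrite /flat; case: ltP => t0; last by rewrite lexx ler01.
by rewrite hornerC mul1r expR_ge0 expR_le1 oppr_le0 invr_ge0 ltW.
Qed.

Lemma bump_range k t : 0 <= bump a b k t <= 1.
Proof.
have /andP[l1 l2] := flat1_range (k.+1%:R * (t - a)).
have /andP[r1 r2] := flat1_range (k.+1%:R * (b - t)).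
by rewrite /bump mulr_ge0//= mulr_ile1.
Qed.

Lemma bump_out k t : ~ (a < t < b) -> bump a b k t = 0.
Proof.
move=> /negP; rewrite negb_and -!leNgt => /orP[h|h].
  by rewrite /bump flat0 ?mul0r// mulr_ge0_le0// subr_le0.
by rewrite /bump mulrC flat0 ?mul0r// mulr_ge0_le0// subr_le0.
Qed.

Lemma flat1_cvg (s : R) : 0 < s -> flat 1 (k.+1%:R * s) @[k --> \oo] --> (1 : R).
Proof.
move=> s0; have -> : (fun k => flat 1 (k.+1%:R * s)) = (fun k => expR (- ((k.+1%:R)^-1 * s^-1))).
  by apply/funext => k; rewrite /flat mulr_gt0// hornerC mul1r invfM.
have H : - ((k.+1%:R)^-1 * s^-1) @[k --> \oo] --> (0 : R).
  rewrite -[X in _ --> X]oppr0; apply: cvgN; rewrite -[X in _ --> X](mul0r s^-1).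
  by apply: cvgM; [exact: cvg_harmonic|exact: cvg_cst].
rewrite -[X in _ --> X]expR0; apply: continuous_cvg => //; exact: continuous_expR.
Qed.

Lemma bump_cvg t : a < t < b -> bump a b k t @[k --> \oo] --> (1 : R).
Proof.
move=> /andP[at_ tb]; rewrite -[X in _ --> X]mulr1; apply: cvgM; apply: flat1_cvg;
by rewrite subr_gt0.
Qed.

End Bump.

Section SeparatedProducts.
Context {R : realType}.
Implicit Types (f g h : R -> R) (x : pt R).

Definition prod3 f g h : pt R -> R := fun x => f x.1.1 * g x.1.2 * h x.2.

Lemma continuous_prod3 f g h : continuous f -> continuous g -> continuous h ->
  continuous (prod3 f g h).
Proof.
move=> cf cg ch x; apply: cvgM; first apply: cvgM.
- by apply: continuous_comp; [apply: cvg_comp cvg_fst cvg_fst|exact: cf].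
- by apply: continuous_comp; [apply: cvg_comp cvg_fst cvg_snd|exact: cg].
- by apply: continuous_comp; [exact: cvg_snd|exact: ch].
Qed.

Lemma is_derive_quotient f t l : is_derive t (1 : R) f l ->
  s^-1 * (f (s + t) - f t) @[s --> 0^'] --> l.
Proof.
move=> [df <-]; have /cvg_ex[y hy] := df.
rewrite /derive (cvg_lim _ hy)//.
apply: cvg_trans hy; apply: near_eq_cvg; near=> s.
by rewrite /GRing.scale/= mulr1.
Unshelve. all: by end_near. Qed.

Lemma derive_prod3_0 f f' g h x : (forall t, is_derive t (1 : R) f (f' t)) ->
  derivable (prod3 f g h) x (Defs.basis 0) /\ partial 0 (prod3 f g h) x = prod3 f' g h x.
Proof.
move=> df.
have E : s^-1 *: (prod3 f g h (s *: Defs.basis 0 + x) - prod3 f g h x) @[s --> 0^'] --> prod3 f' g h x.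
  have -> : (fun s : R => s^-1 *: (prod3 f g h (s *: Defs.basis 0 + x) - prod3 f g h x)) =
     (fun s => (s^-1 * (f (s + x.1.1) - f x.1.1)) * (g x.1.2 * h x.2)).
    apply/funext => s; rewrite /prod3 /Defs.basis /GRing.scale /= /GRing.scale /= !mulr1 !mulr0 !add0r; ring.
  have -> : prod3 f' g h x = f' x.1.1 * (g x.1.2 * h x.2) by rewrite /prod3; ring.
  apply: cvgM; last exact: cvg_cst.
  exact: is_derive_quotient.
by split; [apply/cvg_ex; exists (prod3 f' g h x)|exact: cvg_lim E].
Qed.

Lemma derive_prod3_1 f g g' h x : (forall t, is_derive t (1 : R) g (g' t)) ->
  derivable (prod3 f g h) x (Defs.basis 1) /\ partial 1 (prod3 f g h) x = prod3 f g' h x.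
Proof.
move=> dg.
have E : s^-1 *: (prod3 f g h (s *: Defs.basis 1 + x) - prod3 f g h x) @[s --> 0^'] --> prod3 f g' h x.
  have -> : (fun s : R => s^-1 *: (prod3 f g h (s *: Defs.basis 1 + x) - prod3 f g h x)) =
     (fun s => (s^-1 * (g (s + x.1.2) - g x.1.2)) * (f x.1.1 * h x.2)).
    apply/funext => s; rewrite /prod3 /Defs.basis /GRing.scale /= /GRing.scale /= !mulr1 !mulr0 !add0r; ring.
  have -> : prod3 f g' h x = g' x.1.2 * (f x.1.1 * h x.2) by rewrite /prod3; ring.
  apply: cvgM; last exact: cvg_cst.
  exact: is_derive_quotient.
by split; [apply/cvg_ex; exists (prod3 f g' h x)|exact: cvg_lim E].
Qed.

Lemma derive_prod3_2 f g h h' x : (forall t, is_derive t (1 : R) h (h' t)) ->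
  derivable (prod3 f g h) x (Defs.basis 2%:R) /\ partial 2%:R (prod3 f g h) x = prod3 f g h' x.
Proof.
move=> dh.
have E : s^-1 *: (prod3 f g h (s *: Defs.basis 2%:R + x) - prod3 f g h x) @[s --> 0^'] --> prod3 f g h' x.
  have -> : (fun s : R => s^-1 *: (prod3 f g h (s *: Defs.basis 2%:R + x) - prod3 f g h x)) =
     (fun s => (s^-1 * (h (s + x.2) - h x.2)) * (f x.1.1 * g x.1.2)).
    apply/funext => s; rewrite /prod3 /Defs.basis /GRing.scale /= /GRing.scale /= !mulr1 !mulr0 !add0r; ring.
  have -> : prod3 f g h' x = h' x.2 * (f x.1.1 * g x.1.2) by rewrite /prod3; ring.
  apply: cvgM; last exact: cvg_cst.
  exact: is_derive_quotient.
by split; [apply/cvg_ex; exists (prod3 f g h' x)|exact: cvg_lim E].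
Qed.

Lemma ord3_cases (P : 'I_3 -> Prop) : P 0 -> P 1 -> P 2%:R -> forall i, P i.
Proof.
move=> P0 P1 P2 [[|[|[|//]]] H].
- by rewrite (_ : Ordinal H = 0)//; exact: val_inj.
- by rewrite (_ : Ordinal H = 1)//; exact: val_inj.
- by rewrite (_ : Ordinal H = 2%:R)//; exact: val_inj.
Qed.

Definition smooth_prod3 (p : pt R -> R) : Prop :=
  exists f g h, [/\ smooth1 f, smooth1 g, smooth1 h & p = prod3 f g h].

Lemma smooth_prod3_partial p i : smooth_prod3 p ->
  (forall x, derivable p x (Defs.basis i)) /\ smooth_prod3 (partial i p).
Proof.
move=> [f [g [h [sf sg sh ->]]]].
have [f' df sf'] := smooth1_derive sf.
have [g' dg sg'] := smooth1_derive sg.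
have [h' dh sh'] := smooth1_derive sh.
move: i; apply: ord3_cases; split.
- by move=> x; have [] := derive_prod3_0 g h x df.
- by exists f', g, h; split => //; apply/funext => x; have [_ ->] := derive_prod3_0 g h x df.
- by move=> x; have [] := derive_prod3_1 f h x dg.
- by exists f, g', h; split => //; apply/funext => x; have [_ ->] := derive_prod3_1 f h x dg.
- by move=> x; have [] := derive_prod3_2 f g x dh.
- by exists f, g, h'; split => //; apply/funext => x; have [_ ->] := derive_prod3_2 f g x dh.
Qed.

(** Partial derivatives of such a product are again such products, which makes
    the iteration of partial derivatives an induction. *)
Lemma smooth_prod3_smooth p : smooth_prod3 p -> smooth p.
Proof.
move=> sp s d; have sd : smooth_prod3 d.
  by rewrite /d; elim: s {d} => //= i s IH; have [] := smooth_prod3_partial i IH.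
split=> [x i|]; first by have [] := smooth_prod3_partial i sd.
have [f [g [h [sf sg sh ->]]]] := sd.
by apply: continuous_prod3; [exact: (sf 0%N)|exact: (sg 0%N)|exact: (sh 0%N)].
Qed.

Definition box_bump (a b : pt R) (k : nat) : pt R -> R :=
  prod3 (bump a.1.1 b.1.1 k) (bump a.1.2 b.1.2 k) (bump a.2 b.2 k).

Lemma compact_cbox (a b : pt R) : compact (cbox a b).
Proof.
by apply: compact_setX; [apply: compact_setX|]; exact: segment_compact.
Qed.

Lemma box_bump_out (a b : pt R) k x : ~ obox a b x -> box_bump a b k x = 0.
Proof.
move=> nx; rewrite /box_bump /prod3.
have [h1|/negP h1] := boolP (a.1.1 < x.1.1 < b.1.1); last by rewrite bump_out// !mul0r.
have [h2|/negP h2] := boolP (a.1.2 < x.1.2 < b.1.2); last by rewrite [bump a.1.2 _ _ _]bump_out// mulr0 mul0r.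
have [h3|/negP h3] := boolP (a.2 < x.2 < b.2); last by rewrite [bump a.2 _ _ _]bump_out// mulr0.
by exfalso; apply: nx; split; [split|]; rewrite /= in_itv.
Qed.

Lemma test_box_bump (U : set (pt R)) (a b : pt R) k : cbox a b `<=` U ->
  test U (box_bump a b k).
Proof.
move=> abU; split.
  by apply: smooth_prod3_smooth; exists (bump a.1.1 b.1.1 k), (bump a.1.2 b.1.2 k), (bump a.2 b.2 k);
     split => //; exact: smooth_bump.
exists (cbox a b); split => //; first exact: compact_cbox.
move=> x nx; apply: box_bump_out => -[] [] /=; rewrite !in_itv/= => /andP[? ?] /andP[? ?] /andP[? ?].
by apply: nx; split; [split|] => /=; rewrite in_itv/=; apply/andP; split; exact: ltW.
Qed.

Lemma box_bump_cvg (a b x : pt R) : obox a b x -> box_bump a b k x @[k --> \oo] --> (1 : R).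
Proof.
move=> [] [] /=; rewrite !in_itv/= => h1 h2 h3.
have -> : (1 : R) = 1 * 1 * 1 by rewrite !mulr1.
by apply: cvgM; [apply: cvgM|]; exact: bump_cvg.
Qed.

Lemma box_bump_range (a b : pt R) k x : 0 <= box_bump a b k x <= 1.
Proof.
have /andP[a1 b1] := bump_range a.1.1 b.1.1 k x.1.1.
have /andP[a2 b2] := bump_range a.1.2 b.1.2 k x.1.2.
have /andP[a3 b3] := bump_range a.2 b.2 k x.2.
rewrite /box_bump /prod3; apply/andP; split; first by apply: mulr_ge0 => //; exact: mulr_ge0.
by apply: mulr_ile1 => //; [exact: mulr_ge0|exact: mulr_ile1].
Qed.

End SeparatedProducts.

(** * Functions with zero integral over every octant *)

Section FundamentalLemma.
Context {R : realType}.
Local Notation mu := (@leb3 R).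
Variables (Q : set (pt R)) (g : pt R -> R).
Hypothesis mQ : measurable Q.
Hypothesis ig : mu.-integrable Q (EFin \o g).

Let Z (A : set (pt R)) : Prop := (\int[mu]_(x in A `&` Q) (g x)%:E = 0)%E.

Let igA (A : set (pt R)) : measurable A -> mu.-integrable (A `&` Q) (EFin \o g).
Proof. by move=> mA; apply: integrableS ig => //; exact: measurableI. Qed.

Let Z_diff (A B : set (pt R)) : measurable A -> measurable B -> A `<=` B ->
  Z A -> Z B -> Z (B `\` A).
Proof.
move=> mA mB AB ZA; rewrite /Z.
have -> : B `&` Q = (A `&` Q) `|` ((B `\` A) `&` Q).
  by rewrite -setIUl setDUK.
rewrite integral_setU//; first by rewrite ZA add0e.
- exact: measurableI.
- by apply: measurableI => //; exact: measurableD.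
- by rewrite -setIUl setDUK//; apply: (measurable_int mu); exact: igA.
- by apply/disj_setPS => x [[Ax _] [[_ nAx] _]].
Qed.

Let Z_bigcup (F : (set (pt R))^nat) : (forall n, measurable (F n)) ->
  trivIset setT F -> (forall n, Z (F n)) -> Z (\bigcup_n F n).
Proof.
move=> mF tF ZF; rewrite /Z setI_bigcupl integral_bigcup//.
- by rewrite eseries0// => i _ _; exact: ZF.
- by apply: trivIset_setIr.
- by move=> k; apply: measurableI; [exact: mF|exact: mQ].
- by rewrite -setI_bigcupl; apply: igA; exact: bigcup_measurable.
Qed.

(** The sets A whose preimage has zero integral form a Dynkin system. *)
Let Z_preimage d (X : measurableType d) (f : pt R -> X) (G : set (set X))
    (D : set (pt R)) : @measurable _ X = <<s G >> -> setI_closed G ->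
  measurable_fun setT f -> measurable D -> Z D ->
  (forall A, G A -> Z (f @^-1` A `&` D)) ->
  forall A, measurable A -> Z (f @^-1` A `&` D).
Proof.
move=> GE GI mf mD ZD GZ A; rewrite GE.
have mfA S : measurable S -> measurable (f @^-1` S `&` D).
  by move=> mS; apply: measurableI => //; rewrite -[X in measurable X]setTI; exact: mf.
apply: (@dynkin_induction _ X G (fun A => Z (f @^-1` A `&` D))) => //.
- by rewrite preimage_setT setTI.
- move=> S mS ZS; rewrite preimage_setC.
  rewrite (_ : _ `&` _ = D `\` (f @^-1` S `&` D)).
    by apply: Z_diff => //; exact: mfA.
  by apply/seteqP; split => x; [move=> [nS Dx]; split => // -[]|move=> [Dx nS]; split => // Sx; exact: nS].
- move=> F mF tF ZF; rewrite preimage_bigcup setI_bigcupl.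
  apply: Z_bigcup => // [n|]; first exact: mfA.
  apply: trivIset_setIr; apply/trivIsetP => i j _ _ ij.
  by rewrite -preimage_setI; move/trivIsetP : tF => ->//; rewrite preimage_set0.
Qed.

Let ray (c : R) : set R := `]c, +oo[.
Let f1 (x : pt R) : R := x.1.1.
Let f2 (x : pt R) : R := x.1.2.
Let f3 (x : pt R) : R := x.2.

Hypothesis octants : forall c : pt R,
  (\int[mu]_(x in (ray c.1.1 `*` ray c.1.2 `*` ray c.2) `&` Q) (g x)%:E = 0)%E.
Variable a : pt R.
Hypothesis Qa : Q `<=` ray a.1.1 `*` ray a.1.2 `*` ray a.2.

Let mf1 : measurable_fun setT f1.
Proof. exact: (measurableT_comp measurable_fst measurable_fst). Qed.
Let mf2 : measurable_fun setT f2.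
Proof. exact: (measurableT_comp measurable_snd measurable_fst). Qed.
Let mf3 : measurable_fun setT f3.
Proof. exact: measurable_snd. Qed.

Let mray c : measurable (ray c). Proof. exact: measurable_itv. Qed.
Let mpre (f : pt R -> R) (A : set R) : measurable_fun setT f -> measurable A ->
  measurable (f @^-1` A).
Proof. by move=> mf mA; rewrite -[X in measurable X]setTI; exact: mf. Qed.

Let rayI : setI_closed (@RGenOInfty.G R).
Proof.
move=> _ _ [c ->] [d ->]; exists (Num.max c d); apply/seteqP; split => x /=.
  by rewrite !in_itv/= !andbT gt_max => -[-> ->].
by rewrite !in_itv/= !andbT gt_max => /andP[].
Qed.

Let Z_coordinate (f : pt R -> R) (D : set (pt R)) (c0 : R) :
  measurable_fun setT f -> measurable D -> (forall x, Q x -> c0 < f x) ->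
  (forall c, Z (f @^-1` ray c `&` D)) -> forall A, measurable A -> Z (f @^-1` A `&` D).
Proof.
move=> mf mD Qc ZD A mA; apply: (Z_preimage (@RGenOInfty.measurableE R) rayI) => //.
  rewrite /Z; rewrite (_ : _ `&` _ = f @^-1` ray c0 `&` D `&` Q); first exact: ZD.
  apply/seteqP; split => x; last by move=> [[]].
  by move=> [Dx Qx]; split => //; split => //; rewrite /ray /= in_itv/= andbT; exact: Qc.
by move=> _ [c ->]; exact: ZD.
Qed.

Let Qf x : Q x -> [/\ a.1.1 < f1 x, a.1.2 < f2 x & a.2 < f3 x].
Proof. by move=> /Qa[[]]; rewrite /ray /= !in_itv/= !andbT. Qed.

Let Z_box (A B C : set R) : measurable A -> measurable B -> measurable C ->
  Z (A `*` B `*` C).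
Proof.
move=> mA mB mC.
have E (A' B' C' : set R) : A' `*` B' `*` C' = f1 @^-1` A' `&` (f2 @^-1` B' `&` f3 @^-1` C').
  by apply/seteqP; split => x /=; [move=> [[]]|move=> [? []]].
have Z1 A' c2 c3 : measurable A' -> Z (A' `*` ray c2 `*` ray c3).
  move=> mA'; rewrite E; apply: (@Z_coordinate f1 _ a.1.1) => //.
  - by apply: measurableI; exact: mpre.
  - by move=> x /Qf[].
  - by move=> c; rewrite -E; exact: (octants (c, c2, c3)).
have Z2 A' B' c3 : measurable A' -> measurable B' -> Z (A' `*` B' `*` ray c3).
  move=> mA' mB'; rewrite E setICA; apply: (@Z_coordinate f2 _ a.1.2) => //.
  - by apply: measurableI; exact: mpre.
  - by move=> x /Qf[].
  - by move=> c; rewrite setICA -E; exact: Z1.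
rewrite E setIA setIC; apply: (@Z_coordinate f3 _ a.2) => //.
- by apply: measurableI; exact: mpre.
- by move=> x /Qf[].
- by move=> c; rewrite setIC -setIA -E; exact: Z2.
Qed.

Let rectI d1 d2 (X : measurableType d1) (Y : measurableType d2) :
  setI_closed [set A `*` B | A in @measurable _ X & B in @measurable _ Y].
Proof.
move=> _ _ [A mA [B mB <-]] [A' mA' [B' mB' <-]].
exists (A `&` A'); first exact: measurableI.
by exists (B `&` B'); [exact: measurableI|rewrite setXI].
Qed.

Let Z_measurable (A : set (pt R)) : measurable A -> Z A.
Proof.
have Z2 (A' : set (R * R)) (C : set R) : measurable A' -> measurable C -> Z (A' `*` C).
  move=> mA' mC.
  have -> : A' `*` C = fst @^-1` A' `&` (f3 @^-1` C) by apply/seteqP; split => x [].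
  apply: (Z_preimage (measurable_prod_measurableType _ _) (@rectI _ _ R R)) => //.
  - exact: mpre.
  - rewrite (_ : f3 @^-1` C = setT `*` setT `*` C); first exact: Z_box.
    by apply/seteqP; split => x //= [].
  - move=> _ [A1 mA1 [A2 mA2 <-]]; rewrite (_ : _ `&` _ = A1 `*` A2 `*` C); first exact: Z_box.
    by apply/seteqP; split => x [].
move=> mA; rewrite -[A]setIT -[X in X `&` _]/(idfun @^-1` A).
apply: (Z_preimage (measurable_prod_measurableType _ _) (@rectI _ _ (R * R)%type R)) => //.
- exact: measurable_id.
- by rewrite -setXTT; exact: Z2.
- by move=> _ [A1 mA1 [A2 mA2 <-]]; rewrite setIT; exact: Z2.
Qed.

(** Half-lines are closed under intersection and generate the Borel sets of
    the line, and rectangles those of a product. Replacing half-lines by Borel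
    sets one coordinate at a time, and then products by measurable sets, shows
    that g has zero integral over every measurable part of Q. *)
Lemma zero_of_octants : {ae mu, forall x, Q x -> g x = 0}.
Proof.
have : ae_eq mu Q (EFin \o g) (cst 0%E).
  apply: integral_ae_eq => //.
  move=> E EQ mE; rewrite integral0; have := Z_measurable mE.
  by rewrite /Z (setIidl EQ).
by apply: filterS => x /= gx Qx; have [] := gx Qx.
Qed.

End FundamentalLemma.

(** * Integration by parts against products of bump functions *)

Section PlaneMeasure.
Context {R : realType}.
Local Notation leb := (@lebesgue_measure R).

(** Lebesgue measure on the plane, as the first factor of [leb3]; naming it
    provides the sigma-finiteness that Fubini's theorem in space requires. *)
Definition leb2 := (leb \x leb)%E.

HB.instance Definition _ := Measure.copy leb2 (leb \x leb)%E.

Lemma sigma_finite_leb2 : sigma_finite setT leb2.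
Proof.
have /sigma_finiteP[F [TF ndF Foo]] := sigma_finiteT leb.
exists (fun n => F n `*` F n).
  rewrite -setXTT TF predeqE => -[x y]; split.
    move=> [/= [n _ Fnx] [k _ Gky]]; exists (maxn n k) => //; split.
    - by move: x Fnx; exact/subsetPset/ndF/leq_maxl.
    - by move: y Gky; exact/subsetPset/ndF/leq_maxr.
  by move=> [n _ []/= ? ?]; split; exists n.
move=> k; have [mF Fk] := Foo k; split; first exact: measurableX.
by rewrite /leb2 product_measure1E// lte_mul_pinfty// ge0_fin_numE.
Qed.

HB.instance Definition _ := Measure_isSigmaFinite.Build _ _ _ leb2 sigma_finite_leb2.

End PlaneMeasure.

Section IntegrationByParts.
Context {R : realType}.
Local Notation leb := (@lebesgue_measure R).
Local Notation mu := (@leb3 R).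
Implicit Types (a b t : R) (f g : R -> R).

Definition supported a b f : Prop := forall t, ~ (a < t < b) -> f t = 0.

Lemma supported_patch a b f : supported a b f -> f = f \_ `[a, b].
Proof.
move=> sf; apply/funext => t; rewrite patchE; case: ifPn => // /negP tab.
apply: sf => /andP[at_ tb]; apply: tab.
by rewrite inE/= in_itv/= !ltW.
Qed.

Lemma supported_integrable a b f : continuous f -> supported a b f ->
  leb.-integrable setT (EFin \o f).
Proof.
move=> cf /supported_patch ->; rewrite -integrable_EFin_patch; last exact: measurable_itv.
apply: continuous_compact_integrable; first exact: segment_compact.
by apply: continuous_subspaceT => x; exact: cf.
Qed.

Lemma integral_supported_derivative a b f f' : (forall t, is_derive t (1 : R) f (f' t)) ->
  continuous f' -> supported a b f -> supported a b f' -> \int[leb]_t f' t = 0.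
Proof.
move=> df cf' sf sf'; have cf := is_derive_continuous df.
rewrite (supported_patch sf') -Rintegral_mkcond.
have [ab|ba] := ltP a b; last first.
  have -> : f' = fun=> 0.
    apply/funext => t; apply: sf' => /andP[at_ tb].
    by have := lt_le_trans (lt_trans at_ tb) ba; rewrite ltxx.
  by rewrite /Rintegral integral0.
rewrite /Rintegral (continuous_FTC2 ab (F := f))//=.
- by rewrite !sf ?subrr// => /andP[]; rewrite ltxx.
- by apply: continuous_subspaceT => x; exact: cf'.
- split=> [x _||]; first by have [] := df x.
  + by apply: cvg_at_right_filter; exact: cf.
  + by apply: cvg_at_left_filter; exact: cf.
- by move=> x _; rewrite derive1E; have [_ ->] := df x.
Qed.

Definition prod3_of (F : 'I_3 -> R -> R) : pt R -> R := prod3 (F 0) (F 1) (F 2%:R).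

Lemma integrable_prod3_of (F : 'I_3 -> R -> R) :
  (forall i, leb.-integrable setT (EFin \o F i)) -> mu.-integrable setT (EFin \o prod3_of F).
Proof.
move=> iF; have i01 := integrable_tensor (iF 0) (iF 1).
exact: (@integrable_tensor _ _ _ _ R leb2 leb _ _ i01 (iF 2%:R)).
Qed.

Lemma integral_prod3_of (F : 'I_3 -> R -> R) :
  (forall i, leb.-integrable setT (EFin \o F i)) ->
  \int[mu]_x prod3_of F x = (\int[leb]_t F 0 t) * (\int[leb]_t F 1 t) * (\int[leb]_t F 2%:R t).
Proof.
move=> iF; have i01 := integrable_tensor (iF 0) (iF 1).
by rewrite -(Rintegral_tensor (iF 0) (iF 1)) -(@Rintegral_tensor _ _ _ _ R leb2 leb _ _ i01 (iF 2%:R)).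
Qed.

Local Notation poly3 := (mpoly.mpoly 3 R).
Local Notation monomial m := (mpoly.mpolyX R m : poly3).

Lemma peval_monomial (m : mpoly.multinom 3) (x : pt R) :
  peval (monomial m) x =
  x.1.1 ^+ (mpoly.fun_of_multinom m 0) * x.1.2 ^+ (mpoly.fun_of_multinom m 1) *
  x.2 ^+ (mpoly.fun_of_multinom m 2%:R).
Proof.
rewrite /peval mpoly.mevalX !big_ord_recl big_ord0 mulr1 mulrA.
congr (_ * _ * _).
- by rewrite mxE.
- by rewrite mxE/=; congr (_ ^+ (mpoly.fun_of_multinom m _)); exact: val_inj.
- by rewrite mxE/=; congr (_ ^+ (mpoly.fun_of_multinom m _)); exact: val_inj.
Qed.

Definition pow_times (n : nat) f : R -> R := fun t => t ^+ n * f t.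

Lemma continuous_pow_times n f : continuous f -> continuous (pow_times n f).
Proof. by move=> cf t; apply: cvgM; [exact: exprn_continuous|exact: cf]. Qed.

Lemma supported_pow_times a b n f : supported a b f -> supported a b (pow_times n f).
Proof. by move=> sf t /sf ft; rewrite /pow_times ft mulr0. Qed.

Lemma monomial_prod3_of (m : mpoly.multinom 3) (F : 'I_3 -> R -> R) x :
  peval (monomial m) x * prod3_of F x =
  prod3_of (fun i => pow_times (mpoly.fun_of_multinom m i) (F i)) x.
Proof. by rewrite peval_monomial /prod3_of /prod3 /pow_times; ring. Qed.

Section Cutoff.
Variables (a b : 'I_3 -> R).

Lemma integrable_poly_prod3_of (p : poly3) (F : 'I_3 -> R -> R) :
  (forall i, continuous (F i)) -> (forall i, supported (a i) (b i) (F i)) ->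
  mu.-integrable setT (EFin \o (fun x => peval p x * prod3_of F x)).
Proof.
move=> cF sF; elim/mpoly.mpolyind: p => [|c m p _ _ IH].
  rewrite (_ : _ \o _ = cst 0%E); first exact: integrable0.
  by apply/funext => x; rewrite /= /peval mpoly.meval0 mul0r.
rewrite (_ : _ \o _ = EFin \o (fun x => c * (peval (monomial m) x * prod3_of F x) + peval p x * prod3_of F x)).
  apply: integrable_EFinD => //; apply: integrable_EFinZl => //.
  rewrite (_ : _ \o _ = EFin \o prod3_of (fun i => pow_times (mpoly.fun_of_multinom m i) (F i))).
    apply: integrable_prod3_of => i; apply: (@supported_integrable (a i) (b i)).
      exact: continuous_pow_times.
    exact: supported_pow_times.
  by apply/funext => x /=; rewrite monomial_prod3_of.
by apply/funext => x /=; rewrite pevalD pevalZ; congr EFin; ring.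
Qed.

Variables (be be' : 'I_3 -> R -> R).
Hypothesis dbe : forall i t, is_derive t (1 : R) (be i) (be' i t).
Hypothesis cbe' : forall i, continuous (be' i).
Hypothesis sbe : forall i, supported (a i) (b i) (be i).
Hypothesis sbe' : forall i, supported (a i) (b i) (be' i).

Let cbe i : continuous (be i).
Proof. exact: is_derive_continuous (dbe i). Qed.

Definition derive_at (j : 'I_3) : 'I_3 -> R -> R := fun i => if i == j then be' i else be i.

Lemma partial_prod3_of j : partial j (prod3_of be) = prod3_of (derive_at j).
Proof.
apply/funext => x; move: j; apply: ord3_cases.
- by have [_ ->] := derive_prod3_0 (be 1) (be 2%:R) x (dbe 0).
- by have [_ ->] := derive_prod3_1 (be 0) (be 2%:R) x (dbe 1).
- by have [_ ->] := derive_prod3_2 (be 0) (be 1) x (dbe 2%:R).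
Qed.

Let continuous_derive_at (j i : 'I_3) : continuous (derive_at j i).
Proof. by rewrite /derive_at; case: eqP. Qed.

Let supported_derive_at j i : supported (a i) (b i) (derive_at j i).
Proof. by rewrite /derive_at; case: eqP. Qed.

(** A monomial times a product of functions of one variable is again such a
    product, so that the integral factors; the factor of index j integrates
    the derivative of a function with bounded support. *)
Let ipp_monomial j (m : mpoly.multinom 3) :
  \int[mu]_x (peval (mpoly.mderiv j (monomial m)) x * prod3_of be x +
              peval (monomial m) x * prod3_of (derive_at j) x) = 0.
Proof.
pose n i := mpoly.fun_of_multinom m i.
pose G i t := (n i)%:R * t ^+ (n i).-1 * be i t + t ^+ n i * be' i t.
have dG i t : is_derive t (1 : R) (pow_times (n i) (be i)) (G i t).
  have [dd dE] := is_deriveM (is_derive_poly ('X^(n i)) t) (dbe i t).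
  have fE : pow_times (n i) (be i) = (horner 'X^(n i) : R -> R) * be i.
    by apply/funext => s; rewrite /pow_times /= -[RHS]/(_.[s] * be i s) hornerXn.
  rewrite fE; apply: DeriveDef; first exact: dd.
  rewrite [LHS]dE /G /GRing.scale/= derivXn hornerMn !hornerXn -mulr_natl; ring.
have cG i : continuous (G i).
  move=> t; apply: cvgD; apply: cvgM; [|exact: cbe|exact: exprn_continuous|exact: cbe'].
  by apply: cvgM; [exact: cvg_cst|exact: exprn_continuous].
have sG i : supported (a i) (b i) (G i).
  by move=> t tab; rewrite /G (sbe tab) (sbe' tab) !mulr0 addr0.
pose H i := if i == j then G i else pow_times (n i) (be i).
have iH i : leb.-integrable setT (EFin \o H i).
  rewrite /H; case: eqP => _; first exact: (supported_integrable (cG i) (sG i)).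
  apply: (@supported_integrable (a i) (b i)); first exact: continuous_pow_times.
  exact: supported_pow_times.
transitivity (\int[mu]_x prod3_of H x).
  apply: eq_Rintegral => x _; rewrite mpoly.mderivX pevalZ !peval_monomial.
  rewrite !mpoly.mnmBE !mpoly.mnm1E -!/(n _) /prod3_of /prod3 /H /derive_at.
  clear iH; clear H.
  by move: j; apply: ord3_cases; rewrite /= /G /pow_times ?subn0 ?subn1; ring.
rewrite integral_prod3_of//.
have Gj0 i : i = j -> \int[leb]_t H i t = 0.
  move=> ij; rewrite /H ij eqxx.
  exact: (integral_supported_derivative (dG j) (cG j) (supported_pow_times _ (@sbe j)) (sG j)).
clear iH; move: @H Gj0; move: j; apply: ord3_cases => H Gj0.
- by rewrite Gj0// !mul0r.
- by rewrite [X in _ * X * _]Gj0// mulr0 mul0r.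
- by rewrite [X in _ * _ * X]Gj0// mulr0.
Qed.

Lemma integration_by_parts_prod3_of j (p : poly3) :
  \int[mu]_x (peval p x * partial j (prod3_of be) x) =
  - \int[mu]_x (peval (mpoly.mderiv j p) x * prod3_of be x).
Proof.
apply/eqP; rewrite -addr_eq0 addrC partial_prod3_of; apply/eqP.
have iD (q : poly3) := integrable_poly_prod3_of q cbe sbe.
have iP (q : poly3) := integrable_poly_prod3_of q (@continuous_derive_at j) (@supported_derive_at j).
rewrite -RintegralD//.
elim/mpoly.mpolyind: p => [|c m p _ _ IH].
  rewrite (_ : (fun x => _) = (fun=> 0)); first by rewrite /Rintegral integral0.
  by apply/funext => x; rewrite mpoly.mderiv0 /peval mpoly.meval0 !mul0r addr0.
transitivity (\int[mu]_x (c * (peval (mpoly.mderiv j (monomial m)) x * prod3_of be x +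
              peval (monomial m) x * prod3_of (derive_at j) x) +
   (peval (mpoly.mderiv j p) x * prod3_of be x + peval p x * prod3_of (derive_at j) x))).
  apply: eq_Rintegral => x _; rewrite mpoly.mderivD mpoly.mderivZ !pevalD !pevalZ; ring.
have iq q : mu.-integrable setT (EFin \o (fun x => peval (mpoly.mderiv j q) x * prod3_of be x +
              peval q x * prod3_of (derive_at j) x)) by apply: integrable_EFinD.
rewrite RintegralD//; last exact: integrable_EFinZl.
by rewrite RintegralZl// IH ipp_monomial mulr0 addr0.
Qed.

End Cutoff.
End IntegrationByParts.

(** * The divergence of a curl *)

Section MixedPartials.
Context {R : realType}.
Implicit Types (p : pt R -> R) (x v w : pt R).

Lemma is_derive_line p x v (s : R) : derivable p (x + s *: v) v ->
  is_derive s (1 : R) (fun s => p (x + s *: v)) ('D_v p (x + s *: v)).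
Proof.
move=> dp; have E : (fun h : R => h^-1 *: (p (x + (h *: 1 + s) *: v) - p (x + s *: v))) =
   (fun h : R => h^-1 *: (p (h *: v + (x + s *: v)) - p (x + s *: v))).
  apply/funext => h; congr (_ *: (p _ - _)).
  by rewrite scalerDl /GRing.scale/= mulr1 addrCA.
by apply: DeriveDef; [rewrite /derivable E|rewrite /derive E].
Qed.

Definition second_difference p x v (w : pt R) (h : R) : R :=
  p (x + h *: v + h *: w) - p (x + h *: v) - p (x + h *: w) + p x.

Lemma second_differenceC p x v w h : second_difference p x v w h = second_difference p x w v h.
Proof. by rewrite /second_difference -!addrA (addrC (h *: v)); congr (_ + _); rewrite addrCA. Qed.

(** The mean value theorem, first in the direction v and then in the direction
    w, writes the second difference as h^2 times the mixed derivative at a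
    point that tends to x. *)
Lemma second_difference_cvg p x v w : (forall y, derivable p y v) ->
  (forall y, derivable ('D_v p) y w) -> continuous ('D_w ('D_v p)) ->
  h ^- 2 * second_difference p x v w h @[h --> 0^'+] --> 'D_w ('D_v p) x.
Proof.
move=> dp ddp cddp; pose G (z : R * R) := 'D_w ('D_v p) (x + z.1 *: v + z.2 *: w).
have cG : G z @[z --> (0 : R * R)] --> G 0.
  have H : x + z.1 *: v + z.2 *: w @[z --> (0 : R * R)] --> x + (0 : R * R).1 *: v + (0 : R * R).2 *: w.
    apply: cvgD; first apply: cvgD; first exact: cvg_cst.
    - by apply: cvgZr_tmp; exact: cvg_fst.
    - by apply: cvgZr_tmp; exact: cvg_snd.
  exact: cvg_comp H (cddp _).
apply/cvgrPdist_le => e e0.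
have : nbhs (0 : R * R) [set z | `|G 0 - G z| <= e].
  by move/cvgrPdist_le : cG => /(_ e e0).
move=> /nbhs_ballP[d /= d0 dG]; near=> h.
have h0 : 0 < h by near: h; exact: nbhs_right_gt.
have hd : h < d by near: h; exact: nbhs_right_lt.
pose f (s : R) := p (x + s *: v + h *: w) - p (x + s *: v).
pose df (s : R) := 'D_v p (x + s *: v + h *: w) - 'D_v p (x + s *: v).
have fd s : is_derive s (1 : R) f (df s).
  have dA : is_derive s (1 : R) (fun s => p (x + s *: v + h *: w)) ('D_v p (x + s *: v + h *: w)).
    have := @is_derive_line p (x + h *: w) v s (dp _).
    by under eq_fun do rewrite addrAC; rewrite addrAC.
  exact: (is_deriveB dA (@is_derive_line p x v s (dp _))).
have cf : continuous f by exact: is_derive_continuous fd.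
have [s sh] := @MVT R f df 0 h h0 (fun s _ => fd s) (continuous_subspaceT cf).
rewrite subr0 => fE.
pose g (t : R) := 'D_v p (x + s *: v + t *: w).
have gd t : is_derive t (1 : R) g ('D_w ('D_v p) (x + s *: v + t *: w)).
  exact: (@is_derive_line ('D_v p) (x + s *: v) w t (ddp _)).
have cg : continuous g by exact: is_derive_continuous gd.
have [t th] := @MVT R g _ 0 h h0 (fun s _ => gd s) (continuous_subspaceT cg).
rewrite subr0 => gE.
have -> : second_difference p x v w h = G (s, t) * h * h.
  rewrite /G /= -gE (_ : g h - g 0 = df s); last by rewrite /g /df scale0r addr0.
  rewrite -fE /f /second_difference !scale0r !addr0; ring.
have -> : h ^- 2 * (G (s, t) * h * h) = G (s, t).
  by rewrite -mulrA -expr2 mulrCA mulVf ?mulr1// expf_neq0// gt_eqF.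
rewrite (_ : 'D_w ('D_v p) x = G 0); last by rewrite /G /= !scale0r !addr0.
apply: dG; move: sh th; rewrite !in_itv/= => /andP[s0 sh] /andP[t0 th].
by split; rewrite /ball /= sub0r normrN gtr0_norm// (lt_trans _ hd).
Unshelve. all: by end_near. Qed.

(** The second difference is symmetric in the two directions, and both mixed
    derivatives are limits of the same quotient. *)
Lemma mixed_partials p (i j : 'I_3) x : smooth p ->
  partial i (partial j p) x = partial j (partial i p) x.
Proof.
move=> sp; have d1 k y : derivable p y (Defs.basis k) by have [] := sp [::].
have d2 k l y : derivable (partial k p) y (Defs.basis l) by have [] := sp [:: k].
have c2 k l : continuous (partial l (partial k p)) by have [] := sp [:: l; k].
have h1 := @second_difference_cvg p x _ _ (d1 i) (d2 i j) (@c2 i j).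
have h2 := @second_difference_cvg p x _ _ (d1 j) (d2 j i) (@c2 j i).
have E : second_difference p x (Defs.basis i) (Defs.basis j) =
    second_difference p x (Defs.basis j) (Defs.basis i).
  by apply/funext => h; exact: second_differenceC.
rewrite -E in h2; exact: (cvg_unique _ h2 h1).
Qed.

Lemma rot_grad p : smooth p -> Defs.rot (grad p) = fun=> 0.
Proof.
move=> sp; apply/funext => x; apply/colP => i; rewrite !mxE.
have E j : (fun y => grad p y j 0) = partial j p by apply/funext => y; rewrite mxE.
by rewrite !E mixed_partials// subrr.
Qed.

Lemma test_partial (U : set (pt R)) p i : test U p -> test U (partial i p).
Proof.
move=> [sp [K [cK KU pK]]]; split.
  by move=> s; have := sp (rcons s i); rewrite foldr_rcons.
exists K; split => // x Kx.
have : \near x, p x = cst 0 x.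
  have cl : closed K by apply: compact_closed => //; exact: norm_hausdorff.
  have : nbhs x (~` K) by apply: open_nbhs_nbhs; split => //; exact: closed_openC.
  by apply: filterS => y /pK.
by move=> /(near_eq_derive (Defs.basis i)) e; rewrite /partial e derive_cst.
Qed.

Lemma vtest_grad (U : set (pt R)) p : test U p -> vtest U (grad p).
Proof.
move=> tp i; rewrite (_ : (fun x => _) = partial i p); first exact: test_partial.
by apply/funext => y; rewrite mxE.
Qed.

(** Gradients of test functions are test fields, and their curl vanishes. *)
Lemma weak_div_curl (Omega : set (pt R)) (u w : vfield R) : weak_curl Omega u w ->
  weak_div Omega w (fun=> 0).
Proof.
move=> [Lw uw]; split.
  split; first exact: measurable_cst.
  by under eq_fun do rewrite expr0n/=; exact: integrable0.
move=> p tp; have [sp _] := tp.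
rewrite uw; last exact: vtest_grad.
rewrite rot_grad//.
rewrite ipC ip0l oppr0 /sip; under eq_Rintegral do rewrite mul0r.
by rewrite /Rintegral integral0.
Qed.

End MixedPartials.

(** * Weak curl of piecewise polynomial fields *)

Section WeakCurlOfPolynomial.
Context {R : realType}.
Local Notation leb := (@lebesgue_measure R).
Local Notation mu := (@leb3 R).
Local Notation poly3 := (mpoly.mpoly 3 R).

(** By [is_derive_flat], the derivative of [flat 1] is [flat D]. *)
Let D : {poly R} := 'X^2 * (1 - 1^`()).

Definition bump_derivative (a b : R) (k : nat) (t : R) : R :=
  k.+1%:R * (flat D (k.+1%:R * (t - a)) * flat 1 (k.+1%:R * (b - t)) -
             flat 1 (k.+1%:R * (t - a)) * flat D (k.+1%:R * (b - t))).

Lemma is_derive_bump (a b : R) k t : is_derive t (1 : R) (bump a b k) (bump_derivative a b k t).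
Proof.
have dl (c d : R) : is_derive t (1 : R) (fun s => c * s + d) c.
  have := is_deriveD (is_deriveZ c (is_derive_id t (1 : R))) (is_derive_cst d t (1 : R)).
  by rewrite addr0 /GRing.scale/= mulr1.
have df (c d : R) : is_derive t (1 : R) (fun s => flat 1 (c * s + d)) (flat D (c * t + d) * c).
  exact: (@is_derive1_comp R (flat 1) (fun s => c * s + d) t _ _ (is_derive_flat 1 _) (dl c d)).
have [dd dE] := is_deriveM (df k.+1%:R (- (k.+1%:R * a))) (df (- k.+1%:R) (k.+1%:R * b)).
have -> : bump a b k = (fun s => flat 1 (k.+1%:R * s + - (k.+1%:R * a))) *
                       (fun s => flat 1 (- k.+1%:R * s + k.+1%:R * b)).
  by apply/funext => s; rewrite /bump; congr (flat 1 _ * flat 1 _); ring.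
apply: DeriveDef; first exact: dd.
rewrite [LHS]dE /bump_derivative /GRing.scale /=.
have -> : k.+1%:R * t + - (k.+1%:R * a) = k.+1%:R * (t - a) by ring.
have -> : - k.+1%:R * t + k.+1%:R * b = k.+1%:R * (b - t) by ring.
ring.
Qed.

Lemma continuous_bump_derivative (a b : R) k : continuous (bump_derivative a b k).
Proof.
have [f' df sf'] := smooth1_derive (smooth_bump a b k).
rewrite (_ : bump_derivative a b k = f'); first exact: (sf' 0%N).
by apply/funext => t; have [_ <-] := df t; have [_ <-] := is_derive_bump a b k t.
Qed.

Lemma supported_bump (a b : R) k : supported a b (bump a b k).
Proof. by move=> t; exact: bump_out. Qed.

Lemma supported_bump_derivative (a b : R) k : supported a b (bump_derivative a b k).
Proof.
move=> t /negP; rewrite negb_and -!leNgt /bump_derivative => /orP[h|h].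
  by rewrite !(flat0 _ (_ : k.+1%:R * (t - a) <= 0)) ?mulr_ge0_le0 ?subr_le0// !mul0r subrr mulr0.
rewrite [flat 1 (_ * (b - _))](flat0 _ (_ : k.+1%:R * (b - t) <= 0)) ?mulr_ge0_le0 ?subr_le0//.
by rewrite [flat D (_ * (b - _))](flat0 _ (_ : k.+1%:R * (b - t) <= 0)) ?mulr_ge0_le0 ?subr_le0// !mulr0 subrr mulr0.
Qed.

Lemma Rintegral_support (A B : set (pt R)) (f : pt R -> R) : B `<=` A ->
  (forall x, ~ B x -> f x = 0) -> \int[mu]_(x in A) f x = \int[mu]_(x in B) f x.
Proof.
move=> BA f0; rewrite Rintegral_mkcond [RHS]Rintegral_mkcond; congr (Rintegral _ _ _).
apply/funext => x; rewrite !patchE; case: ifPn => xA; case: ifPn => xB //.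
  by apply: f0 => Bx; move/negP: xB; apply; rewrite inE.
by move/negP: xA; case; rewrite inE; apply: BA; rewrite inE in xB.
Qed.

Definition poly_rot (p : 'I_3 -> poly3) : 'I_3 -> poly3 := fun i =>
  mpoly.mderiv (i + 1) (p (i + 2%:R)) - mpoly.mderiv (i + 2%:R) (p (i + 1)).

Definition along (i : 'I_3) (phi : pt R -> R) : vfield R := fun y => phi y *: delta_mx i 0.

Lemma along_component i phi l : (fun y => along i phi y l 0) = if l == i then phi else fun=> 0.
Proof.
by apply/funext => y; rewrite !mxE andbT; case: eqP => _; rewrite ?mulr1 ?mulr0.
Qed.

Lemma dot_along i phi (v : vfield R) x : dot (v x) (along i phi x) = v x i 0 * phi x.
Proof.
rewrite dotE (bigD1 i)//= big1 ?addr0.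
  by rewrite !mxE !eqxx mulr1.
by move=> l li; rewrite !mxE (negbTE li) !mulr0.
Qed.

Lemma sum3 (F : 'I_3 -> R) : \sum_i F i = F 0 + F 1 + F 2%:R.
Proof.
rewrite !big_ord_recl big_ord0 addr0 addrA.
by congr (F _ + F _ + F _); exact: val_inj.
Qed.

Lemma rot_along i phi x : Defs.rot (along i phi) x =
  \col_j ((j + 2%:R == i)%:R * partial (j + 1) phi x - (j + 1 == i)%:R * partial (j + 2%:R) phi x).
Proof.
have pE j l : partial j (fun y => along i phi y l 0) x = (l == i)%:R * partial j phi x.
  rewrite along_component; case: eqP => _; first by rewrite mul1r.
  by rewrite mul0r /partial derive_cst.
by apply/colP => j; rewrite !mxE !pE.
Qed.

Lemma dot_rot_along i phi (v : vfield R) x : dot (v x) (Defs.rot (along i phi) x) =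
  v x (i + 1) 0 * partial (i + 2%:R) phi x - v x (i + 2%:R) 0 * partial (i + 1) phi x.
Proof.
rewrite rot_along dotE sum3 !mxE.
have e01 : (0 + 1 : 'I_3) = 1 by exact: val_inj.
have e02 : (0 + 2%:R : 'I_3) = 2%:R by exact: val_inj.
have e11 : (1 + 1 : 'I_3) = 2%:R by exact: val_inj.
have e12 : (1 + 2%:R : 'I_3) = 0 by exact: val_inj.
have e21 : (2%:R + 1 : 'I_3) = 0 by exact: val_inj.
have e22 : (2%:R + 2%:R : 'I_3) = 1 by exact: val_inj.
rewrite e01 e02 e11 e12 e21 e22.
move: i; apply: ord3_cases; rewrite ?e01 ?e02 ?e11 ?e12 ?e21 ?e22;
  move: (partial 0 phi x) (partial 1 phi x) (partial 2%:R phi x) (v x 0 0) (v x 1 0)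
        (v x 2%:R 0) => P0 P1 P2 v0 v1 v2 /=; ring.
Qed.

Lemma cbox_integrable_poly (a b : pt R) (q : poly3) :
  mu.-integrable (cbox a b) (EFin \o peval q).
Proof.
elim/mpoly.mpolyind: q => [|c m q _ _ IH].
  rewrite (_ : _ \o _ = cst 0%E); first exact: integrable0.
  by apply/funext => x; rewrite /= /peval mpoly.meval0.
rewrite (_ : _ \o _ = EFin \o (fun x => c * peval (mpoly.mpolyX R m) x + peval q x)).
  apply: integrable_EFinD => //; first exact: measurable_cbox.
  apply: integrable_EFinZl; first exact: measurable_cbox.
  rewrite integrable_EFin_patch; last exact: measurable_cbox.
  pose F (i : 'I_3) : R -> R :=
    (fun t => t ^+ (mpoly.fun_of_multinom m i)) \_ `[vec a i 0, vec b i 0].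
  rewrite (_ : _ \o _ = EFin \o prod3_of F).
    apply: integrable_prod3_of => i; rewrite -integrable_EFin_patch; last exact: measurable_itv.
    apply: continuous_compact_integrable; first exact: segment_compact.
    by apply: continuous_subspaceT => x; exact: exprn_continuous.
  apply/funext => x /=; congr EFin; rewrite /prod3_of /prod3 /F !patch_indic /= !indicE !mxE /= peval_monomial.
  have -> : (x \in cbox a b) = (x.1.1 \in `[a.1.1, b.1.1]%classic) &&
      (x.1.2 \in `[a.1.2, b.1.2]%classic) && (x.2 \in `[a.2, b.2]%classic).
    apply/idP/idP; first by rewrite inE => -[[? ?] ?]; rewrite !mem_set.
    by move=> /andP[/andP[]]; rewrite !inE => ? ? ?; split => //; split.
  by case: (_ \in _); case: (_ \in _); case: (_ \in _); rewrite /=; ring.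
by apply/funext => x /=; rewrite pevalD pevalZ.
Qed.

Variables (Omega U : set (pt R)) (u w : vfield R) (p : 'I_3 -> poly3).
Hypotheses (mOmega : measurable Omega) (oU : open U) (UO : U `<=` Omega).
Hypothesis uw : weak_curl Omega u w.
Hypothesis up : {ae mu, forall x, U x -> u x = pveval p x}.

Section Box.
Variables (a b : pt R) (i : 'I_3).
Hypothesis abU : cbox a b `<=` U.

Let sub_oc : obox a b `<=` cbox a b.
Proof.
move=> x [] [] /=; rewrite !in_itv/= => /andP[? ?] /andP[? ?] /andP[? ?].
by split; [split|] => /=; rewrite in_itv/=; apply/andP; split; exact: ltW.
Qed.

Let obU : obox a b `<=` U.
Proof. exact: subset_trans abU. Qed.

Let g (x : pt R) : R := w x i 0 - peval (poly_rot p i) x.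

Let integrable_w : mu.-integrable (obox a b) (EFin \o (fun x => w x i 0)).
Proof.
have mo := measurable_obox a b.
have [mw w2] := uw.1 i.
have i1 : mu.-integrable (obox a b) (EFin \o (fun=> (1 : R))).
  have : mu.-integrable (obox a b) (EFin \o peval 1).
    by apply: integrableS (cbox_integrable_poly a b 1) => //; exact: measurable_cbox.
  by rewrite (_ : EFin \o peval 1 = EFin \o (fun=> (1 : R)))//; apply/funext => x /=; rewrite /peval mpoly.meval1.
have L1 : L2s (obox a b) (fun=> (1 : R)).
  by split => //; under eq_fun do rewrite expr1n.
have Lw : L2s (obox a b) (fun x => w x i 0).
  have oO : obox a b `<=` Omega by exact: subset_trans obU _.
  by split; [exact: measurable_funS mw|exact: integrableS w2].
by have := L2s_mul_integrable mo Lw L1; under eq_fun do rewrite /= mulr1.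
Qed.

Lemma integral_box_integrable : mu.-integrable (obox a b) (EFin \o g).
Proof.
have mo := measurable_obox a b.
rewrite (_ : _ \o _ = EFin \o (fun x => w x i 0 + (-1) * peval (poly_rot p i) x)); last first.
  by apply/funext => x /=; rewrite /g mulN1r.
apply: integrable_EFinD => //; apply: integrable_EFinZl => //.
apply: integrableS (cbox_integrable_poly a b _) => //; exact: measurable_cbox.
Qed.

(** The weak curl is tested with a bump in the direction i. On the box u is a
    polynomial, so that integration by parts moves the derivatives from the
    bump to it. *)
Let integral_box_bump k : \int[mu]_(x in obox a b) (g x * box_bump a b k x) = 0.
Proof.
pose be j := bump (vec a j 0) (vec b j 0) k.
pose be' j := bump_derivative (vec a j 0) (vec b j 0) k.
pose va j := vec a j 0; pose vb j := vec b j 0.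
pose phi := box_bump a b k.
have phiE : phi = prod3_of be by rewrite /phi /box_bump /prod3_of /be !mxE.
have dbe j t : is_derive t (1 : R) (be j) (be' j t) by exact: is_derive_bump.
have cbe' j : continuous (be' j) by exact: continuous_bump_derivative.
have cbe j : continuous (be j) by exact: is_derive_continuous (dbe j).
have sbe j : supported (va j) (vb j) (be j) by exact: supported_bump.
have sbe' j : supported (va j) (vb j) (be' j) by exact: supported_bump_derivative.
have phi0 x : ~ obox a b x -> phi x = 0 by exact: box_bump_out.
have sda j l : supported (va l) (vb l) (derive_at be be' j l).
  by rewrite /derive_at; case: eqP.
have cda j l : continuous (derive_at be be' j l) by rewrite /derive_at; case: eqP.
have dphiE j : partial j phi = prod3_of (derive_at be be' j) by rewrite phiE; exact: partial_prod3_of.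
have dphi0 j x : ~ obox a b x -> partial j phi x = 0.
  move=> nx; rewrite dphiE /prod3_of /prod3.
  have [h1|/negP h1] := boolP (a.1.1 < x.1.1 < b.1.1); last first.
    by rewrite [derive_at _ _ _ 0 _]sda ?mul0r// /va /vb !mxE.
  have [h2|/negP h2] := boolP (a.1.2 < x.1.2 < b.1.2); last first.
    by rewrite [derive_at _ _ _ 1 _]sda ?mulr0 ?mul0r// /va /vb !mxE.
  have [h3|/negP h3] := boolP (a.2 < x.2 < b.2); last first.
    by rewrite [derive_at _ _ _ 2%:R _]sda ?mulr0// /va /vb !mxE.
  by exfalso; apply: nx; split; [split|]; rewrite /= in_itv.
have obO : obox a b `<=` Omega by exact: subset_trans UO.
have vt : vtest Omega (along i phi).
  move=> l; rewrite along_component; case: eqP => _.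
    by apply: test_box_bump; exact: subset_trans UO.
  split; last by exists set0; split => //; exact: compact0.
  apply: smooth_prod3_smooth; exists (fun=> 0), (fun=> 0), (fun=> 0).
  split; try by move=> n; exact: smooth_upto_cst.
  by apply/funext => x; rewrite /prod3 !mulr0.
have wE : ip Omega w (along i phi) = \int[mu]_(x in obox a b) (w x i 0 * phi x).
  rewrite -(Rintegral_support obO); last by move=> x /phi0 ->; rewrite mulr0.
  by apply: eq_Rintegral => x _; rewrite dot_along.
have ipoly (q : poly3) := integrable_poly_prod3_of q cbe sbe.
have idpoly j (q : poly3) := integrable_poly_prod3_of q (cda j) (sda j).
have uE : ip Omega u (Defs.rot (along i phi)) = \int[mu]_x (peval (poly_rot p i) x * phi x).
  transitivity (\int[mu]_(x in obox a b)
     (u x (i + 1) 0 * partial (i + 2%:R) phi x - u x (i + 2%:R) 0 * partial (i + 1) phi x)).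
    rewrite -(Rintegral_support obO); last by move=> x nx; rewrite !dphi0// !mulr0 subrr.
    by apply: eq_Rintegral => x _; rewrite dot_rot_along.
  transitivity (\int[mu]_(x in obox a b)
     (peval (p (i + 1)) x * partial (i + 2%:R) phi x - peval (p (i + 2%:R)) x * partial (i + 1) phi x)).
    apply: ae_eq_Rintegral; apply: filterS up => x ux ox.
    by rewrite (ux (obU ox)) !mxE.
  rewrite -(@Rintegral_support setT)//; last by move=> x nx; rewrite !dphi0// !mulr0 subrr.
  rewrite RintegralB//; last 2 first.
  - by rewrite dphiE; exact: idpoly.
  - by rewrite dphiE; exact: idpoly.
  have ibp j (q : poly3) : \int[mu]_x (peval q x * partial j phi x) =
      - \int[mu]_x (peval (mpoly.mderiv j q) x * phi x).
    rewrite phiE; exact: (integration_by_parts_prod3_of dbe cbe' sbe sbe').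
  transitivity (\int[mu]_x (peval (mpoly.mderiv (i + 1) (p (i + 2%:R))) x * phi x) -
                \int[mu]_x (peval (mpoly.mderiv (i + 2%:R) (p (i + 1))) x * phi x)).
    by apply: etrans (congr2 (fun r s => r - s) (ibp _ _) (ibp _ _)) _; rewrite opprK addrC.
  transitivity (\int[mu]_x (peval (mpoly.mderiv (i + 1) (p (i + 2%:R))) x * phi x -
                             peval (mpoly.mderiv (i + 2%:R) (p (i + 1))) x * phi x)).
    by apply/esym; apply: RintegralB => //; rewrite phiE; exact: ipoly.
  by apply: eq_Rintegral => x _; rewrite /poly_rot pevalB mulrBl.
have wint : mu.-integrable (obox a b) (EFin \o (fun x => w x i 0 * phi x)).
  have mo := measurable_obox a b; have [mw _] := uw.1 i.
  apply: (@ae_le_integrable _ _ _ (fun x => w x i 0)) => //.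
  - apply: measurable_funM; first exact: measurable_funS mw.
    apply: (@measurable_funS _ _ _ _ setT) => //.
    have := ipoly 1 => /(measurable_int mu); rewrite phiE.
    by move=> /measurable_EFinP; under eq_fun do rewrite /peval mpoly.meval1 mul1r.
  - apply: aeW => x _; rewrite normrM ler_piMr//.
    by have /andP[l r] := box_bump_range a b k x; rewrite ger0_norm.
have pint : mu.-integrable (obox a b) (EFin \o (fun x => peval (poly_rot p i) x * phi x)).
  by rewrite phiE; apply: integrableS (ipoly (poly_rot p i)) => //; exact: measurable_obox.
transitivity (\int[mu]_(x in obox a b) (w x i 0 * phi x - peval (poly_rot p i) x * phi x)).
  by apply: eq_Rintegral => x _; rewrite /g mulrBl.
rewrite RintegralB//; last exact: measurable_obox.
rewrite -wE uw.2// uE (@Rintegral_support setT (obox a b)) ?subrr//.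
by move=> x /phi0 ->; rewrite mulr0.
Qed.

(** The bumps increase to the indicator function of the box. *)
Lemma integral_box_zero : (\int[mu]_(x in obox a b) (g x)%:E = 0)%E.
Proof.
have mo := measurable_obox a b; have ibi := integral_box_integrable.
pose f_ k (x : pt R) : \bar R := (g x * box_bump a b k x)%:E.
have mbb k : measurable_fun (obox a b) (box_bump a b k).
  apply: (@measurable_funS _ _ _ _ setT) => //.
  have be_int t1 t2 : leb.-integrable setT (EFin \o bump t1 t2 k).
    by apply: (@supported_integrable _ t1 t2); [exact: (smooth_bump t1 t2 k 0%N)|exact: supported_bump].
  have := @integrable_prod3_of R (fun j => bump (vec a j 0) (vec b j 0) k) (fun j => be_int _ _).
  by rewrite /prod3_of !mxE => /(measurable_int mu) /measurable_EFinP.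
have mg : measurable_fun (obox a b) g by apply/measurable_EFinP; exact: (measurable_int mu).
have mf k : measurable_fun (obox a b) (f_ k).
  by apply/measurable_EFinP; exact: measurable_funM.
have mge : measurable_fun (obox a b) (EFin \o g) by exact/measurable_EFinP.
have cvf : {ae mu, forall x, obox a b x -> f_ k x @[k --> \oo] --> (EFin \o g) x}.
  apply: aeW => x ox; apply: cvg_EFin; first exact: nearW.
  rewrite -[X in _ --> X]mulr1; apply: cvgM; first exact: cvg_cst.
  exact: box_bump_cvg.
have ig : mu.-integrable (obox a b) (fun x => `|(g x)%:E|%E) by exact: integrable_abse.
have fg : {ae mu, forall x, forall k, obox a b x -> (`|f_ k x| <= `|(g x)%:E|)%E}.
  apply: aeW => x k _; rewrite /f_ /= lee_fin normrM ler_piMr//.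
  by have /andP[l r] := box_bump_range a b k x; rewrite ger0_norm.
have [_ _ cv] := @dominated_convergence _ _ _ mu _ mo _ _ _ mf mge cvf ig fg.
have f0 k : (\int[mu]_(x in obox a b) f_ k x = 0)%E.
  rewrite -[LHS]fineK; first by rewrite -[fine _]/(\int[mu]_(x in obox a b) (g x * box_bump a b k x)) integral_box_bump.
  apply: integrable_fin_num => //; apply: (@ae_le_integrable _ _ _ g) => //.
    by apply: measurable_funM.
  apply: aeW => x _; rewrite normrM ler_piMr//.
  by have /andP[l r] := box_bump_range a b k x; rewrite ger0_norm.
have cv0 : [sequence (\int[mu]_(x in obox a b) f_ n x)%E]_n @ \oo --> (0%E : \bar R).
  by under eq_fun do rewrite f0; exact: cvg_cst.
exact: (cvg_unique _ cv cv0).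
Qed.
End Box.
End WeakCurlOfPolynomial.

Section CurlOfPiecewisePolynomial.
Context {R : realType}.
Local Notation mu := (@leb3 R).
Local Notation poly3 := (mpoly.mpoly 3 R).
Implicit Types (u w : vfield R) (U : set (pt R)).

(** An octant cuts a box in another box, so that the integrals over octants
    vanish by [integral_box_zero]. *)
Lemma weak_curl_box (Omega U : set (pt R)) u w (p : 'I_3 -> poly3) (a b : pt R) :
  measurable Omega -> U `<=` Omega -> weak_curl Omega u w ->
  {ae mu, forall x, U x -> u x = pveval p x} -> cbox a b `<=` U ->
  {ae mu, forall x, obox a b x -> w x = pveval (poly_rot p) x}.
Proof.
move=> mO UO uw up abU; have mo := measurable_obox a b.
suff H i : {ae mu, forall x, obox a b x -> w x i 0 - peval (poly_rot p i) x = 0}.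
  have : {ae mu, forall x, forall i, obox a b x -> w x i 0 - peval (poly_rot p i) x = 0}.
    by apply: filter_forall.
  by apply: filterS => x Hx ox; apply/colP => i; rewrite mxE; apply/subr0_eq/Hx.
apply: (@zero_of_octants R (obox a b) _ mo _ _ a).
- exact: (@integral_box_integrable _ Omega U u w p mO UO uw a b i abU).
- move=> c.
  (* The octant at c meets the box in the box whose lower corner is the maximum of c and a. *)
  pose m (s t : R) := Num.max s t.
  pose a' : pt R := (m c.1.1 a.1.1, m c.1.2 a.1.2, m c.2 a.2).
  have -> : `]c.1.1, +oo[ `*` `]c.1.2, +oo[ `*` `]c.2, +oo[ `&` obox a b = obox a' b.
    apply/seteqP; split => x; rewrite /obox /a' /m /=; rewrite !in_itv/= !andbT !gt_max.
      by move=> [[[-> ->] ->] [[/andP[-> ->] /andP[-> ->]] /andP[-> ->]]].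
    by move=> [[/andP[/andP[-> ->] ->] /andP[/andP[-> ->] ->]] /andP[/andP[-> ->] ->]].
  apply: (@integral_box_zero _ Omega U u w p mO UO uw up a' b i) => x.
  move=> [[]]; rewrite /= !in_itv/= !ge_max => /andP[/andP[_ x1] y1] /andP[/andP[_ x2] y2] /andP[/andP[_ x3] y3].
  by apply: abU; split; [split|]; rewrite /= in_itv/=; apply/andP.
- by move=> x [[]]; rewrite /= !in_itv/= => /andP[x1 _] /andP[x2 _] /andP[x3 _]; split; [split|]; rewrite ?x1 ?x2 ?x3.
Qed.

Lemma weak_curl_polynomial (Omega U : set (pt R)) u w (p : 'I_3 -> poly3) :
  open U -> measurable Omega -> U `<=` Omega -> weak_curl Omega u w ->
  {ae mu, forall x, U x -> u x = pveval p x} ->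
  {ae mu, forall x, U x -> w x = pveval (poly_rot p) x}.
Proof.
move=> oU mO UO uw up; rewrite (open_bigcup_box oU).
set I := (X in \bigcup_(i in X) _).
pose P n := if unpickle n is Some i
  then fun x => I i -> obox (ratpt i.1) (ratpt i.2) x -> w x = pveval (poly_rot p) x
  else fun=> True.
have : {ae mu, forall x, forall n, P n x}.
  apply: ae_foralln => n; rewrite /P; case: unpickle => [i|]; last exact: aeW.
  have [Ii|nI] := pselect (I i); last by apply: aeW => x /nI.
  by apply: filterS (weak_curl_box mO UO uw up Ii) => x H _ /H.
apply: filterS => x Px [i Ii xi].
by have := Px (pickle i); rewrite /P pickleK; apply.
Qed.

Lemma deg_le_mderiv k (p : poly3) j : deg_le k.+1 p -> deg_le k (mpoly.mderiv j p).
Proof.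
rewrite /deg_le => dp; rewrite mpoly.msizeE; apply/bigmax_leqP_seq => m mp _.
have := @mpoly.msize_mdeg_lt _ _ p (mpoly.mnm_add m (mpoly.mnm1 j)).
rewrite mpoly.mdegD mpoly.mdeg1 addn1 => H.
apply: leq_trans (H _) dp; move: mp; rewrite !mpoly.mcoeff_msupp mpoly.mcoeff_mderiv.
by apply: contraNN => /eqP ->; rewrite mul0rn.
Qed.

Lemma raviart_thomas_rot k (p : 'I_3 -> poly3) :
  (forall i, deg_le k.+1 (p i)) -> raviart_thomas k (pveval (poly_rot p)).
Proof.
move=> dp; exists (poly_rot p), 0; split => [i||x].
- by apply: deg_leB; exact: deg_le_mderiv.
- exact: mpoly.dhomog0.
- by rewrite /peval mpoly.meval0 scale0r addr0.
Qed.

Lemma weak_curl_curl (Omega : set (pt R)) u : Hcurl Omega u ->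
  weak_curl Omega u (curl Omega u).
Proof. by move=> [_ [w uw]]; exact: (xgetPex (fun=> 0) (ex_intro _ w uw)). Qed.

(** On the interior of a cell the weak curl is the curl of a polynomial field
    of degree at most k + 1, hence has degree at most k and needs no
    homogeneous part in the Raviart-Thomas form. The function curl Omega u is
    arbitrary outside Omega, while the discrete space constrains its elements
    on closed cells: there phi is given by the polynomial of the first cell
    containing the point, the overlap of two cells being a null set by
    conformity of the mesh. *)
Lemma curl_in_RTh (Omega : set (pt R)) (Th : seq 'M[R]_(3, 4)) k u :
  open Omega -> mesh Omega Th -> Nh0 Omega k Th u ->
  exists2 phi, RTh Omega k Th phi & forall x, Omega x -> phi x = curl Omega u x.
Proof.
move=> oO [ndT hT conf] [[cu _] pu].
have mO := open_measurable3 oO.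
have uw := weak_curl_curl cu.
have /choice[q qP] : forall K : 'M[R]_(3, 4), exists q : 'I_3 -> poly3, K \in Th ->
    (forall i, deg_le k.+1 (q i)) /\ {ae mu, forall x, hull K x -> u x = pveval q x}.
  move=> K; have [KT|nK] := boolP (K \in Th); last by exists (fun=> 0).
  have [v /nedelec_polynomial[q dq vq] uv] := pu _ KT.
  by exists q => _; split => //; apply: filterS uv => x uv Kx; rewrite uv.
pose cell x := nth 0 Th (first_cell Th x).
pose phi : vfield R := fun x =>
  if `[< Omega x >] then curl Omega u x else pveval (poly_rot (q (cell x))) x.
have phiO x : Omega x -> phi x = curl Omega u x by move=> Ox; rewrite /phi asboolT.
exists phi => //; split.
  have [Lw _] := uw; split.
    move=> i; have [mw iw] := Lw i; split.
      by apply: eq_measurable_fun mw => x; rewrite inE => /phiO ->.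
    by apply: eq_integrable iw => // x; rewrite inE => /phiO ->.
  exists (fun=> 0); have [Ld dv] := weak_div_curl uw; split => // p tp.
  rewrite dv//; congr (- _); apply: eq_Rintegral => x; rewrite inE => /phiO ->.
  by [].
move=> K KT; exists (pveval (poly_rot (q K))).
  by apply: raviart_thomas_rot; have [] := qP _ KT.
have [dq uq] := qP _ KT.
have inO : {ae mu, forall x, (cell_interior K `&` Omega) x -> curl Omega u x = pveval (poly_rot (q K)) x}.
  apply: (weak_curl_polynomial _ mO _ uw) => //.
  - by apply: openI => //; exact: cell_interior_open (ndT _ KT).
  - apply: filterS uq => x H [xi _]; apply: H; exact: (cell_interior_sub (ndT _ KT) xi).
have other : {ae mu, forall x, forall l : 'I_(size Th), nth 0 Th l != K ->
    ~ (hull (nth 0 Th l) x /\ hull K x)}.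
  apply: filter_forall => l; have [->|lK] := eqVneq (nth 0 Th l) K; first exact: aeW.
  have [I [_ [IT _ KI _]]] := conf _ _ (mem_nth 0 (ltn_ord l)) KT lK.
  apply: negligibleS (proper_face_null (ndT _ (mem_nth 0 (ltn_ord l))) IT) => x.
  by rewrite -KI => /not_implyP[_ /contrapT].
apply: filterS2 (ae_cell_interior (ndT _ KT)) (filterI inO other) => x xi [xO xl] Kx.
have [Ox|nO] := pselect (Omega x); first by rewrite phiO//; apply: xO; split => //; exact: xi.
rewrite /phi asboolF//.
have cover y : closure Omega y -> exists2 K, K \in Th & hull K y by rewrite -hT.
have clx : closure Omega x by rewrite -hT; exists K.
have [l lx lK] := first_cellP cover clx.
rewrite /cell lx; have [->//|neq] := eqVneq (nth 0 Th l) K.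
by have := xl l neq; case.
Qed.

End CurlOfPiecewisePolynomial.

(** * Fields depending on time *)

Section TimeDependentFields.
Context {R : realType} (Omega : set (pt R)) (T : R).
Hypothesis mOmega : measurable Omega.
Local Notation leb := (@lebesgue_measure R).
Local Notation mu := (@leb3 R).
Implicit Types (u du : R -> vfield R) (v : vfield R) (A : tensor R).

Lemma simple_in_time_L2 (s : R -> vfield R) t : simple_in_time Omega s -> L2 Omega (s t).
Proof.
move=> [m [A [w [mA Lw sE]]]].
rewrite (_ : s t = fun x => \sum_i \1_(A i) t *: w i x); last by apply/funext => x; rewrite sE.
by apply: L2_sum => // i; exact: L2Z.
Qed.

Lemma measurable_ip_simple (s : R -> vfield R) v : simple_in_time Omega s -> L2 Omega v ->
  measurable_fun setT (fun t => ip Omega (s t) v).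
Proof.
move=> [m [A [w [mA Lw sE]]]] Lv.
rewrite (_ : (fun t => _) = fun t => \sum_i \1_(A i) t * ip Omega (w i) v).
  by apply: measurable_sum => i; apply: measurable_funM => //; exact: measurable_indic.
apply/funext => t.
rewrite (_ : s t = fun x => \sum_i \1_(A i) t *: w i x); last by apply/funext => x; rewrite sE.
rewrite ip_suml// => [|i]; last exact: L2Z.
by apply: eq_bigr => i _; rewrite ipZl.
Qed.

(** The scalar products of v with the approximating simple functions are
    measurable and converge almost everywhere by the Cauchy-Schwarz
    inequality; their upper limit is a measurable representative, square-
    integrable because the norm of u is. *)
Lemma L2t_ip_integrable u v : L2t Omega T u -> L2 Omega v ->
  exists2 g : R -> R, leb.-integrable `]0, T] (EFin \o g) &
    {ae leb, forall t, t \in `]0, T[ -> g t = ip Omega (u t) v}.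
Proof.
move=> [Lu [s [simple_s su]] u2] Lv.
pose h n t := ip Omega (s n t) v; pose m t := fine (limn_esup (fun n => (h n t)%:E)).
have mm : measurable_fun setT m.
  apply: (measurableT_comp (fine_measurable (@measurableT _ _))).
  apply: measurable_fun_limn_esup => n; apply/measurable_EFinP; exact: measurable_ip_simple.
have mE : {ae leb, forall t, t \in `]0, T[ -> m t = ip Omega (u t) v}.
  apply: filterS2 Lu su => t Lut sut tT.
  have Lut' := Lut tT; have {}sut := sut tT.
  have cvh : h n t @[n --> \oo] --> ip Omega (u t) v.
    apply/cvgrPdist_le => e e0; have v1 : 0 < norm2 Omega v + 1 by have := norm2_ge0 Omega v; lra.
    have /cvgrPdist_le/(_ (e / (norm2 Omega v + 1)) (divr_gt0 e0 v1)) := sut.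
    apply: filterS => n; rewrite sub0r normrN (ger0_norm (norm2_ge0 _ _)) => hn.
    have Ls := simple_in_time_L2 t (simple_s n).
    rewrite distrC -ipBl//; apply: le_trans (CauchySchwarz _ _ _) _ => //; first exact: L2B.
    rewrite -[leRHS](@divfK _ (norm2 Omega v + 1)) ?gt_eqF//.
    by apply: ler_pM => //; [exact: norm2_ge0|exact: norm2_ge0|lra].
  rewrite /m.
  have cvE : (h n t)%:E @[n --> \oo] --> (ip Omega (u t) v)%:E by apply: cvg_EFin => //; exact: nearW.
  by have [_ ->] := cvg_limn_einf_sup cvE.
(* Dividing by the norm of v avoids scaling an integral whose integrand need not be measurable. *)
pose g t := (norm2 Omega v)^-1 * m t.
have mg : measurable_fun `]0, T[ g.
  by apply: (@measurable_funS _ _ _ _ setT) => //; exact: measurable_funM.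
have gu : {ae leb, forall t, t \in `]0, T[ -> `|g t| <= norm2 Omega (u t)}.
  apply: filterS2 Lu mE => t Lut mt tT; rewrite /g mt// normrM normfV (ger0_norm (norm2_ge0 Omega v)).
  have [v0|v0] := eqVneq (norm2 Omega v) 0; first by rewrite v0 invr0 mul0r norm2_ge0.
  have vp : 0 < norm2 Omega v by rewrite lt_neqAle eq_sym v0 norm2_ge0.
  by rewrite mulrC ler_pdivrMr//; apply: CauchySchwarz => //; exact: Lut.
have g2 : leb.-integrable `]0, T[ (EFin \o (fun t => g t ^+ 2)).
  apply/integrableP; split; first by apply/measurable_EFinP; exact: measurable_funX.
  apply: le_lt_trans u2; apply: ae_ge0_le_lower_integral => // [t|].
    by rewrite lee_fin sqr_ge0.
  apply: filterS gu => t gut tT; rewrite /= lee_fin normrX ler_pXn2r ?nnegrE ?norm2_ge0//.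
  exact: gut.
have ig : leb.-integrable `]0, T[ (EFin \o g).
  apply: (@le_integrable _ _ _ leb _ _ _ (EFin \o (fun t => 1 + g t ^+ 2))) => //.
  - exact/measurable_EFinP.
  - move=> t _; rewrite /= lee_fin [leRHS]ger0_norm ?addr_ge0 ?sqr_ge0//.
    by rewrite -[g t ^+ 2]real_normK ?num_real//; have := normr_ge0 (g t); nra.
  - apply: integrable_EFinD => //.
    apply: (@integrableS _ _ _ leb `[0, T]) => //; first exact: subset_itv_oo_cc.
    apply: continuous_compact_integrable; first exact: segment_compact.
    by apply: continuous_subspaceT => x; exact: cvg_cst.
exists ((fun t : R => norm2 Omega v * g t) \_ `]0, T[).
  apply: (@integrableS _ _ _ leb setT) => //.
  by rewrite -integrable_EFin_patch//; exact: integrable_EFinZl.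
apply: filterS2 Lu mE => t Lut mt tT; rewrite patchE mem_set// -mt// /g.
have [v0|v0] := eqVneq (norm2 Omega v) 0; last by rewrite mulrA divff// mul1r.
rewrite v0 mul0r mt//; apply/esym/eqP; rewrite -normr_le0 -[leRHS](mulr0 (norm2 Omega (u t))) -v0.
by apply: CauchySchwarz => //; exact: Lut.
Qed.

Lemma AC_ip V u du v : 0 < T -> H1t Omega T V u du -> L2 Omega v ->
  exists2 g, AC T (fun t => ip Omega (u t) v) g &
    {ae leb, forall t, t \in `]0, T[ -> g t = ip Omega (du t) v}.
Proof.
move=> T0 [_ _ _ Ldu uE] Lv; have [g ig gE] := L2t_ip_integrable Ldu Lv.
exists g => //; split => // t tT; rewrite (uE v Lv t tT); congr (_ + _).
transitivity (\int[leb]_(s in `]0, t[) g s).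
  apply: ae_eq_Rintegral; apply: filterS gE => s gE; rewrite /= in_itv/= => /andP[s0 st].
  by rewrite gE// in_itv/= s0 (lt_le_trans st)//; move: tT; rewrite in_itv/= => /andP[].
apply: Rintegral_itv_bndo_bndc; apply: integrableS ig => // s /= sI; apply: (sub_itv0 tT).
by apply: subset_itv_oo_oc sI.
Qed.

(** In an orthonormal basis of a space containing the values of u, the
    quadratic form is a polynomial in finitely many coordinates, which are
    primitives by [AC_ip]. Symmetry merges the two terms of the product rule. *)
Lemma AC_quadratic (J : finType) (w : J -> vfield R) V A u du : 0 < T ->
  (forall v, V v -> L2 Omega v /\ spanned Omega w v) ->
  Linfty_tensor Omega A -> sym_tensor Omega A -> H1t Omega T V u du ->
  exists2 g, AC T (fun t => ip Omega (act A (u t)) (u t)) g &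
    {ae leb, forall t, t \in `]0, T[ -> g t = 2 * ip Omega (act A (du t)) (u t)}.
Proof.
move=> T0 VL LA symA uH; have [uV duV _ _ _] := uH.
have [N [e [Le _ eV]]] := orthonormal_basis mOmega w.
pose a i j := ip Omega (act A (e i)) (e j).
have ipE v v' : V v -> V v' -> ip Omega (act A v) v' =
    \sum_i \sum_j a i j * (ip Omega v (e i) * ip Omega v' (e j)).
  move=> /VL[Lv sv] /VL[Lv' sv'].
  rewrite (ip_ae (act_ae A (eV v Lv sv)) (eV v' Lv' sv')) act_sum.
  have LAe i : L2 Omega (act A (e i)) by exact: L2_act.
  have LS : L2 Omega (fun x => \sum_i ip Omega v' (e i) *: e i x).
    by apply: L2_sum => // i; exact: L2Z.
  rewrite ip_suml// => [|i]; last exact: L2Z.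
  apply: eq_bigr => i _; rewrite ipZl// ip_sumr// => [|j]; last exact: L2Z.
  by rewrite mulr_sumr; apply: eq_bigr => j _; rewrite ipZr// /a; ring.
have /choice[g gP] : forall i, exists g, AC T (fun t => ip Omega (u t) (e i)) g /\
    {ae leb, forall t, t \in `]0, T[ -> g t = ip Omega (du t) (e i)}.
  by move=> i; have [g ? ?] := AC_ip T0 uH (Le i); exists g.
exists (fun t => \sum_i \sum_j a i j * (g i t * ip Omega (u t) (e j) + g j t * ip Omega (u t) (e i))).
  apply: (@AC_ext _ _ _ (fun t => \sum_i \sum_j a i j * (ip Omega (u t) (e i) * ip Omega (u t) (e j)))).
  - exact: T0.
  - by move=> t tT; rewrite ipE//; exact: uV.
  - do 2!(apply: AC_sum => // ?); apply: AC_Z => //.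
    exact: (AC_M T0 (proj1 (gP _)) (proj1 (gP _))).
have allg : {ae leb, forall t, forall i, t \in `]0, T[ -> g i t = ip Omega (du t) (e i)}.
  by apply: filter_forall => i; have [] := gP i.
apply: filterS2 duV allg => t Vdu gt tT.
have Vut : V (u t) by apply: uV; exact: subset_itv_oo_cc tT.
transitivity (ip Omega (act A (du t)) (u t) + ip Omega (act A (u t)) (du t)).
  rewrite !ipE//; last 2 first.
  - exact: Vdu.
  - exact: Vdu.
  rewrite -big_split; apply: eq_bigr => i _; rewrite -big_split; apply: eq_bigr => j _.
  by rewrite !gt//=; ring.
by rewrite (ip_act_sym _ _ symA) mulrDl mul1r.
Qed.

End TimeDependentFields.

(** * The energy identity *)

Section DiscreteSpaces.
Context {R : realType} (Omega : set (pt R)) (Th : seq 'M[R]_(3, 4)) (k : nat).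
Hypotheses (oOmega : open Omega) (meshT : mesh Omega Th).
Let mOmega : measurable Omega := open_measurable3 oOmega.

Lemma mesh_cover x : Omega x -> exists2 K, K \in Th & hull K x.
Proof. by have [_ hT _] := meshT => /subset_closure; rewrite -hT. Qed.

Lemma Nh0_L2 v : Nh0 Omega k Th v -> L2 Omega v.
Proof. by move=> [[[]]]. Qed.

Lemma RTh_L2 v : RTh Omega k Th v -> L2 Omega v.
Proof. by move=> [[]]. Qed.

Lemma Nh0_spanned v : Nh0 Omega k Th v ->
  L2 Omega v /\ spanned Omega (@shape_function R Th k.+1) v.
Proof.
move=> vN; split; first exact: Nh0_L2.
apply: (piecewise_spanned mesh_cover) => K KT; have [w wN vw] := vN.2 K KT.
by exists w => //; exact: nedelec_polynomial wN.
Qed.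

Lemma RTh_spanned v : RTh Omega k Th v ->
  L2 Omega v /\ spanned Omega (@shape_function R Th k.+1) v.
Proof.
move=> vN; split; first exact: RTh_L2.
apply: (piecewise_spanned mesh_cover) => K KT; have [w wN vw] := vN.2 K KT.
by exists w => //; exact: raviart_thomas_polynomial wN.
Qed.

(** Let phi in RT_h agree with curl u on Omega. The equation for the test
    fields w and phi gives (w + phi, w) = (w + phi, phi) = 0, so that w + phi
    has norm zero. *)
Lemma faraday_strong u w : Nh0 Omega k Th u -> RTh Omega k Th w ->
  (forall phi, RTh Omega k Th phi -> ip Omega w phi + ip Omega (curl Omega u) phi = 0) ->
  ae_eq_on Omega w (fun x => - curl Omega u x) /\ L2 Omega (curl Omega u).
Proof.
move=> uN wR eqw; have [phi phiR phiE] := curl_in_RTh oOmega meshT uN.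
have [Lw Lphi] := (RTh_L2 wR, RTh_L2 phiR).
have phiC : ae_eq_on Omega (curl Omega u) phi by apply: aeW => x Ox; rewrite phiE.
have Lc : L2 Omega (curl Omega u).
  by have [[cu _] _] := uN; have [] := weak_curl_curl cu.
split => //.
have := eqw _ wR; have := eqw _ phiR.
rewrite !(ip_ae phiC (ae_eq_on_refl _ _)) => e1 e2.
have Ls : L2 Omega (fun x => w x + phi x) by exact: L2D.
have /(ip_def mOmega Ls) : ip Omega (fun x => w x + phi x) (fun x => w x + phi x) = 0.
  by rewrite ipDl// !ipDr// addrACA e2 add0r e1.
by apply: filterS2 phiC => x cE wE Ox; rewrite cE//; apply/eqP; rewrite -addr_eq0; apply/eqP/wE.
Qed.

Variables (T : R) (eps mu sigma : tensor R) (f E B : R -> vfield R).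
Hypotheses (T0 : 0 < T).
Hypotheses (Leps : Linfty_tensor Omega eps) (seps : sym_tensor Omega eps) (peps : psd_tensor Omega eps).
Hypotheses (Lnu : Linfty_tensor Omega (tinv mu)) (snu : sym_tensor Omega (tinv mu))
  (pnu : psd_tensor Omega (tinv mu)).
Hypothesis scheme : semidiscrete Omega T eps mu sigma f k Th E B.

Lemma energyE t : energy Omega eps mu E B t =
  2^-1 * (ip Omega (act eps (E t)) (E t) + ip Omega (act (tinv mu) (B t)) (B t)).
Proof. by rewrite /energy !sqr_norm2_act_tsqrt. Qed.

(** With psi = E(t), the coupling term (mu^-1 B, curl E) equals - (mu^-1 d_t
    B, B) by Faraday's law and the symmetry of mu^-1; it is thus minus the
    derivative of the magnetic energy. *)
Lemma energy_AC : exists2 g, AC T (energy Omega eps mu E B) g &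
  {ae @lebesgue_measure R, forall t, t \in `]0, T[ ->
     g t = ip Omega (f t) (E t) - ip Omega (act sigma (E t)) (E t)}.
Proof.
have [dE [dB [EH BH eqE eqB]]] := scheme.
have [gE aE gEE] := AC_quadratic mOmega T0 Nh0_spanned Leps seps EH.
have [gB aB gBE] := AC_quadratic mOmega T0 RTh_spanned Lnu snu BH.
exists (fun t => 2^-1 * (gE t + gB t)).
  apply: (@AC_ext _ _ T0 (fun t => 2^-1 * (ip Omega (act eps (E t)) (E t) + ip Omega (act (tinv mu) (B t)) (B t)))).
    by move=> t _; rewrite energyE.
  by apply: AC_Z => //; exact: AC_D.
have [EN _ _ _ _] := EH; have [BR dBR _ _ _] := BH.
apply: (filterS _ (filterI (filterI gEE gBE) (filterI dBR (filterI eqE eqB)))) => t [[gEt gBt] [dBt [eqEt eqBt]]] tT.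
have tT' : t \in `[0, T] by exact: subset_itv_oo_cc tT.
have [ENt BRt] := (EN _ tT', BR _ tT').
have [dBE Lc] := faraday_strong ENt (dBt tT) (eqBt tT).
have := eqEt tT _ ENt.
(* Faraday's law inserted in the coupling term. *)
have -> : ip Omega (act (tinv mu) (B t)) (curl Omega (E t)) = - ip Omega (act (tinv mu) (dB t)) (B t).
  rewrite (ip_act_sym (dB t) _ snu) (ip_ae (ae_eq_on_refl _ _) dBE).
  have LB : L2 Omega (act (tinv mu) (B t)) by apply: L2_act => //; exact: RTh_L2 BRt.
  rewrite (_ : (fun x => - curl Omega (E t) x) = fun x => (-1) *: curl Omega (E t) x).
    by rewrite ipZr// mulN1r opprK.
  by apply/funext => x; rewrite scaleN1r.
by rewrite gEt// gBt// => <-; field.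
Qed.

End DiscreteSpaces.

(** * A Gronwall inequality *)

Section Gronwall.
Context {R : realType}.
Local Notation leb := (@lebesgue_measure R).

(** The function exp(-t) F(t) is a primitive of h = exp(-t) (g - F), whose
    positive part is at most c n^2. No measurability of n is at hand, so that
    the positive part of h, which is measurable, is compared with it as a
    lower integral. *)
Lemma gronwall (T c : R) (F g n : R -> R) : 0 < T -> 0 < c -> AC T F g -> 0 <= F 0 ->
  {ae leb, forall t, t \in `]0, T[ -> g t - F t <= c * n t ^+ 2} ->
  (\int[leb]_(t in `]0%R, T[) (n t ^+ 2)%:E < +oo)%E ->
  forall t, t \in `[0, T] ->
    F t <= expR T * F 0 + expR T * c * \int[leb]_(s in `]0, T[) n s ^+ 2.
Proof.
move=> T0 c0 aF F0 gFn n2 t tT.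
pose em (s : R) := expR (- s).
have aem : AC T em (fun s => - em s).
  apply: AC_C1 => [s|].
  - have := @is_derive1_comp R expR (fun s => - s) s _ _ (is_derive_expR _) (is_deriveNid s 1).
    by rewrite mulrN1.
  - by move=> s; apply: cvgN; apply: (@continuous_comp _ _ _ (fun s : R => - s) expR); [exact: opp_continuous|exact: continuous_expR].
have aG := AC_M T0 aem aF; set h := (X in AC _ _ X) in aG.
have [ih hE] := aG.
have ht : leb.-integrable `]0, t] (EFin \o h) by exact: AC_integrable aG tT.
have ht' : leb.-integrable `]0, t[ (EFin \o h).
  by apply: integrableS ht => //; exact: subset_itv_oo_oc.
(* The factor 1 / c is put on h, as an integral of a function that may fail to be
   measurable need not be homogeneous. *)
pose p s := c^-1 * Num.max (h s) 0.
have ip : leb.-integrable `]0, t[ (EFin \o p).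
  apply: integrable_EFinZl => //.
  have mt : measurable (`]0, t[%classic : set R) by exact: measurable_itv.
  have := @integrable_funepos _ _ _ leb _ mt _ ht'; apply: eq_integrable => // s _.
  by rewrite /= funeposE EFin_max.
have lep : (\int[leb]_(s in `]0%R, t[) (p s)%:E <= \int[leb]_(s in `]0%R, T[) (n s ^+ 2)%:E)%E.
  rewrite integral_mkcond [leRHS]integral_mkcond.
  apply: ae_ge0_le_lower_integral.
  - by move=> s; rewrite patchE; case: ifP => // _; rewrite lee_fin mulr_ge0 ?invr_ge0 ?(ltW c0)// le_max lexx orbT.
  - by move=> s; rewrite patchE; case: ifP => // _; rewrite lee_fin sqr_ge0.
  apply: filterS gFn => s gFs _; rewrite !patchE; case: ifPn => [|_]; last first.
    by case: ifP => // _; rewrite lee_fin sqr_ge0.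
  rewrite inE /= in_itv/= => /andP[s0 st].
  have sT : s \in `]0, T[.
    by rewrite in_itv/= s0 (lt_le_trans st)//; move: tT; rewrite in_itv/= => /andP[].
  rewrite mem_set// lee_fin /p mulrC ler_pdivrMr// ge_max mulrC.
  have K0 : 0 <= c * n s ^+ 2 by rewrite mulr_ge0 ?sqr_ge0// ltW.
  rewrite K0 andbT /h (_ : _ + _ = em s * (g s - F s)); last by ring.
  have e0 : 0 <= em s by exact: expR_ge0.
  apply: le_trans (ler_wpM2l e0 (gFs sT)) _; rewrite ler_piMl//.
  by rewrite /em -expR0 ler_expR oppr_le0 ltW.
have fin2 : (\int[leb]_(s in `]0%R, T[) (n s ^+ 2)%:E)%E \is a fin_num.
  by rewrite ge0_fin_numE// integral_ge0// => s _; rewrite lee_fin sqr_ge0.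
have I0 : 0 <= \int[leb]_(s in `]0, T[) n s ^+ 2 by apply: Rintegral_ge0 => s _; exact: sqr_ge0.
have hI : \int[leb]_(s in `]0, t]) h s <= c * \int[leb]_(s in `]0, T[) n s ^+ 2.
  rewrite -Rintegral_itv_bndo_bndc//.
  apply: (@le_trans _ _ (\int[leb]_(s in `]0, t[) (c * p s))).
    apply: le_Rintegral => //; first exact: integrable_EFinZl.
    by move=> s _; rewrite /p mulVKf ?gt_eqF// le_max lexx.
  rewrite RintegralZl// ler_pM2l//; apply: fine_le => //; exact: integrable_fin_num.
have := hE t tT; rewrite /em oppr0 expR0 mul1r => GE.
have -> : F t = expR t * (expR (- t) * F t) by rewrite mulrA -expRD subrr expR0 mul1r.
rewrite GE; have /andP[t0 t1] : 0 <= t <= T by move: tT; rewrite in_itv.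
apply: (@le_trans _ _ (expR t * (F 0 + c * \int[leb]_(s in `]0, T[) n s ^+ 2))).
  by rewrite ler_pM2l ?expR_gt0// lerD2l.
rewrite -mulrA -mulrDr ler_wpM2r ?ler_expR// addr_ge0// mulr_ge0// ltW//.
Qed.
End Gronwall.

(** * Energy and stability estimates *)

Section EnergyEstimate.
Context {R : realType} (Omega : set (pt R)) (T : R) (eps mu : tensor R) (eps0 b : R).
Hypotheses (oOmega : open Omega) (T0 : 0 < T).
Hypotheses (Leps : Linfty_tensor Omega eps) (seps : sym_tensor Omega eps).
Hypotheses (eps0_gt0 : 0 < eps0) (ceps : coercive Omega eps0 eps).
Hypotheses (Lnu : Linfty_tensor Omega (tinv mu)) (snu : sym_tensor Omega (tinv mu)).
Hypotheses (b_gt0 : 0 < b) (cnu : coercive Omega b (tinv mu)).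
Local Notation leb := (@lebesgue_measure R).
Let mOmega : measurable Omega := open_measurable3 oOmega.
Let peps : psd_tensor Omega eps := coercive_psd_tensor eps0_gt0 ceps.
Let pnu : psd_tensor Omega (tinv mu) := coercive_psd_tensor b_gt0 cnu.
Local Notation energy := (energy Omega eps mu).

Lemma energy_ge_E (E B : R -> vfield R) t : L2 Omega (E t) ->
  eps0 * norm2 Omega (E t) ^+ 2 <= 2 * energy E B t.
Proof.
move=> LE; rewrite (energyE _ _ seps peps snu pnu) mulVKf// sqr_norm2.
have h1 := coercive_ip mOmega Leps seps ceps LE.
have h2 := psd_ip_ge0 (B t) pnu.
lra.
Qed.

Lemma energy_ge_B (E B : R -> vfield R) t : L2 Omega (B t) ->
  b * norm2 Omega (B t) ^+ 2 <= 2 * energy E B t.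
Proof.
move=> LB; rewrite (energyE _ _ seps peps snu pnu) mulVKf// sqr_norm2.
have h1 := coercive_ip mOmega Lnu snu cnu LB.
have h2 := psd_ip_ge0 (E t) peps.
lra.
Qed.

Section Scheme.
Variables (Th : seq 'M[R]_(3, 4)) (k : nat) (sigma : tensor R) (f E B : R -> vfield R).
Hypotheses (meshT : mesh Omega Th) (ssigma : sym_tensor Omega sigma) (psigma : psd_tensor Omega sigma).
Hypothesis Lf : L2t Omega T f.
Hypothesis scheme : semidiscrete Omega T eps mu sigma f k Th E B.

Lemma scheme_L2 t : t \in `[0, T] -> L2 Omega (E t) /\ L2 Omega (B t).
Proof.
move=> tT; have [dE [dB [[EN _ _ _ _] [BR _ _ _ _] _ _]]] := scheme.
by split; [exact: Nh0_L2 (EN _ tT)|exact: RTh_L2 (BR _ tT)].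
Qed.

Lemma energy_identity : {ae leb, forall t, t \in `]0, T[ ->
  derivable (energy E B) t 1 /\
  derive1 (energy E B) t + norm2 Omega (act (tsqrt sigma) (E t)) ^+ 2 = ip Omega (f t) (E t)}.
Proof.
have [g aE gE] := energy_AC oOmega meshT T0 Leps seps peps Lnu snu pnu scheme.
apply: (filterS _ (filterI (AC_derivable aE) gE)) => t [dt gt] tT.
have [dE dEE] := dt tT; split => //.
by rewrite dEE gt// sqr_norm2_act_tsqrt// subrK.
Qed.

(** Since the energy is at least eps0 |E|^2 / 2, its derivative minus itself
    is at most |f| |E| - eps0 |E|^2 / 2 <= |f|^2 / (2 eps0). *)
Lemma energy_bound t : t \in `[0, T] ->
  energy E B t <= expR T * energy E B 0 +
    expR T / (2 * eps0) * \int[leb]_(s in `]0, T[) norm2 Omega (f s) ^+ 2.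
Proof.
have [g aE gE] := energy_AC oOmega meshT T0 Leps seps peps Lnu snu pnu scheme.
have [Lfs _ f2] := Lf.
have c0 : 0 < (2 * eps0)^-1 by rewrite invr_gt0 mulr_gt0.
apply: (gronwall (n := fun s => norm2 Omega (f s)) T0 c0 aE _ _ f2).
  by rewrite (energyE _ _ seps peps snu pnu) mulr_ge0 ?addr_ge0 ?psd_ip_ge0.
apply: (filterS _ (filterI Lfs gE)) => s [Lfs' gs] sT.
have [LE LB] := scheme_L2 (subset_itv_oo_cc sT).
have hE := energy_ge_E B LE; have hs := psd_ip_ge0 (E s) psigma.
have := CauchySchwarz mOmega (Lfs' sT) LE.
have := ler_norm (ip Omega (f s) (E s)).
rewrite gs//; move: hE hs; set F := norm2 _ (f s); set N := norm2 _ (E s).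
move: (energy E B s) (ip _ _ (E s)) (ip _ _ (E s)) => En I J hE hs h1 h2.
have h : 0 <= (2 * eps0)^-1 * (F - eps0 * N) ^+ 2 by rewrite mulr_ge0 ?sqr_ge0// ltW.
have hh : (2 * eps0)^-1 * (F - eps0 * N) ^+ 2 =
   (2 * eps0)^-1 * F ^+ 2 - F * N + eps0 * N ^+ 2 / 2 by field; exact: lt0r_neq0.
move: h; rewrite hh => h; lra.
Qed.

Lemma energy_sup :
  (ereal_sup [set (energy E B t)%:E | t in `[0%R, T]]
   <= (expR T * energy E B 0 +
       expR T / (2 * eps0) * \int[leb]_(s in `]0, T[) norm2 Omega (f s) ^+ 2)%:E)%E.
Proof.
by apply: ge_ereal_sup => _ [t tT <-]; rewrite lee_fin; exact: energy_bound.
Qed.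

Lemma norm_Linft_le (u : R -> vfield R) (M : R) : 0 <= M ->
  (forall t, t \in `[0, T] -> norm2 Omega (u t) <= M) -> (norm_Linft Omega T u <= M%:E)%E.
Proof.
move=> M0 uM; apply/ess_supP; apply: aeW => t; rewrite patchE.
case: ifPn => [|_]; last by rewrite lee_fin.
by rewrite inE lee_fin => tT; apply: uM; exact: subset_itv_oo_cc tT.
Qed.

(** With S the sum of the three data norms, the energy at time 0 is at most
    (Ceps + Cnu) S^2 / 2 and the integral of |f|^2 at most S^2, so that
    [energy_bound] keeps the energy below K S^2. Coercivity then bounds |E|^2
    by 2 K S^2 / eps0 and |B|^2 by 2 K S^2 / b. *)
Lemma stability (Ceps Cnu : R) (E0 : vfield R) (beta : R) : 0 <= Ceps -> 0 <= Cnu ->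
  (forall u, L2 Omega u -> ip Omega (act eps u) u <= Ceps * ip Omega u u) ->
  (forall u, L2 Omega u -> ip Omega (act (tinv mu) u) u <= Cnu * ip Omega u u) ->
  norm2 Omega (E 0) <= norm2 Omega E0 -> norm2 Omega (B 0) <= beta ->
  (norm_Linft Omega T E + norm_Linft Omega T B <=
   ((Num.sqrt (2 * (expR T * ((Ceps + Cnu) / 2 + (2 * eps0)^-1)) / eps0) +
     Num.sqrt (2 * (expR T * ((Ceps + Cnu) / 2 + (2 * eps0)^-1)) / b)) *
    (norm_L2t Omega T f + norm2 Omega E0 + beta))%:E)%E.
Proof.
move=> Ce0 Cn0 epsC nuC E0le B0le.
set K := expR T * _; set S := _ + beta.
have b0 : 0 <= beta by apply: le_trans B0le; exact: norm2_ge0.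
have [F0 e0] : 0 <= norm_L2t Omega T f /\ 0 <= norm2 Omega E0 by split; exact: sqrtr_ge0.
have S0 : 0 <= S by rewrite !addr_ge0.
have c0 : 0 < (2 * eps0)^-1 by rewrite invr_gt0 mulr_gt0.
have K0 : 0 <= K by rewrite mulr_ge0 ?expR_ge0// addr_ge0 ?(ltW c0)// divr_ge0// addr_ge0.
have in0 : 0 \in `[0, T] by rewrite in_itv/= lexx ltW.
have FE : norm_L2t Omega T f ^+ 2 = \int[leb]_(s in `]0, T[) norm2 Omega (f s) ^+ 2.
  by rewrite sqr_sqrtr// Rintegral_ge0// => s _; exact: sqr_ge0.
have enS t : t \in `[0, T] -> energy E B t <= K * S ^+ 2.
  move=> tT; apply: le_trans (energy_bound tT) _; rewrite -FE.
  have [LE LB] := scheme_L2 in0.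
  have := epsC _ LE; have := nuC _ LB; rewrite -!sqr_norm2 => hB hE.
  have E0S : norm2 Omega (E 0) ^+ 2 <= S ^+ 2.
    rewrite ler_pXn2r ?nnegrE ?norm2_ge0//; apply: le_trans E0le _.
    by rewrite /S; lra.
  have B0S : norm2 Omega (B 0) ^+ 2 <= S ^+ 2.
    rewrite ler_pXn2r ?nnegrE ?norm2_ge0//; apply: le_trans B0le _.
    by rewrite /S; lra.
  have FS : norm_L2t Omega T f ^+ 2 <= S ^+ 2.
    by rewrite ler_pXn2r ?nnegrE// /S; lra.
  have en0 : energy E B 0 <= (Ceps + Cnu) / 2 * S ^+ 2.
    rewrite (energyE _ _ seps peps snu pnu).
    have := ler_wpM2l Ce0 E0S; have := ler_wpM2l Cn0 B0S; lra.
  have fS := ler_wpM2l (ltW c0) FS.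
  rewrite -[X in _ + X <= _]mulrA -mulrDr /K -mulrA ler_wpM2l ?expR_ge0// [leRHS]mulrDl.
  exact: lerD.
have bnd (a : R) (x : R) (e : R) : 0 < a -> 0 <= x -> a * x ^+ 2 <= 2 * e -> e <= K * S ^+ 2 ->
    x <= Num.sqrt (2 * K / a) * S.
  move=> a0 x0 h1 h2.
  rewrite -(ler_pXn2r (ltn0Sn 1)) ?nnegrE ?mulr_ge0 ?sqrtr_ge0// exprMn sqr_sqrtr; last first.
    by apply: divr_ge0; [exact: mulr_ge0|exact: ltW].
  by rewrite mulrAC ler_pdivlMr// mulrC; lra.
rewrite mulrDl EFinD; apply: leeD; apply: norm_Linft_le.
- by rewrite mulr_ge0 ?sqrtr_ge0.
- move=> t tT; have [LE LB] := scheme_L2 tT.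
  exact: (bnd _ _ _ eps0_gt0 (norm2_ge0 _ _) (energy_ge_E B LE) (enS _ tT)).
- by rewrite mulr_ge0 ?sqrtr_ge0.
- move=> t tT; have [LE LB] := scheme_L2 tT.
  exact: (bnd _ _ _ b_gt0 (norm2_ge0 _ _) (energy_ge_B E LB) (enS _ tT)).
Qed.

End Scheme.
End EnergyEstimate.

(** Test with the projection itself. *)
Lemma norm2_projection (R : realType) (Omega : set (pt R)) (V : set (vfield R)) (u v : vfield R) :
  measurable Omega -> L2 Omega u -> L2 Omega v -> L2_projection Omega V u v ->
  norm2 Omega v <= norm2 Omega u.
Proof.
move=> mO Lu Lv [Vv vE]; have := CauchySchwarz mO Lu Lv.
rewrite -(vE _ Vv) ger0_norm ?ip_ge0// -sqr_norm2 expr2.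
have := norm2_ge0 Omega v; rewrite le_eqVlt => /predU1P[<-|v0]; first by rewrite norm2_ge0.
by rewrite ler_pM2r.
Qed.

Theorem lemma4 (R : realType) (Omega : set (pt R)) (T : R) (eps mu : tensor R)
    (eps0 mu0 : R)
    (hOmega : bounded_lipschitz_domain Omega) (hT : 0 < T)
    (heps : Linfty_tensor Omega eps) (heps_sym : sym_tensor Omega eps)
    (heps0 : 0 < eps0) (heps_coer : coercive Omega eps0 eps)
    (hmu : Linfty_tensor Omega mu) (hmu_sym : sym_tensor Omega mu)
    (hmu0 : 0 < mu0) (hmu_coer : coercive Omega mu0 mu) :
  exists CT : R,
  forall (sigma : tensor R) (f : R -> vfield R) (E0 B0 : vfield R) (k : nat)
    (Th : nat -> seq 'M[R]_(3, 4)) (E B : nat -> R -> vfield R),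
    Linfty_tensor Omega sigma -> sym_tensor Omega sigma ->
    psd_tensor Omega sigma ->
    L2t Omega T f ->
    L2 Omega E0 -> L2 Omega B0 -> weak_div Omega B0 (fun=> 0) ->
    (forall n, mesh Omega (Th n)) -> shape_regular Th ->
    mesh_size (Th n) @[n --> \oo] --> (0 : R) ->
    (forall n, semidiscrete Omega T eps mu sigma f k (Th n) (E n) (B n)) ->
    (forall n, L2_projection Omega (Nh0 Omega k (Th n)) E0 (E n 0)) ->
    (forall n, discretely_div_free Omega k (Th n) (B n 0)) ->
    norm2 Omega (fun x => B n 0 x - B0 x) @[n --> \oo] --> (0 : R) ->
    [/\ forall n, {ae @lebesgue_measure R, forall t, t \in `]0, T[ ->
          derivable (energy Omega eps mu (E n) (B n)) t 1 /\
          derive1 (energy Omega eps mu (E n) (B n)) t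
          + norm2 Omega (act (tsqrt sigma) (E n t)) ^+ 2
          = ip Omega (f t) (E n t)},
        forall n,
          (ereal_sup [set (energy Omega eps mu (E n) (B n) t)%:E | t in `[0%R, T]]
           <= (expR T * energy Omega eps mu (E n) (B n) 0
               + expR T / (2 * eps0)
                 * \int[@lebesgue_measure R]_(s in `]0, T[)
                     norm2 Omega (f s) ^+ 2)%:E)%E,
        0 < norm_L2t Omega T f + norm2 Omega E0 + norm2 Omega B0 ->
          (exists C : R, forall n,
             stability_bound Omega T C f E0 B0 (E n) (B n)) /\
          (\forall n \near \oo,
             stability_bound Omega T CT f E0 B0 (E n) (B n))
      & forall n, norm2 Omega (B n 0) <= norm2 Omega B0 ->
          stability_bound Omega T CT f E0 B0 (E n) (B n)].
Proof.
have [oO _ _ _ _] := hOmega; have mO := open_measurable3 oO.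
have Lnu := Linfty_tinv mO hmu0 hmu hmu_sym hmu_coer.
have snu := sym_tinv hmu_sym.
have [b b0 cnu] := coercive_tinv hmu0 hmu hmu_sym hmu_coer.
have [Ce Ce0 epsC] := bounded_ip mO heps.
have [Cn Cn0 nuC] := bounded_ip mO Lnu.
pose K := expR T * ((Ce + Cn) / 2 + (2 * eps0)^-1).
pose C0 := Num.sqrt (2 * K / eps0) + Num.sqrt (2 * K / b).
have C00 : 0 <= C0 by rewrite addr_ge0 ?sqrtr_ge0.
(* C0 is the constant for data in which |B_h(0)| replaces |B_0|; the factor 2 absorbs
   their difference, which is eventually at most the sum of the data norms. *)
exists (2 * C0) => sigma f E0 B0 k Th E B _ ssig psig Lf LE0 LB0 _ hTh _ _ hs hE0 hB0 hBn.
pose S := norm_L2t Omega T f + norm2 Omega E0 + norm2 Omega B0.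
have SD r : norm_L2t Omega T f + norm2 Omega E0 + (norm2 Omega B0 + r) = S + r.
  by rewrite addrA.
have bound n beta : norm2 Omega (B n 0) <= beta ->
    (norm_Linft Omega T (E n) + norm_Linft Omega T (B n) <=
     (C0 * (norm_L2t Omega T f + norm2 Omega E0 + beta))%:E)%E.
  move=> Bb.
  have LEn : L2 Omega (E n 0) by exact: Nh0_L2 (hE0 n).1.
  have E0le := norm2_projection mO LE0 LEn (hE0 n).
  exact: (stability oO hT heps heps_sym heps0 heps_coer Lnu snu b0 cnu (hTh n) psig
    Lf (hs n) Ce0 Cn0 epsC nuC E0le Bb).
have [F0 e0] : 0 <= norm_L2t Omega T f /\ 0 <= norm2 Omega E0 by split; exact: sqrtr_ge0.
pose d n := norm2 Omega (fun x => B n 0 x - B0 x).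
have d0 n : 0 <= d n by exact: norm2_ge0.
have Bd n : norm2 Omega (B n 0) <= norm2 Omega B0 + d n.
  have LBn : L2 Omega (B n 0) by exact: RTh_L2 (hB0 n).1.
  have -> : norm2 Omega (B n 0) = norm2 Omega (fun x => B0 x + (B n 0 x - B0 x)).
    by congr norm2; apply/funext => x; rewrite addrC subrK.
  by apply: norm2_triangle => //; exact: L2B.
split.
- by move=> n; exact: (energy_identity oO hT heps heps_sym heps0 heps_coer Lnu snu b0 cnu (hTh n) ssig psig (hs n)).
- by move=> n; exact: (energy_sup oO hT heps heps_sym heps0 heps_coer Lnu snu b0 cnu (hTh n) psig Lf (hs n)).
- rewrite -/S => S0.
  have dlt (e : R) : 0 < e -> \forall n \near \oo, d n <= e.
    move=> e_gt0; have /cvgrPdist_le/(_ e e_gt0) := hBn.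
    by apply: filterS => n; rewrite sub0r normrN (ger0_norm (d0 n)).
  split.
    have [N _ dN] := dlt 1 ltr01.
    (* The first N meshes are not controlled by the convergence of the initial data. *)
    pose M := 1 + \sum_(i < N) d i.
    have dM n : d n <= M.
      rewrite /M; have [Nn|nN] := leqP N n.
        by apply: le_trans (dN n Nn) _; rewrite lerDl sumr_ge0.
      rewrite (bigD1 (Ordinal nN))//= addrCA lerDl addr_ge0// sumr_ge0//.
    exists (C0 * (S + M) / S) => n.
    rewrite /stability_bound -/S divfK ?gt_eqF//.
    have := bound n (norm2 Omega B0 + M).
    rewrite SD; apply.
    by apply: le_trans (Bd n) _; rewrite lerD2l.
  have := dlt S S0; apply: filterS => n dS; rewrite /stability_bound -/S.
  have := bound n (norm2 Omega B0 + S); rewrite SD.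
  rewrite (_ : C0 * (S + S) = 2 * C0 * S); last by ring.
  by apply; apply: le_trans (Bd n) _; rewrite lerD2l.
- move=> n /bound; rewrite -/S /stability_bound => /le_trans; apply.
  by rewrite lee_fin -/S -mulrA ler_peMl ?ler1n// mulr_ge0// !addr_ge0 ?norm2_ge0.
Qed.
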